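(* Let $M$ be a connected smooth manifold of dimension $n\ge2$ with a smooth symmetric affine connection $\Gamma$ and a smooth everywhere non-degenerate operator field $\mathbf A$ of type $(1,1)$, and consider the system $$\frac{\partial y^i}{\partial t}=\sum_{j=1}^nA^i_j\Big(\frac{\partial^2y^j}{\partial x^2}+\sum_{r,s=1}^n\Gamma^j_{rs}\frac{\partial y^r}{\partial x}\frac{\partial y^s}{\partial x}\Big),\quad i=1,\dots,n.$$ Suppose that the system belongs to the $m$-th case of intermediate degeneration for some $1\le m\le n-1$, and that its algebra of point symmetries has the maximal dimension $\dim\mathcal G=n(n+1-m)+\frac{m(m-1)}2$. Then (near every point of $M$) there is a point transformation $\tilde y^i=\tilde y^i(y^1,\dots,y^n)$, i.e. a change of local coordinates on $M$, bringing the system to the form (tildes omitted) $$\frac{\partial y^i}{\partial t}=a\,\frac{\partial^2y^i}{\partial x^2}-2a\Big(\sum_{r=1}^m\frac{\partial\psi}{\partial y^r}\frac{\partial y^r}{\partial x}\Big)\frac{\partial y^i}{\partial x},\quad i=1,\dots,n,$$ where $a=\mathrm{const}$ and $\psi=\psi(y^1,\dots,y^m)$ is some scalar field depending on $y^1,\dots,y^m$ only.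
   Context: The coefficients $A^i_j$, $\Gamma^j_{rs}=\Gamma^j_{sr}$ are functions of $y^1,\dots,y^n$ only; the $y^i$ are local coordinates on $M$, and under change of coordinates $A^i_j$ transform as a $(1,1)$ tensor and $\Gamma^j_{rs}$ as an affine connection. Point symmetries: a vector field $\boldsymbol\eta=\sum_i\eta^i(y)\,\partial/\partial y^i$ on $M$ whose local flow carries solutions to solutions ($x,t$ unchanged); this is expressed by the determining equations, which (for non-degenerate $\mathbf A$) read: $L_{\boldsymbol\eta}\mathbf A=0$ and $$\sum_k\frac{\partial\eta^i}{\partial y^k}\Gamma^k_{rs}=\frac{\partial^2\eta^i}{\partial y^r\partial y^s}+\sum_k\Big(\frac{\partial\Gamma^i_{rs}}{\partial y^k}\eta^k+\Gamma^i_{ks}\frac{\partial\eta^k}{\partial y^r}+\Gamma^i_{rk}\frac{\partial\eta^k}{\partial y^s}\Big)$$ (i.e. $\boldsymbol\eta$ is an infinitesimal affine transformation of $\Gamma$). $\mathcal G$ is the real Lie algebra of all point symmetries on $M$. Curvature: $R^i_{srk}=\frac{\partial\Gamma^i_{ks}}{\partial y^r}-\frac{\partial\Gamma^i_{rs}}{\partial y^k}+\sum_q(\Gamma^q_{ks}\Gamma^i_{rq}-\Gamma^q_{rs}\Gamma^i_{kq})$. Ricci tensor: $R_{ij}=\sum_kR^k_{ikj}$, with symmetric part $\hat R_{ij}=\frac12(R_{ij}+R_{ji})$. The system belongs to the $m$-th case of intermediate degeneration ($1\le m\le n-1$) if the rank of $(\hat R_{ij})$ equals $m$ everywhere on $M$.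 *)

(* Defs.v *)
From mathcomp Require Import all_boot all_order all_algebra.
From mathcomp Require Import all_classical all_reals all_analysis.
Import Order.TTheory GRing.Theory Num.Theory.
Import numFieldNormedType.Exports.

Set Implicit Arguments.
Unset Strict Implicit.
Unset Printing Implicit Defensive.

Local Open Scope classical_set_scope.
Local Open Scope ring_scope.

(* Calculus on open subsets of R^k; points of R^k are row vectors. *)

Definition pd (R : realType) (k : nat) (i : 'I_k) (f : 'rV[R]_k -> R)
  (y : 'rV[R]_k) : R := 'D_(delta_mx 0 i) f y.

Definition iter_pd (R : realType) (k : nat) (s : seq 'I_k)
  (f : 'rV[R]_k -> R) : 'rV[R]_k -> R := foldr (@pd R k) f s.

(* C^infty: the iterated partial derivatives of all orders exist and are
   continuous at every point of U (used for open U only). *)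
Definition smooth_on (R : realType) (k : nat) (U : set 'rV[R]_k)
  (f : 'rV[R]_k -> R) : Prop :=
  forall (s : seq 'I_k) (y : 'rV[R]_k), U y ->
    {for y, continuous (iter_pd s f)} /\
    forall i : 'I_k, derivable (iter_pd s f) y (delta_mx 0 i).

(* [cmap] and [cinv] are total functions; only their restrictions to the
   domain [cdom] and to the image [cmap @` cdom] matter. *)
Record chart (R : realType) (n : nat) (M : topologicalType) := Chart {
  cdom : set M;
  cmap : M -> 'rV[R]_n;
  cinv : 'rV[R]_n -> M;
  cdom_open : open cdom;
  cimg_open : open (cmap @` cdom);
  cmapK : forall p, cdom p -> cinv (cmap p) = p;
  cmap_continuous : forall p, cdom p -> {for p, continuous cmap};
  cinv_continuous :
    forall y, (cmap @` cdom) y -> {for y, continuous cinv} }.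

Definition cimg (R : realType) (n : nat) (M : topologicalType)
  (c : chart R n M) : set 'rV[R]_n := cmap c @` cdom c.

Definition overlap (R : realType) (n : nat) (M : topologicalType)
  (c d : chart R n M) : set 'rV[R]_n := cmap c @` (cdom c `&` cdom d).

(* The i-th coordinate of chart d as a function of the coordinates of c. *)
Definition transition (R : realType) (n : nat) (M : topologicalType)
  (c d : chart R n M) (i : 'I_n) (y : 'rV[R]_n) : R :=
  cmap d (cinv c y) 0 i.

Definition compatible (R : realType) (n : nat) (M : topologicalType)
  (c d : chart R n M) : Prop :=
  forall i : 'I_n, smooth_on (overlap c d) (transition c d i) /\
                   smooth_on (overlap d c) (transition d c i).

(* The atlas is the maximal one: its elements are all the local coordinate
   systems of the smooth manifold. *)
Record smooth_manifold (R : realType) (n : nat) := SmoothManifold {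
  carrier :> topologicalType;
  manifold_hausdorff : hausdorff_space carrier;
  manifold_second_countable : @second_countable carrier;
  atlas : set (chart R n carrier);
  atlas_cover : forall p : carrier, exists2 c, atlas c & cdom c p;
  atlas_compatible : forall c d, atlas c -> atlas d -> compatible c d;
  atlas_maximal :
    forall c, (forall d, atlas d -> compatible c d) -> atlas c }.
Arguments atlas {R n} s _.

(* Geometric objects are given by their components in every chart of the
   atlas, as functions of the coordinates of that chart; the values outside
   the image of the chart are irrelevant. *)

(* [eta y 0 i] is eta^i(y). *)
Definition vect_comp (R : realType) (n : nat) := 'rV[R]_n -> 'rV[R]_n.
(* [A y i j] is A^i_j(y), with upper index i. *)
Definition op_comp (R : realType) (n : nat) := 'rV[R]_n -> 'M[R]_n.
(* [G y i r s] is Gamma^i_{rs}(y). *)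
Definition conn_comp (R : realType) (n : nat) :=
  'rV[R]_n -> 'I_n -> 'I_n -> 'I_n -> R.

(* In the three transformation laws x = cmap c p are the old coordinates of a
   point p and y = cmap d p are the new ones. *)

Definition vector_field (R : realType) (n : nat) (M : smooth_manifold R n)
  (eta : chart R n M -> vect_comp R n) : Prop :=
  (forall c, atlas M c ->
     forall i, smooth_on (cimg c) (fun y => eta c y 0 i)) /\
  (forall c d, atlas M c -> atlas M d ->
     forall p, cdom c p -> cdom d p -> forall i,
     let x := cmap c p in let y := cmap d p in
     eta d y 0 i = \sum_(j < n) pd j (transition c d i) x * eta c x 0 j).

Definition operator_field (R : realType) (n : nat) (M : smooth_manifold R n)
  (A : chart R n M -> op_comp R n) : Prop :=
  (forall c, atlas M c ->
     forall i j, smooth_on (cimg c) (fun y => A c y i j)) /\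
  (forall c d, atlas M c -> atlas M d ->
     forall p, cdom c p -> cdom d p -> forall i j,
     let x := cmap c p in let y := cmap d p in
     A d y i j = \sum_(k < n) \sum_(q < n)
       pd k (transition c d i) x * pd j (transition d c q) y * A c x k q).

Definition affine_connection (R : realType) (n : nat)
  (M : smooth_manifold R n) (G : chart R n M -> conn_comp R n) : Prop :=
  (forall c, atlas M c ->
     forall i r s, smooth_on (cimg c) (fun y => G c y i r s)) /\
  (forall c d, atlas M c -> atlas M d ->
     forall p, cdom c p -> cdom d p -> forall i r s,
     let x := cmap c p in let y := cmap d p in
     G d y i r s = \sum_(k < n) pd k (transition c d i) x *
       (pd r (pd s (transition d c k)) y +
        \sum_(a < n) \sum_(b < n)
          pd r (transition d c a) y * pd s (transition d c b) y *
          G c x k a b)).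

Definition symmetric_connection (R : realType) (n : nat)
  (M : smooth_manifold R n) (G : chart R n M -> conn_comp R n) : Prop :=
  forall c, atlas M c -> forall y, cimg c y ->
  forall i r s, G c y i r s = G c y i s r.

Definition nondegenerate_field (R : realType) (n : nat) (M : smooth_manifold R n)
  (A : chart R n M -> op_comp R n) : Prop :=
  forall c, atlas M c -> forall y, cimg c y -> A c y \in unitmx.

(* Right-hand side of the system as a function on the space of jets: u and w
   stand for the x-derivatives y_x and y_xx. *)
Definition system_rhs (R : realType) (n : nat) (A : op_comp R n)
  (G : conn_comp R n) (y u w : 'rV[R]_n) (i : 'I_n) : R :=
  \sum_(j < n) A y i j *
    (w 0 j + \sum_(r < n) \sum_(s < n) G y j r s * u 0 r * u 0 s).

Definition lie_derivative (R : realType) (n : nat) (eta : vect_comp R n)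
  (A : op_comp R n) (y : 'rV[R]_n) (i j : 'I_n) : R :=
  \sum_(k < n) (eta y 0 k * pd k (fun z => A z i j) y
    - A y k j * pd k (fun z => eta z 0 i) y
    + A y i k * pd j (fun z => eta z 0 k) y).

Definition infinitesimal_affine (R : realType) (n : nat)
  (eta : vect_comp R n) (G : conn_comp R n) (y : 'rV[R]_n) : Prop :=
  forall i r s : 'I_n,
  \sum_(k < n) pd k (fun z => eta z 0 i) y * G y k r s =
  pd r (pd s (fun z => eta z 0 i)) y +
  \sum_(k < n) (pd k (fun z => G z i r s) y * eta y 0 k
    + G y i k s * pd r (fun z => eta z 0 k) y
    + G y i r k * pd s (fun z => eta z 0 k) y).

(* The algebra of point symmetries, through its determining equations for
   non-degenerate A. *)
Definition point_symmetry (R : realType) (n : nat) (M : smooth_manifold R n)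
  (A : chart R n M -> op_comp R n) (G : chart R n M -> conn_comp R n)
  (eta : chart R n M -> vect_comp R n) : Prop :=
  vector_field eta /\
  forall c, atlas M c -> forall y, cimg c y ->
    (forall i j, lie_derivative (eta c) (A c) y i j = 0) /\
    infinitesimal_affine (eta c) (G c) y.

(* Equality of vector fields on M, disregarding the values of the components
   outside the images of the charts. *)
Definition vect_eq (R : realType) (n : nat) (M : smooth_manifold R n)
  (eta zeta : chart R n M -> vect_comp R n) : Prop :=
  forall c, atlas M c -> forall y, cimg c y -> eta c y = zeta c y.

Definition lin_comb (R : realType) (n : nat) (M : smooth_manifold R n)
  (N : nat) (a : 'I_N -> R) (e : 'I_N -> chart R n M -> vect_comp R n) :
  chart R n M -> vect_comp R n :=
  fun c y => \sum_(k < N) a k *: e k c y.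

(* The space V of vector fields on M has real dimension N: it has a basis
   consisting of N elements. *)
Definition vect_dim (R : realType) (n : nat) (M : smooth_manifold R n)
  (V : set (chart R n M -> vect_comp R n)) (N : nat) : Prop :=
  exists e : 'I_N -> chart R n M -> vect_comp R n,
  [/\ forall k, V (e k),
      forall a : 'I_N -> R,
        vect_eq (lin_comb a e) (fun _ _ => 0) -> forall k, a k = 0
    & forall eta, V eta -> exists a : 'I_N -> R, vect_eq eta (lin_comb a e)].

(* R^i_{srk} *)
Definition curvature (R : realType) (n : nat) (G : conn_comp R n)
  (y : 'rV[R]_n) (i s r k : 'I_n) : R :=
  pd r (fun z => G z i k s) y - pd k (fun z => G z i r s) y
  + \sum_(q < n) (G y q k s * G y i r q - G y q r s * G y i k q).

Definition ricci (R : realType) (n : nat) (G : conn_comp R n)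
  (y : 'rV[R]_n) : 'M[R]_n :=
  \matrix_(i, j) \sum_(k < n) curvature G y k i k j.

Definition ricci_sym (R : realType) (n : nat) (G : conn_comp R n)
  (y : 'rV[R]_n) : 'M[R]_n :=
  2^-1 *: (ricci G y + (ricci G y)^T).

(* The m-th case of intermediate degeneration, for 1 <= m <= n - 1. *)
Definition degeneration_case (R : realType) (n : nat)
  (M : smooth_manifold R n) (G : chart R n M -> conn_comp R n) (m : nat) :
  Prop :=
  [/\ (1 <= m)%N, (m <= n.-1)%N
    & forall c, atlas M c -> forall y, cimg c y -> \rank (ricci_sym (G c) y) = m].

(* (y^1, ..., y^n) |-> (y^1, ..., y^m) *)
Definition first_coords (R : realType) (m n : nat) (hmn : (m <= n)%N)
  (y : 'rV[R]_n) : 'rV[R]_m := \row_(r < m) y 0 (widen_ord hmn r).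

(* Main.v *)
(* Write S for the symmetric Ricci tensor. The dimension of the symmetry
   algebra being maximal, every pair (v, F) with F skew for S, up to a
   correction depending on v, is the 1-jet of a symmetry at a given point;
   in particular, for v in ker S, so is (0, v xi) for every covector xi.
   Invariance under the latter forces A to be scalar (hence constant), nabla S
   to be proportional to S, and
   R(x, y) z = (S(y, z) x - S(x, z) y) / (n - 1).
   Fix p. For v in ker S(p) let zeta_v be a symmetry with value v and zero
   covariant derivative at p, and eta_v^j one with 1-jet (0, v xi^j), where the
   xi^j form a coframe at p. Linear ODE uniqueness shows first that the jets
   (eta, nabla eta) of these fields stay in ker S, then that
   eta_v^j = y^j zeta_v with functions y^j independent of v. Taking the y^j as
   coordinates, the fact that zeta_v and all the y^j zeta_v are affine gives
   Gamma^j_rs = delta^j_s phi_r + delta^j_r phi_s, with zeta_v a constant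
   vector annihilated by phi. As the trace of the curvature vanishes, phi is
   closed, and psi is a potential of - phi. *)
Require Import Defs.
From HB Require Import structures.
From mathcomp Require Import all_boot all_order all_algebra.
From mathcomp Require Import all_classical all_reals all_analysis.
From mathcomp Require Import perm ring lra zify.
Import Order.TTheory GRing.Theory Num.Theory.
Import numFieldNormedType.Exports.

Local Open Scope classical_set_scope.
Local Open Scope ring_scope.

Set Implicit Arguments.
Unset Strict Implicit.
Unset Printing Implicit Defensive.

(** * Calculus on open subsets of R^k *)

(** The assumed dimension is that of a space of jets. On a connected M a symmetry is determined by
    its 1-jet at one point, and at a zero its linear part is skew for S; value and skew part
    together leave n + n(n - m) + m(m - 1)/2 free parameters, exactly the assumed number, so
    evaluation of jets is onto. What isotropy yields depends on the rank. For m > 1 it contains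
    rotations of S, which force nabla S = 0, and parallelism of S removes the trace of the
    curvature. For m = 1 there are no rotations: nabla S is only proportional to S, but a skew form
    vanishing on the hyperplane ker S is zero. Proportionality is enough for the jet argument, since
    S times a jet then still solves a linear homogeneous system. The factor y^j does not depend on v
    because the jets lying in ker S all solve one and the same linear connection, so the identity
    eta_v^j (x) zeta_w = zeta_v (x) eta_w^j propagates from p. Requiring nabla zeta_v = 0 at p makes
    Gamma vanish at the origin of the new coordinates; this is the initial condition behind
    phi(zeta_v) = 0. *)

Section RowVectorNorm.
Context {R : realType} {k : nat}.
Implicit Types (x y : 'rV[R]_k).

Lemma rV_norm_le x (e : R) : 0 <= e -> (`|x| <= e) <-> (forall i, `|x 0 i| <= e).
Proof.
move=> e0; rewrite [`|x|]/Num.Def.normr/= mx_normrE; split.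
- by move=> + i; apply: le_trans; apply: (le_bigmax _ (fun ij : 'I_1 * 'I_k => `|x ij.1 ij.2|) (0, i)).
- by move=> h; apply: bigmax_le => // -[i j] _ /=; rewrite (ord1 i).
Qed.

Lemma rV_norm_lt x (e : R) : 0 < e -> (`|x| < e) <-> (forall i, `|x 0 i| < e).
Proof.
move=> e0; rewrite [`|x|]/Num.Def.normr/= mx_normrE; split.
- by move=> + i; apply: le_lt_trans; apply: (le_bigmax _ (fun ij : 'I_1 * 'I_k => `|x ij.1 ij.2|) (0, i)).
- by move=> h; apply: bigmax_lt => // -[i j] _ /=; rewrite (ord1 i).
Qed.

Lemma rV_coord_le x i : `|x 0 i| <= `|x|.
Proof. exact: (iffLR (rV_norm_le x (normr_ge0 _)) (lexx _)). Qed.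

End RowVectorNorm.

Lemma continuous_bigsum {R : realType} {V : topologicalType} (I : Type) (s : seq I)
  (F : I -> V -> R) (y : V) :
  (forall i, {for y, continuous (F i)}) ->
  {for y, continuous (fun z => \sum_(i <- s) F i z)}.
Proof.
move=> cF; elim: s => [|i s IHs].
  by rewrite (_ : (fun _ => _) = cst 0); [exact: cvg_cst|apply/funext => z; rewrite big_nil].
rewrite (_ : (fun _ => _) = (fun z => F i z + \sum_(j <- s) F j z)).
  by apply: cvgD; [exact: cF|exact: IHs].
by apply/funext => z; rewrite big_cons.
Qed.

Lemma continuous_const {R : realType} {V : topologicalType} (a : R) (y : V) :
  {for y, continuous (fun=> a)}.
Proof. exact: cvg_cst. Qed.

Section MeanValue.
Context {R : realType} {k : nat}.
Implicit Types (f : 'rV[R]_k -> R) (x y z v : 'rV[R]_k) (i : 'I_k).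

Lemma is_derive_line f z v (t : R) : derivable f (z + t *: v) v ->
  is_derive t 1 (fun s => f (z + s *: v)) ('D_v f (z + t *: v)).
Proof.
move=> fd.
have E : (fun h : R => h^-1 *: (f (z + (h *: 1 + t) *: v) - f (z + t *: v))) =
   (fun h : R => h^-1 *: (f (h *: v + (z + t *: v)) - f (z + t *: v))).
  apply/funext => h; congr (_ *: (f _ - _)).
  by rewrite [h *: 1]mulr1 scalerDl addrCA addrA.
by split; rewrite /derivable /derive /comp /shift /= E.
Qed.

(** The parameter runs over [[0, 1]] and [d] scales the displacement, so that [d] of either sign, or
    zero, needs no case distinction. *)
Lemma mvt_line f z v (d : R) :
  (forall t : R, 0 <= t <= 1 -> derivable f (z + (t * d) *: v) v) ->
  exists2 c : R, 0 <= c <= 1 &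
    f (z + d *: v) - f z = d * 'D_v f (z + (c * d) *: v).
Proof.
move=> fd.
pose g (t : R) := f (z + (t * d) *: v).
have gd (t : R) : 0 <= t <= 1 -> is_derive t 1 g ('D_v f (z + (t * d) *: v) * d).
  move=> t01; rewrite /g.
  apply: (@is_derive1_comp R (fun s => f (z + s *: v)) (fun t => t * d) t).
    exact: is_derive_line (fd _ t01).
  by apply: is_derive_eq; rewrite scaler0 add0r [_ *: _]mulr1.
have gc : {within `[0, 1], continuous g}.
  by apply: derivable_within_continuous => t; rewrite in_itv/= => /gd[].
have gd' (t : R) : t \in `]0, 1[ -> is_derive t 1 g ('D_v f (z + (t * d) *: v) * d).
  by rewrite in_itv/= => /andP[/ltW t0 /ltW t1]; apply: gd; rewrite t0.
have [c] := MVT ltr01 gd' gc.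
rewrite in_itv/= => /andP[c0 c1]; rewrite /g mul1r mul0r scale0r addr0 => ->.
by exists c; [rewrite !ltW|rewrite subr0 mulr1 mulrC].
Qed.

(** Balls of the sup norm are boxes, so each coordinate may travel between its end values with a
    parameter [t] of its own. *)
Lemma path_in_ball (a b : 'rV[R]_k) (y : 'rV[R]_k) (r : R) (z : 'rV[R]_k) :
  `|a - y| < r -> `|b - y| < r ->
  (forall i, exists2 t : R, 0 <= t <= 1 & z 0 i = a 0 i + t * (b 0 i - a 0 i)) ->
  `|z - y| < r.
Proof.
move=> ay bly zi; have r0 : 0 < r by exact: le_lt_trans ay.
apply/rV_norm_lt => // i; have [t /andP[t0 t1] zE] := zi i.
have := iffLR (rV_norm_lt _ r0) ay i; have := iffLR (rV_norm_lt _ r0) bly i.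
rewrite !mxE zE !ltr_norml => /andP[h1 h2] /andP[h3 h4].
move: t0; rewrite le_eqVlt => /predU1P[<-|t0]; first by rewrite mul0r addr0 h3 h4.
apply/andP; split; rewrite -subr_gt0.
- have : 0 < t * (b 0 i - y 0 i + r) by rewrite mulr_gt0 //; lra.
  have : 0 <= (1 - t) * (a 0 i - y 0 i + r) by rewrite mulr_ge0 //; lra.
  lra.
- have : 0 < t * (r - (b 0 i - y 0 i)) by rewrite mulr_gt0 //; lra.
  have : 0 <= (1 - t) * (r - (a 0 i - y 0 i)) by rewrite mulr_ge0 //; lra.
  lra.
Qed.

(* Moving from [a] to [b] one coordinate at a time keeps the path inside the
   ball because balls of the sup norm are boxes. *)
Lemma mean_value f y (r e : R) (L : 'I_k -> R) :
  (forall z, `|z - y| < r -> forall i, derivable f z (delta_mx 0 i)) ->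
  (forall z, `|z - y| < r -> forall i, `|pd i f z - L i| <= e) ->
  forall a b : 'rV[R]_k, `|a - y| < r -> `|b - y| < r ->
  `|f b - f a - \sum_i L i * (b 0 i - a 0 i)| <= k%:R * e * `|b - a|.
Proof.
move=> fd fL a b ay bly.
pose z (j : nat) : 'rV[R]_k := \row_i (if (i < j)%N then b 0 i else a 0 i).
have z0 : z 0%N = a by apply/rowP => i; rewrite mxE.
have zk : z k = b by apply/rowP => i; rewrite mxE ltn_ord.
have zS (i : 'I_k) : z i.+1 = z i + (b 0 i - a 0 i) *: delta_mx 0 i.
  apply/rowP => j; rewrite !mxE eqxx /= eq_sym ltnS leq_eqVlt.
  have [->|ij] := eqVneq j i.
    by rewrite eqxx ltnn /= mulr1 addrC subrK.
  rewrite mulr0 addr0 (_ : (j == i :> nat) = false) //.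
  by apply/eqP => /val_inj /eqP; rewrite (negbTE ij).
have zball (i : 'I_k) (t : R) : 0 <= t <= 1 ->
    `|z i + (t * (b 0 i - a 0 i)) *: delta_mx 0 i - y| < r.
  move=> t01; apply: (path_in_ball ay bly) => j; rewrite !mxE eqxx /=.
  have [->|ij] := eqVneq j i; first by exists t => //; rewrite ltnn mulr1.
  case: ifP => _; [exists 1 | exists 0]; rewrite ?lexx ?ler01 // ?mulr0 ?addr0; ring.
have -> : f b - f a = \sum_(i < k) (f (z i.+1) - f (z i)).
  by rewrite -(big_mkord xpredT (fun i : nat => f (z i.+1) - f (z i))) telescope_sumr // zk z0.
rewrite -sumrB; apply: le_trans (ler_norm_sum _ _ _) _.
rewrite -mulrA [leRHS](_ : _ = \sum_(i < k) e * `|b - a|); last first.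
  by rewrite sumr_const card_ord mulr_natl.
apply: ler_sum => i _; rewrite zS.
have [|c c01 ->] := @mvt_line f (z i) (delta_mx 0 i) (b 0 i - a 0 i).
  by move=> t t01; apply: fd; exact: zball.
rewrite mulrC -mulrBl normrM; apply: ler_pM => //.
  by apply: fL; exact: zball.
by have := rV_coord_le (b - a) i; rewrite !mxE.
Qed.

End MeanValue.

Section ContinuouslyDifferentiable.
Context {R : realType} {k : nat}.
Implicit Types (f : 'rV[R]_k -> R) (y z v : 'rV[R]_k) (i : 'I_k).

Lemma open_ballP (U : set 'rV[R]_k) y : open U -> U y ->
  exists2 r : R, 0 < r & forall z, `|z - y| < r -> U z.
Proof.
rewrite openE => /(_ y) h Uy; have /nbhs_normP[r r0 hr] := h Uy.
by exists r => // z zy; apply: hr; rewrite /ball_ /= distrC.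
Qed.

Lemma near_normI y (P : set 'rV[R]_k) (r : R) : 0 < r ->
  (forall z, `|z - y| < r -> P z) -> nbhs y P.
Proof.
move=> r0 h; apply: (iffRL (nbhs_normP y P)).
by exists r => // z; rewrite /ball_ /= distrC => /h.
Qed.

Lemma cont_near_le f y (e : R) : 0 < e -> {for y, continuous f} ->
  exists2 r : R, 0 < r & forall z, `|z - y| < r -> `|f z - f y| <= e.
Proof.
move=> e0 /cvgrPdist_le /(_ e e0) /nbhs_normP[r r0 hr].
by exists r => // z zy; rewrite distrC; apply: hr; rewrite /ball_ /= distrC.
Qed.

Lemma fin_radius (T : finType) (P : T -> R -> Prop) :
  (forall t, exists2 r : R, 0 < r & P t r) ->
  (forall t (r s : R), s <= r -> P t r -> P t s) ->
  exists2 r : R, 0 < r & forall t, P t r.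
Proof.
move=> h mon.
have : \forall e \near 0^'+, forall t, P t e.
  apply: filter_forall => t; have [r r0 Pr] := h t.
  near=> e; apply: (mon t r) => //; near: e; exact: nbhs_right_le.
have : \forall e \near (0 : R)^'+, 0 < e by exact: nbhs_right_gt.
by move=> h0 h1; have [e [e0 he]] := filter_ex (filterI h0 h1); exists e.
Unshelve. all: by end_near. Qed.

Lemma fin_cont_near_le (T : finType) (F : T -> 'rV[R]_k -> R) y (e : R) : 0 < e ->
  (forall t, {for y, continuous (F t)}) ->
  exists2 r : R, 0 < r & forall t z, `|z - y| < r -> `|F t z - F t y| <= e.
Proof.
move=> e0 cF.
apply: (@fin_radius T (fun t r => forall z, `|z - y| < r -> `|F t z - F t y| <= e)).
  by move=> t; apply: cont_near_le.
by move=> t r s sr h z zy; apply: h; apply: lt_le_trans sr.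
Qed.

(** [mean_value] with [L] the partial derivatives at [y] is the first-order expansion; the partial
    derivatives need to be continuous at [y] only. *)
Lemma C1_differentiable (U : set 'rV[R]_k) f y : open U -> U y ->
  (forall z, U z -> forall i, derivable f z (delta_mx 0 i)) ->
  (forall i, {for y, continuous (pd i f)}) ->
  differentiable f y /\
  forall v, 'D_v f y = \sum_i v 0 i * pd i f y.
Proof.
move=> oU Uy fd fc.
pose L v : R := \sum_i v 0 i * pd i f y.
have Llin : linear L.
  move=> a u v; rewrite /L scaler_sumr -big_split /=; apply: eq_bigr => i _.
  by rewrite !mxE mulrDl [_ *: _]mulrA.
pose Lm := GRing.isLinear.Build _ _ _ _ L Llin.
pose LL : {linear 'rV[R]_k -> R} := HB.pack L Lm.
have Lc : continuous LL.
  move=> v; apply: (@continuous_bigsum R _ _ _ (fun i (z : 'rV[R]_k) => z 0 i * pd i f y)) => i.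
  apply: (@continuousM _ _ (fun z : 'rV[R]_k => z 0 i) (fun=> pd i f y)).
    exact: coord_continuous.
  exact: continuous_const.
have E : f \o shift y = cst (f y) + LL +o_ (0 : 'rV[R]_k) id.
  apply/eqaddoP => e e0.
  have [r1 r10 h1] := open_ballP oU Uy.
  (* The mean value estimate loses a factor [k]; dividing by [k + 1] also covers [k = 0]. *)
  have e'0 : 0 < e / (k%:R + 1) by rewrite divr_gt0 // ltr_wpDl // ler0n.
  have [r2 r20 h2] := fin_cont_near_le e'0 fc.
  pose r := Num.min r1 r2.
  have r0 : 0 < r by rewrite lt_min r10.
  have mv := @mean_value _ _ f y r (e / (k%:R + 1)) (fun i => pd i f y).
  apply: (@near_normI 0 _ r r0) => h; rewrite subr0 => hr.
  have {mv} := mv _ _ y (h + y).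
  rewrite subrr normr0 addrK => /(_ _ _ r0 hr).
  have <- : LL h = \sum_i pd i f y * ((h + y) 0 i - y 0 i).
    by apply: eq_bigr => i _; rewrite !mxE addrK mulrC.
  move=> mv; rewrite !fctE /shift /= opprD addrA; apply: le_trans (mv _ _) _.
  - by move=> z zy; apply: fd; apply: h1; apply: lt_le_trans zy _; rewrite ge_min lexx.
  - by move=> z zy i; apply: h2; apply: lt_le_trans zy _; rewrite ge_min lexx orbT.
  - rewrite ler_wpM2r // mulrCA ger_pMr // ler_pdivrMr ?ltr_wpDl ?ler0n //.
    by rewrite mul1r lerDl.
have dfE := @diff_unique R _ _ f LL y Lc E.
have df : differentiable f y by apply/diff_locallyP; rewrite dfE; split.
by split => // v; rewrite deriveE // dfE.
Qed.

End ContinuouslyDifferentiable.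

Section PartialDerivatives.
Context {R : realType} {k : nat}.
Implicit Types (f g : 'rV[R]_k -> R) (y z v w : 'rV[R]_k) (i j : 'I_k)
  (U : set 'rV[R]_k).

Lemma derivable_shift f z v w :
  (derivable f (z + w) v -> derivable (fun x => f (x + w)) z v) /\
  'D_v (fun x => f (x + w)) z = 'D_v f (z + w).
Proof.
have E : (fun h : R => h^-1 *: (((fun x => f (x + w)) \o shift z) (h *: v) - f (z + w))) =
         (fun h : R => h^-1 *: ((f \o shift (z + w)) (h *: v) - f (z + w))).
  by apply/funext => h /=; rewrite /shift /= addrA.
by rewrite /derivable /derive E.
Qed.

Lemma differentiable_derive f y v : differentiable f y ->
  'D_v f y = \sum_i v 0 i * pd i f y.
Proof.
move=> fd; rewrite deriveE // {1}(row_sum_delta v) linear_sum /=.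
by apply: eq_bigr => i _; rewrite linearZ /= /pd deriveE.
Qed.

Lemma pdE i f y : pd i f y = 'D_(delta_mx 0 i) f y. Proof. by []. Qed.

Opaque pd.

Lemma derivable_difference f z v w : derivable f z v -> derivable f (z + w) v ->
  derivable (fun x => f (x + w) - f x) z v /\
  'D_v (fun x => f (x + w) - f x) z = 'D_v f (z + w) - 'D_v f z.
Proof.
move=> d1 d2; have [/(_ d2) d3 E] := derivable_shift f z v w.
by rewrite -E; split; [exact: derivableB|exact: deriveB].
Qed.

Lemma second_difference f y i j (h : R) : 0 < h ->
  (forall z, `|z - y| <= 2 * h -> derivable f z (delta_mx 0 i)) ->
  (forall z, `|z - y| <= 2 * h -> derivable (pd i f) z (delta_mx 0 j)) ->
  exists2 z, `|z - y| <= 2 * h &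
    f (y + h *: delta_mx 0 i + h *: delta_mx 0 j) - f (y + h *: delta_mx 0 i)
    - (f (y + h *: delta_mx 0 j) - f y) = h * (h * pd j (pd i f) z).
Proof.
move=> h0 fd fdd.
have box (s t : R) : 0 <= s <= 1 -> 0 <= t <= 1 ->
    `|y + (s * h) *: delta_mx 0 i + (t * h) *: delta_mx 0 j - y| <= 2 * h.
  have D (l : 'I_k) : `|delta_mx 0 l : 'rV[R]_k| <= 1.
    by apply/rV_norm_le => // l'; rewrite mxE normr_nat; case: (_ && _).
  move=> /andP[s0 s1] /andP[t0 t1]; rewrite addrAC (addrAC y) subrr add0r.
  apply: le_trans (ler_normD _ _) _; rewrite mulr2n mulrDl mul1r lerD //.
    by rewrite normrZ ger0_norm ?mulr_ge0 ?(ltW h0) // -[leRHS]mulr1 ler_pM //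
       ?mulr_ge0 ?(ltW h0) // ger_pMl.
  by rewrite normrZ ger0_norm ?mulr_ge0 ?(ltW h0) // -[leRHS]mulr1 ler_pM //
       ?mulr_ge0 ?(ltW h0) // ger_pMl.
pose F z := f (z + h *: delta_mx 0 j) - f z.
have Fd (t : R) : 0 <= t <= 1 -> derivable F (y + (t * h) *: delta_mx 0 i) (delta_mx 0 i) /\
   'D_(delta_mx 0 i) F (y + (t * h) *: delta_mx 0 i) =
   pd i f (y + (t * h) *: delta_mx 0 i + h *: delta_mx 0 j) - pd i f (y + (t * h) *: delta_mx 0 i).
  move=> t01.
  have d1 : derivable f (y + (t * h) *: delta_mx 0 i) (delta_mx 0 i).
    apply: fd; have := box t 0 t01; rewrite mul0r scale0r addr0; apply.
    by rewrite lexx ler01.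
  have d2 : derivable f (y + (t * h) *: delta_mx 0 i + h *: delta_mx 0 j) (delta_mx 0 i).
    by apply: fd; have := box t 1 t01; rewrite mul1r; apply; rewrite lexx ler01.
  exact: derivable_difference.
have [c c01 cE] := mvt_line (fun (t : R) t01 => (Fd t t01).1).
have [|c' c'01 c'E] := @mvt_line _ _ (pd i f) (y + (c * h) *: delta_mx 0 i) (delta_mx 0 j) h.
  by move=> t t01; apply: fdd; exact: box.
exists (y + (c * h) *: delta_mx 0 i + (c' * h) *: delta_mx 0 j); first exact: box.
by move: cE; rewrite /F (Fd c c01).2 c'E => ->.
Qed.

(** The second difference is symmetric in [i] and [j], and [second_difference] evaluates it as
    either mixed derivative at some point within [2 * h] of [y]. Continuity of both mixed
    derivatives at [y] then compares their values there. *)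
Lemma pd_comm U f y i j : open U -> U y -> smooth_on U f ->
  pd i (pd j f) y = pd j (pd i f) y.
Proof.
move=> oU Uy sf; apply/eqP; rewrite -subr_eq0 -normr_eq0 eq_le normr_ge0 andbT.
apply/ler_addgt0Pl => e e0; rewrite addr0.
have e2 : 0 < e / 2 by rewrite divr_gt0.
have [r r0 rU] := open_ballP oU Uy.
have [r1 r10 h1] := cont_near_le e2 (sf [:: i; j] y Uy).1.
have [r2 r20 h2] := cont_near_le e2 (sf [:: j; i] y Uy).1.
pose h := Num.min r (Num.min r1 r2) / 4.
have h0 : 0 < h by rewrite divr_gt0 // !lt_min r0 r10.
have hr z : `|z - y| <= 2 * h -> [/\ `|z - y| < r, `|z - y| < r1 & `|z - y| < r2].
  move=> zh; have : `|z - y| < h * 4 by apply: le_lt_trans zh _; rewrite mulrC ltr_pM2l // ltr_nat.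
  by rewrite divfK // !lt_min => /andP[-> /andP[-> ->]].
have zU z : `|z - y| <= 2 * h -> U z by move=> /hr[+ _ _]; exact: rU.
have [|| z1 z1h E1] := @second_difference f y i j h h0.
- by move=> z /zU /(sf [::])[_]; apply.
- by move=> z /zU /(sf [:: i])[_]; apply.
have [|| z2 z2h E2] := @second_difference f y j i h h0.
- by move=> z /zU /(sf [::])[_]; apply.
- by move=> z /zU /(sf [:: j])[_]; apply.
have E : pd j (pd i f) z1 = pd i (pd j f) z2.
  have hn : h != 0 by rewrite gt_eqF.
  move: E1 E2; rewrite (addrAC y).
  move: (f (_ + _ + _)) (f (y + _)) (f (y + _)) (f y) => a b c d.
  move: (pd j _ _) (pd i _ _) => A B E1 E2.
  have E12 : h * (h * A) = h * (h * B) by rewrite -E1 -E2; ring.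
  exact: (mulfI hn (mulfI hn E12)).
have [_ _ /h2 /=] := hr _ z1h; have [_ /h1 /= + _] := hr _ z2h.
rewrite E => a b.
move: a b; move: (pd i _ z2) (pd i _ y) (pd j _ y) => a b c; clear -R.
rewrite !ler_norml => /andP[p1 p2] /andP[p3 p4]; apply/andP; split; lra.
Qed.

End PartialDerivatives.

(** * Closure properties of smooth functions *)

Section SmoothAlgebra.
Context {R : realType} {k : nat}.
Implicit Types (f g : 'rV[R]_k -> R) (y z v w : 'rV[R]_k) (i j : 'I_k)
  (U : set 'rV[R]_k).

(* [smooth_upto N] unfolds one derivative at a time, which makes closure
   properties provable by induction on the order [N]. *)
Fixpoint smooth_upto N U f : Prop :=
  (forall y, U y -> {for y, continuous f} /\
     forall i, derivable f y (delta_mx 0 i)) /\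
  (if N is N'.+1 then forall i, smooth_upto N' U (pd i f) else True).

Lemma iter_pd_rcons s i f : iter_pd (rcons s i) f = iter_pd s (pd i f).
Proof. by rewrite /iter_pd -cats1 foldr_cat. Qed.

Lemma smooth_on_pd U f i : smooth_on U f -> smooth_on U (pd i f).
Proof. by move=> sf s y Uy; rewrite -iter_pd_rcons; exact: sf. Qed.

Lemma smooth_uptoP U f : smooth_on U f <-> forall N, smooth_upto N U f.
Proof.
split=> [+ N | h s].
  elim: N f => [|N IHN] f sf; split.
  - by move=> y Uy; exact: (sf [::]).
  - by [].
  - by move=> y Uy; exact: (sf [::]).
  - by move=> i; apply: IHN; exact: smooth_on_pd.
have : smooth_upto (size s) U f by [].
elim/last_ind: s f {h} => [|s i IHs] f; first by case.
by rewrite size_rcons iter_pd_rcons => -[_ /(_ i)]; exact: IHs.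
Qed.

Lemma smooth_upto_0 N U f : smooth_upto N U f ->
  forall y, U y -> {for y, continuous f} /\ forall i, derivable f y (delta_mx 0 i).
Proof. by case: N => [|N] []. Qed.

Lemma smooth_uptoS N U f : smooth_upto N.+1 U f -> smooth_upto N U f.
Proof. by elim: N f => [|N IHN] f [h1 h2]; split => // i; exact: IHN. Qed.

Lemma pd_near f g y i : (\forall z \near y, f z = g z) -> pd i f y = pd i g y.
Proof. by move=> fg; rewrite !pdE; exact: near_eq_derive. Qed.

Lemma open_near U y : open U -> U y -> \forall z \near y, U z.
Proof. by rewrite openE => oU Uy; exact: oU. Qed.

Lemma open_eq_near U f g y : open U -> U y -> (forall z, U z -> f z = g z) ->
  \forall z \near y, f z = g z.
Proof. by move=> oU Uy fg; apply: filterS (open_near oU Uy); exact: fg. Qed.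

Lemma smooth_upto_eq N U f g : open U -> (forall z, U z -> f z = g z) ->
  smooth_upto N U f -> smooth_upto N U g.
Proof.
move=> oU; have H f1 g1 y : U y -> (forall z, U z -> f1 z = g1 z) ->
    {for y, continuous f1} /\ (forall i, derivable f1 y (delta_mx 0 i)) ->
    {for y, continuous g1} /\ (forall i, derivable g1 y (delta_mx 0 i)).
  move=> Uy fg [fc fd]; have E := open_eq_near oU Uy fg; split.
    rewrite /prop_for /continuous_at -(fg _ Uy); apply: cvg_trans fc.
    exact: near_eq_cvg E.
  by move=> i; apply: near_eq_derivable (fd i).
elim: N f g => [|N IHN] f g fg [h1 h2]; split.
- by move=> y Uy; exact: H (h1 y Uy).
- by [].
- by move=> y Uy; exact: H (h1 y Uy).
- move=> i; apply: IHN (h2 i) => z Uz.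
  by apply: pd_near; exact: open_eq_near oU Uz fg.
Qed.

Lemma smooth_on_eq U f g : open U -> (forall z, U z -> f z = g z) ->
  smooth_on U f -> smooth_on U g.
Proof.
move=> oU fg /smooth_uptoP sf; apply/smooth_uptoP => N.
exact: smooth_upto_eq fg (sf N).
Qed.

Lemma smooth_on_sub U V f : V `<=` U -> smooth_on U f -> smooth_on V f.
Proof. by move=> VU sf s y /VU; exact: sf. Qed.

Lemma smooth_cont U f y : smooth_on U f -> U y -> {for y, continuous f}.
Proof. by move=> sf Uy; exact: (sf [::] y Uy).1. Qed.

Lemma smooth_derivable U f y i : smooth_on U f -> U y -> derivable f y (delta_mx 0 i).
Proof. by move=> sf Uy; exact: (sf [::] y Uy).2. Qed.

Lemma smooth_differentiable U f y : open U -> smooth_on U f -> U y ->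
  differentiable f y.
Proof.
move=> oU sf Uy; apply: (C1_differentiable oU Uy _ _).1.
  by move=> z Uz i; exact: smooth_derivable sf Uz.
by move=> i; exact: smooth_cont (smooth_on_pd i sf) Uy.
Qed.

Lemma pd_cst (a : R) i y : pd i (fun=> a) y = 0.
Proof. by rewrite pdE; exact: derive_cst. Qed.

Lemma pdD f g i y : derivable f y (delta_mx 0 i) -> derivable g y (delta_mx 0 i) ->
  pd i (fun z => f z + g z) y = pd i f y + pd i g y.
Proof. by move=> fd gd; rewrite !pdE; exact: deriveD. Qed.

Lemma pdM f g i y : derivable f y (delta_mx 0 i) -> derivable g y (delta_mx 0 i) ->
  pd i (fun z => f z * g z) y = pd i f y * g y + f y * pd i g y.
Proof.
move=> fd gd; rewrite !pdE; have := deriveM fd gd; rewrite /GRing.scale /= => E.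
by apply: (etrans E); rewrite addrC mulrC.
Qed.

Lemma pdV f i y : f y != 0 -> derivable f y (delta_mx 0 i) ->
  pd i (fun z => (f z)^-1) y = - (f y)^-1 * (f y)^-1 * pd i f y.
Proof.
move=> f0 fd; rewrite !pdE; apply: (etrans (deriveV f0 fd)).
by rewrite /GRing.scale /= expr2 invfM !mulNr.
Qed.

Lemma smooth_upto_cst N U (a : R) : open U -> smooth_upto N U (fun=> a).
Proof.
move=> oU; elim: N a => [|N IHN] a; split.
- by move=> y _; split => *; [exact: continuous_const|exact: derivable_cst].
- by [].
- by move=> y _; split => *; [exact: continuous_const|exact: derivable_cst].
- by move=> i; apply: smooth_upto_eq (IHN 0) => // z _; rewrite pd_cst.
Qed.

Lemma smooth_uptoD N U f g : open U ->
  smooth_upto N U f -> smooth_upto N U g -> smooth_upto N U (fun z => f z + g z).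
Proof.
move=> oU; elim: N f g => [|N IHN] f g sf sg.
- split => // y Uy; have [fc fd] := smooth_upto_0 sf Uy.
  have [gc gd] := smooth_upto_0 sg Uy.
  by split=> [|i]; [exact: continuousD|exact: derivableD].
- split => [y Uy|i].
    have [fc fd] := smooth_upto_0 sf Uy; have [gc gd] := smooth_upto_0 sg Uy.
    by split=> [|i]; [exact: continuousD|exact: derivableD].
  apply: (smooth_upto_eq oU _ (IHN _ _ (sf.2 i) (sg.2 i))) => z Uz.
  by rewrite pdD //; [exact: (smooth_upto_0 sf Uz).2|exact: (smooth_upto_0 sg Uz).2].
Qed.

Lemma smooth_uptoM N U f g : open U ->
  smooth_upto N U f -> smooth_upto N U g -> smooth_upto N U (fun z => f z * g z).
Proof.
move=> oU; elim: N f g => [|N IHN] f g sf sg.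
- split => // y Uy; have [fc fd] := smooth_upto_0 sf Uy.
  have [gc gd] := smooth_upto_0 sg Uy.
  by split=> [|i]; [exact: continuousM|exact: derivableM].
- split => [y Uy|i].
    have [fc fd] := smooth_upto_0 sf Uy; have [gc gd] := smooth_upto_0 sg Uy.
    by split=> [|i]; [exact: continuousM|exact: derivableM].
  have S := smooth_uptoD oU (IHN _ _ (sf.2 i) (smooth_uptoS sg))
                            (IHN _ _ (smooth_uptoS sf) (sg.2 i)).
  apply: (smooth_upto_eq oU _ S) => z Uz.
  by rewrite pdM //; [exact: (smooth_upto_0 sf Uz).2|exact: (smooth_upto_0 sg Uz).2].
Qed.

Lemma smooth_upto_sum N U (I : Type) (s : seq I) (F : I -> 'rV[R]_k -> R) : open U ->
  (forall a, smooth_upto N U (F a)) -> smooth_upto N U (fun z => \sum_(a <- s) F a z).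
Proof.
move=> oU sF; elim: s => [|i s IHs].
  by apply: smooth_upto_eq (smooth_upto_cst _ 0 oU) => // z _; rewrite big_nil.
apply: smooth_upto_eq (smooth_uptoD oU (sF i) IHs) => // z _.
by rewrite big_cons.
Qed.

Lemma smooth_upto_prod N U (I : Type) (s : seq I) (F : I -> 'rV[R]_k -> R) : open U ->
  (forall a, smooth_upto N U (F a)) -> smooth_upto N U (fun z => \prod_(a <- s) F a z).
Proof.
move=> oU sF; elim: s => [|i s IHs].
  by apply: smooth_upto_eq (smooth_upto_cst _ 1 oU) => // z _; rewrite big_nil.
apply: smooth_upto_eq (smooth_uptoM oU (sF i) IHs) => // z _.
by rewrite big_cons.
Qed.

Lemma smooth_uptoV N U f : open U -> (forall z, U z -> f z != 0) ->
  smooth_upto N U f -> smooth_upto N U (fun z => (f z)^-1).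
Proof.
move=> oU f0; elim: N f f0 => [|N IHN] f f0 sf.
- split => // y Uy; have [fc fd] := smooth_upto_0 sf Uy.
  by split=> [|i]; [apply: continuousV => //; exact: f0|apply: derivableV => //; exact: f0].
- split => [y Uy|i].
    have [fc fd] := smooth_upto_0 sf Uy.
    by split=> [|i]; [apply: continuousV => //; exact: f0|apply: derivableV => //; exact: f0].
  have S := IHN _ f0 (smooth_uptoS sf).
  have S' := smooth_uptoM oU (smooth_upto_cst N (-1) oU) (smooth_uptoM oU (smooth_uptoM oU S S) (sf.2 i)).
  apply: (smooth_upto_eq oU _ S') => z Uz.
  by rewrite pdV ?f0 //; [rewrite mulN1r !mulNr|exact: (smooth_upto_0 sf Uz).2].
Qed.

End SmoothAlgebra.

Section SmoothComposition.
Context {R : realType} {k n : nat}.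
Implicit Types (f : 'rV[R]_n -> R) (g : 'rV[R]_k -> 'rV[R]_n)
  (U : set 'rV[R]_k) (V : set 'rV[R]_n).

Lemma continuous_rV {T : topologicalType} (g : T -> 'rV[R]_n) (y : T) :
  (forall j, {for y, continuous (fun z => g z 0 j)}) -> {for y, continuous g}.
Proof.
move=> gc; apply/cvgrPdist_le => e e0.
have : \forall z \near y, forall j, `|g y 0 j - g z 0 j| <= e.
  by apply: filter_forall => j; move/cvgrPdist_le: (gc j) => /(_ e e0).
apply: filterS => z h; apply/rV_norm_le; first exact: ltW.
by move=> j; rewrite !mxE.
Qed.

Lemma derive_alongE {V W : normedModType R} (F : V -> W) y v :
  'D_v F y = 'D_1 (fun h : R => F (h *: v + y)) 0.
Proof.
have E : (fun h : R => h^-1 *: ((F \o shift y) (h *: v) - F y)) =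
   (fun h : R => h^-1 *: (((fun h : R => F (h *: v + y)) \o shift 0) (h *: 1)
      - (fun h : R => F (h *: v + y)) 0)).
  by apply/funext => h /=; rewrite /shift /= addr0 scale0r add0r [h *: 1]mulr1.
by rewrite /derive E.
Qed.

(** [g] is only assumed derivable along [v]: restricted to the line through [y] it becomes a
    function of one real variable, for which derivability is differentiability. *)
Lemma derive_comp f g y v : differentiable f (g y) ->
  (forall j, derivable (fun z => g z 0 j) y v) ->
  derivable (fun z => f (g z)) y v /\
  'D_v (fun z => f (g z)) y = \sum_j pd j f (g y) * 'D_v (fun z => g z 0 j) y.
Proof.
move=> fd gd.
have gD : derivable g y v by apply/derivable_mxP => i j; rewrite (ord1 i); exact: gd.
pose l (h : R) := g (h *: v + y).
have l0 : l 0 = g y by rewrite /l scale0r add0r.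
have lD : differentiable l 0 by apply/derivable1_diffP; exact: (iffLR (derivable1P _ _ _) gD).
have fD : differentiable f (l 0) by rewrite l0.
have flD := differentiable_comp lD fD.
have fgD : derivable (fun z => f (g z)) y v.
  by apply/derivable1P; apply/derivable1_diffP; exact: flD.
split => //.
rewrite derive_alongE -[fun h => _]/(f \o l) deriveE // diff_comp //= -deriveE //.
rewrite l0 differentiable_derive //.
apply: eq_bigr => j _; rewrite mulrC; congr (_ * _).
rewrite -(deriveE _ lD) -(derive_alongE g).
by rewrite derive_mx // mxE.
Qed.

(** One more order is asked of [f] because the chain rule needs [f] differentiable, which is deduced
    from the continuity of its partial derivatives. *)
Lemma smooth_upto_comp N f g U V : open U -> open V ->
  (forall y, U y -> V (g y)) -> smooth_upto N.+1 V f ->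
  (forall j, smooth_upto N U (fun z => g z 0 j)) ->
  smooth_upto N U (fun z => f (g z)).
Proof.
move=> oU oV UV; have H M f1 : smooth_upto M.+1 V f1 ->
    (forall j, smooth_upto M U (fun z => g z 0 j)) -> forall y, U y ->
    {for y, continuous (fun z => f1 (g z))} /\
    forall i, derivable (fun z => f1 (g z)) y (delta_mx 0 i) /\
    pd i (fun z => f1 (g z)) y =
      \sum_j pd j f1 (g y) * pd i (fun z => g z 0 j) y.
  move=> sf sg y Uy; split.
    apply: continuous_comp; last exact: (smooth_upto_0 sf (UV _ Uy)).1.
    by apply: continuous_rV => j; exact: (smooth_upto_0 (sg j) Uy).1.
  move=> i; rewrite pdE; apply: derive_comp.
    apply: (C1_differentiable oV (UV _ Uy) _ _).1.
      by move=> z Vz i'; exact: (smooth_upto_0 sf Vz).2.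
    by move=> i'; exact: (smooth_upto_0 (sf.2 i') (UV _ Uy)).1.
  by move=> j; exact: (smooth_upto_0 (sg j) Uy).2.
elim: N f => [|N IHN] f sf sg.
- split => // y Uy; have [fc fd] := H _ _ sf sg y Uy.
  by split=> // i; exact: (fd i).1.
- split=> [y Uy|i].
    have [fc fd] := H _ _ sf sg y Uy.
    by split=> // i; exact: (fd i).1.
  apply: (@smooth_upto_eq _ _ _ _ (fun y => \sum_j pd j f (g y) * pd i (fun z => g z 0 j) y)) => //.
    by move=> z Uz; rewrite ((H _ _ sf sg z Uz).2 i).2.
  apply: smooth_upto_sum => // j; apply: smooth_uptoM => //; last exact: (sg j).2.
  apply: IHN; first exact: sf.2.
  by move=> j'; apply: smooth_uptoS; exact: sg.
Qed.

End SmoothComposition.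

Section SmoothOn.
Context {R : realType} {k : nat} (U : set 'rV[R]_k) (oU : open U).
Implicit Types (f g : 'rV[R]_k -> R).

Lemma smooth_cst (a : R) : smooth_on U (fun=> a).
Proof. by apply/smooth_uptoP => N; exact: smooth_upto_cst. Qed.

Lemma smoothD f g : smooth_on U f -> smooth_on U g -> smooth_on U (fun z => f z + g z).
Proof.
move=> /smooth_uptoP sf /smooth_uptoP sg; apply/smooth_uptoP => N.
exact: smooth_uptoD.
Qed.

Lemma smoothM f g : smooth_on U f -> smooth_on U g -> smooth_on U (fun z => f z * g z).
Proof.
move=> /smooth_uptoP sf /smooth_uptoP sg; apply/smooth_uptoP => N.
exact: smooth_uptoM.
Qed.

Lemma smoothN f : smooth_on U f -> smooth_on U (fun z => - f z).
Proof.
move=> sf; apply: smooth_on_eq (smoothM (smooth_cst (-1)) sf) => // z _.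
by rewrite mulN1r.
Qed.

Lemma smoothB f g : smooth_on U f -> smooth_on U g -> smooth_on U (fun z => f z - g z).
Proof. by move=> sf sg; exact: (smoothD sf (smoothN sg)). Qed.

Lemma smooth_sum (I : Type) (s : seq I) (F : I -> 'rV[R]_k -> R) :
  (forall a, smooth_on U (F a)) -> smooth_on U (fun z => \sum_(a <- s) F a z).
Proof.
move=> sF; apply/smooth_uptoP => N; apply: smooth_upto_sum => // a.
exact: (iffLR (smooth_uptoP _ _) (sF a)) N.
Qed.

Lemma smooth_prod (I : Type) (s : seq I) (F : I -> 'rV[R]_k -> R) :
  (forall a, smooth_on U (F a)) -> smooth_on U (fun z => \prod_(a <- s) F a z).
Proof.
move=> sF; apply/smooth_uptoP => N; apply: smooth_upto_prod => // a.
exact: (iffLR (smooth_uptoP _ _) (sF a)) N.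
Qed.

Lemma smoothV f : (forall z, U z -> f z != 0) -> smooth_on U f ->
  smooth_on U (fun z => (f z)^-1).
Proof.
move=> f0 /smooth_uptoP sf; apply/smooth_uptoP => N; exact: smooth_uptoV.
Qed.

Lemma pd_coord i j y : pd i (fun z : 'rV[R]_k => z 0 j) y = (i == j)%:R.
Proof.
rewrite pdE; have d := @derivable_id R 'rV[R]_k y (delta_mx 0 i).
have := @derive_mx _ _ 1 k (fun z : 'rV[R]_k => z) y (delta_mx 0 i) d.
by rewrite derive_id => /rowP /(_ j); rewrite !mxE eqxx eq_sym.
Qed.

Lemma smooth_coord j : smooth_on U (fun z => z 0 j).
Proof.
have H y : {for y, continuous (fun z : 'rV[R]_k => z 0 j)} /\
     forall i, derivable (fun z : 'rV[R]_k => z 0 j) y (delta_mx 0 i).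
  split=> [|i]; first exact: coord_continuous.
  have d := @derivable_id R 'rV[R]_k y (delta_mx 0 i).
  by have := iffLR (@derivable_mxP _ _ 1 k (fun z => z) y (delta_mx 0 i)) d; apply.
apply/smooth_uptoP => -[|N]; split => // i.
apply: smooth_upto_eq (smooth_upto_cst _ (i == j)%:R oU) => // z _.
by rewrite pd_coord.
Qed.

Lemma smooth_pdD f g i y : U y -> smooth_on U f -> smooth_on U g ->
  pd i (fun z => f z + g z) y = pd i f y + pd i g y.
Proof. by move=> Uy sf sg; apply: pdD; exact: smooth_derivable Uy. Qed.

Lemma smooth_pdM f g i y : U y -> smooth_on U f -> smooth_on U g ->
  pd i (fun z => f z * g z) y = pd i f y * g y + f y * pd i g y.
Proof. by move=> Uy sf sg; apply: pdM; exact: smooth_derivable Uy. Qed.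

Lemma pd_ext f g i y : f =1 g -> pd i f y = pd i g y.
Proof. by move/funext ->. Qed.

Lemma smooth_pdN f i y : U y -> smooth_on U f -> pd i (fun z => - f z) y = - pd i f y.
Proof.
move=> Uy sf; rewrite -mulN1r.
have -> : (fun z => - f z) = (fun z => -1 * f z) by apply/funext => z; rewrite mulN1r.
by rewrite (smooth_pdM _ Uy (smooth_cst (-1)) sf) pd_cst mul0r add0r.
Qed.

Lemma smooth_pdB f g i y : U y -> smooth_on U f -> smooth_on U g ->
  pd i (fun z => f z - g z) y = pd i f y - pd i g y.
Proof.
by move=> Uy sf sg; rewrite (smooth_pdD _ Uy sf (smoothN sg)) smooth_pdN.
Qed.

Lemma smooth_pd_sum (I : Type) (s : seq I) (F : I -> 'rV[R]_k -> R) i y : U y ->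
  (forall a, smooth_on U (F a)) ->
  pd i (fun z => \sum_(a <- s) F a z) y = \sum_(a <- s) pd i (F a) y.
Proof.
move=> Uy sF; elim: s => [|a s IHs].
  rewrite big_nil -[RHS](pd_cst 0 i y); apply: pd_ext => z.
  by rewrite big_nil.
rewrite big_cons -IHs -(smooth_pdD _ Uy (sF a) (smooth_sum s sF)).
by apply: pd_ext => z; rewrite big_cons.
Qed.

Lemma pd_eq_on f g i y : U y -> (forall z, U z -> f z = g z) -> pd i f y = pd i g y.
Proof. by move=> Uy fg; apply: pd_near; exact: open_eq_near Uy fg. Qed.

End SmoothOn.

Lemma smooth_comp {R : realType} {k n : nat} (U : set 'rV[R]_k) (V : set 'rV[R]_n)
  (f : 'rV[R]_n -> R) (g : 'rV[R]_k -> 'rV[R]_n) : open U -> open V ->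
  (forall y, U y -> V (g y)) -> smooth_on V f ->
  (forall j, smooth_on U (fun z => g z 0 j)) -> smooth_on U (fun z => f (g z)).
Proof.
move=> oU oV UV /smooth_uptoP sf sg; apply/smooth_uptoP => N.
apply: smooth_upto_comp oU oV UV (sf N.+1) _ => j.
exact: (iffLR (smooth_uptoP _ _) (sg j)) N.
Qed.

Lemma pd_comp {R : realType} {k n : nat} (U : set 'rV[R]_k) (V : set 'rV[R]_n)
  (f : 'rV[R]_n -> R) (g : 'rV[R]_k -> 'rV[R]_n) i y : open V ->
  U y -> V (g y) -> smooth_on V f ->
  (forall j, smooth_on U (fun z => g z 0 j)) ->
  pd i (fun z => f (g z)) y = \sum_j pd j f (g y) * pd i (fun z => g z 0 j) y.
Proof.
move=> oV Uy Vgy sf sg; rewrite pdE; apply: (derive_comp _ _).2.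
  exact: smooth_differentiable oV sf Vgy.
by move=> j; exact: smooth_derivable (sg j) Uy.
Qed.

(** * Derivatives of matrix-valued functions *)

Section MatrixCalculus.
Context {R : realType} {k : nat} (U : set 'rV[R]_k) (oU : open U).

Definition smooth_mx {p q} (A : 'rV[R]_k -> 'M[R]_(p, q)) : Prop :=
  forall i j, smooth_on U (fun z => A z i j).

Definition pd_mx {p q} (r : 'I_k) (A : 'rV[R]_k -> 'M[R]_(p, q)) (y : 'rV[R]_k) :
  'M[R]_(p, q) := \matrix_(i, j) pd r (fun z => A z i j) y.

Lemma pd_mxE {p q} r (A : 'rV[R]_k -> 'M[R]_(p, q)) y i j :
  pd_mx r A y i j = pd r (fun z => A z i j) y.
Proof. by rewrite mxE. Qed.

Lemma smooth_mx_pd {p q} r (A : 'rV[R]_k -> 'M[R]_(p, q)) :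
  smooth_mx A -> smooth_mx (pd_mx r A).
Proof.
move=> sA i j; apply: smooth_on_eq (smooth_on_pd r (sA i j)) => // z _.
by rewrite mxE.
Qed.

Lemma smooth_mxD {p q} (A B : 'rV[R]_k -> 'M[R]_(p, q)) :
  smooth_mx A -> smooth_mx B -> smooth_mx (fun z => A z + B z).
Proof.
move=> sA sB i j; apply: smooth_on_eq (smoothD oU (sA i j) (sB i j)) => // z _.
by rewrite mxE.
Qed.

Lemma smooth_mxN {p q} (A : 'rV[R]_k -> 'M[R]_(p, q)) :
  smooth_mx A -> smooth_mx (fun z => - A z).
Proof.
by move=> sA i j; apply: smooth_on_eq (smoothN oU (sA i j)) => // z _; rewrite mxE.
Qed.

Lemma smooth_mxM {p q r} (A : 'rV[R]_k -> 'M[R]_(p, q)) (B : 'rV[R]_k -> 'M[R]_(q, r)) :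
  smooth_mx A -> smooth_mx B -> smooth_mx (fun z => A z *m B z).
Proof.
move=> sA sB i j.
have S := smooth_sum oU (index_enum 'I_q) (fun l => smoothM oU (sA i l) (sB l j)).
by apply: smooth_on_eq S => // z _; rewrite mxE.
Qed.

Lemma smooth_mxZ {p q} (f : 'rV[R]_k -> R) (A : 'rV[R]_k -> 'M[R]_(p, q)) :
  smooth_on U f -> smooth_mx A -> smooth_mx (fun z => f z *: A z).
Proof.
move=> sf sA i j; apply: smooth_on_eq (smoothM oU sf (sA i j)) => // z _.
by rewrite mxE.
Qed.

Lemma smooth_mx_sum {p q} (I : Type) (s : seq I) (A : I -> 'rV[R]_k -> 'M[R]_(p, q)) :
  (forall a, smooth_mx (A a)) -> smooth_mx (fun z => \sum_(a <- s) A a z).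
Proof.
move=> sA i j; have S := smooth_sum oU s (fun a => sA a i j).
by apply: smooth_on_eq S => // z _; rewrite summxE.
Qed.

Lemma smooth_mx_cst {p q} (A : 'M[R]_(p, q)) : smooth_mx (fun=> A).
Proof. by move=> i j; exact: smooth_cst. Qed.

Lemma smooth_mx_tr {p q} (A : 'rV[R]_k -> 'M[R]_(p, q)) :
  smooth_mx A -> smooth_mx (fun z => (A z)^T).
Proof. by move=> sA i j; apply: smooth_on_eq (sA j i) => // z _; rewrite mxE. Qed.

Lemma pd_mx_eq {p q} r (A B : 'rV[R]_k -> 'M[R]_(p, q)) y : U y ->
  (forall z, U z -> A z = B z) -> pd_mx r A y = pd_mx r B y.
Proof.
move=> Uy AB; apply/matrixP => i j; rewrite !mxE; apply: (pd_eq_on oU) => // z Uz.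
by rewrite AB.
Qed.

Lemma pd_mxD {p q} r (A B : 'rV[R]_k -> 'M[R]_(p, q)) y : U y ->
  smooth_mx A -> smooth_mx B ->
  pd_mx r (fun z => A z + B z) y = pd_mx r A y + pd_mx r B y.
Proof.
move=> Uy sA sB; apply/matrixP => i j; rewrite !mxE.
rewrite -(smooth_pdD _ Uy (sA i j) (sB i j)).
by apply: pd_ext => z; rewrite mxE.
Qed.

Lemma pd_mxN {p q} r (A : 'rV[R]_k -> 'M[R]_(p, q)) y : U y ->
  smooth_mx A -> pd_mx r (fun z => - A z) y = - pd_mx r A y.
Proof.
move=> Uy sA; apply/matrixP => i j; rewrite !mxE -(smooth_pdN oU _ Uy (sA i j)).
by apply: pd_ext => z; rewrite mxE.
Qed.

Lemma pd_mxB {p q} r (A B : 'rV[R]_k -> 'M[R]_(p, q)) y : U y ->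
  smooth_mx A -> smooth_mx B ->
  pd_mx r (fun z => A z - B z) y = pd_mx r A y - pd_mx r B y.
Proof. by move=> Uy sA sB; rewrite (pd_mxD _ Uy sA (smooth_mxN sB)) pd_mxN. Qed.

Lemma pd_mxM {p q s} r (A : 'rV[R]_k -> 'M[R]_(p, q)) (B : 'rV[R]_k -> 'M[R]_(q, s)) y :
  U y -> smooth_mx A -> smooth_mx B ->
  pd_mx r (fun z => A z *m B z) y = pd_mx r A y *m B y + A y *m pd_mx r B y.
Proof.
move=> Uy sA sB; apply/matrixP => i j; rewrite !mxE.
have -> : (fun z => (A z *m B z) i j) = (fun z => \sum_l A z i l * B z l j).
  by apply/funext => z; rewrite mxE.
rewrite (smooth_pd_sum oU _ _ Uy (fun l => smoothM oU (sA i l) (sB l j))) -big_split.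
by apply: eq_bigr => l _; rewrite (smooth_pdM _ Uy (sA i l) (sB l j)) !mxE.
Qed.

Lemma pd_mxZ {p q} r (f : 'rV[R]_k -> R) (A : 'rV[R]_k -> 'M[R]_(p, q)) y : U y ->
  smooth_on U f -> smooth_mx A ->
  pd_mx r (fun z => f z *: A z) y = pd r f y *: A y + f y *: pd_mx r A y.
Proof.
move=> Uy sf sA; apply/matrixP => i j; rewrite !mxE -(smooth_pdM _ Uy sf (sA i j)).
by apply: pd_ext => z; rewrite mxE.
Qed.

Lemma pd_mx_sum {p q} (I : Type) (s : seq I) r (A : I -> 'rV[R]_k -> 'M[R]_(p, q)) y :
  U y -> (forall a, smooth_mx (A a)) ->
  pd_mx r (fun z => \sum_(a <- s) A a z) y = \sum_(a <- s) pd_mx r (A a) y.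
Proof.
move=> Uy sA; apply/matrixP => i j; rewrite mxE summxE.
transitivity (\sum_(a <- s) pd r (fun z => A a z i j) y); last first.
  by apply: eq_bigr => a _; rewrite mxE.
rewrite -(smooth_pd_sum oU s r Uy (fun a => sA a i j)).
by apply: pd_ext => z; rewrite summxE.
Qed.

Lemma pd_mx_tr {p q} r (A : 'rV[R]_k -> 'M[R]_(p, q)) y :
  pd_mx r (fun z => (A z)^T) y = (pd_mx r A y)^T.
Proof.
apply/matrixP => i j; rewrite [RHS]mxE !pd_mxE.
by apply: pd_ext => z; rewrite mxE.
Qed.

Lemma pd_mx_comm {p q} r s (A : 'rV[R]_k -> 'M[R]_(p, q)) y : U y -> smooth_mx A ->
  pd_mx r (pd_mx s A) y = pd_mx s (pd_mx r A) y.
Proof.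
move=> Uy sA; apply/matrixP => i j.
have E a b : pd_mx a (pd_mx b A) y i j = pd a (pd b (fun z => A z i j)) y.
  by apply: (etrans (pd_mxE _ _ _ _ _)); apply: pd_ext => z; exact: pd_mxE.
exact: (etrans (E r s) (etrans (pd_comm r s oU Uy (sA i j)) (esym (E s r)))).
Qed.

Lemma smooth_det {p} (A : 'rV[R]_k -> 'M[R]_p) : smooth_mx A ->
  smooth_on U (fun z => \det (A z)).
Proof.
move=> sA; rewrite /determinant.
apply: (smooth_sum oU) => s; apply: (smoothM oU (smooth_cst oU _)).
by apply: (smooth_prod oU) => i; exact: sA.
Qed.

Lemma smooth_mx_inv {p} (A : 'rV[R]_k -> 'M[R]_p) : smooth_mx A ->
  (forall z, U z -> A z \in unitmx) -> smooth_mx (fun z => invmx (A z)).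
Proof.
move=> sA uA i j.
have sD : smooth_on U (fun z => (\det (A z))^-1).
  apply: (smoothV oU) (smooth_det sA).
  by move=> z Uz; rewrite -unitfE; exact: uA.
have sC : smooth_on U (fun z => cofactor (A z) j i).
  rewrite /cofactor; apply: (smoothM oU (smooth_cst oU _)).
  apply: smooth_det => a b; apply: smooth_on_eq (sA (lift j a) (lift i b)) => // z _.
  by rewrite !mxE.
apply: smooth_on_eq (smoothM oU sD sC) => // z Uz.
by rewrite /invmx uA // !mxE.
Qed.

End MatrixCalculus.
Opaque pd_mx.

(** * Uniqueness for linear systems of differential equations *)

Section LinearODE.
Context {R : realType} {k : nat}.

Lemma sum_sqr_le (T : finType) (g : T -> R) :
  (\sum_a `|g a|) ^+ 2 <= #|T|%:R * \sum_a g a ^+ 2.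
Proof.
have E : \sum_a \sum_b (g a ^+ 2 + g b ^+ 2) / 2 = #|T|%:R * \sum_a g a ^+ 2.
  transitivity (\sum_a (#|T|%:R * g a ^+ 2 / 2 + (\sum_b g b ^+ 2) / 2)).
    apply: eq_bigr => a _; rewrite -mulr_suml big_split /= sumr_const mulrDl.
    by rewrite mulr_natl.
  rewrite big_split /= sumr_const -mulr_suml -mulr_sumr.
  rewrite -[_ / 2 *+ _]mulr_natl mulrA -splitr //.
rewrite -E expr2 mulr_suml; apply: ler_sum => a _; rewrite mulr_sumr.
apply: ler_sum => b _; rewrite -(real_normK (num_real (g a))) -(real_normK (num_real (g b))).
have := sqr_ge0 (`|g a| - `|g b|); rewrite sqrrB; lra.
Qed.

Lemma is_derive_bigsum (T : Type) (s : seq T) (F : T -> R -> R) (dF : T -> R) (x : R) :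
  (forall a, is_derive x 1 (F a) (dF a)) ->
  is_derive x 1 (fun t => \sum_(a <- s) F a t) (\sum_(a <- s) dF a).
Proof.
move=> hF; elim: s => [|a s IHs].
  rewrite big_nil (_ : (fun _ => _) = cst 0); first exact: is_derive_cst.
  by apply/funext => t; rewrite big_nil.
rewrite big_cons (_ : (fun _ => _) = (F a + (fun t => \sum_(b <- s) F b t))).
  exact: is_deriveD.
by apply/funext => t; rewrite big_cons.
Qed.

(* Gronwall's inequality for the energy [\sum_a (u a)^2] along segments. *)
Lemma linear_ode_zero (T : finType) (u : T -> 'rV[R]_k -> R) (y0 : 'rV[R]_k)
  (r C : R) :
  let B := [set y | `|y - y0| < r] in
  open B -> 0 <= C ->
  (forall a, smooth_on B (u a)) ->
  (forall y, B y -> forall i a, `|pd i (u a) y| <= C * \sum_b `|u b y|) ->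
  forall y1, B y1 -> (forall a, u a y1 = 0) ->
  forall y, B y -> forall a, u a y = 0.
Proof.
move=> B oB C0 su hu y1 By1 u1 y By.
pose d := y - y1; pose g a (t : R) := u a (y1 + t *: d).
have Bt (t : R) : 0 <= t <= 1 -> B (y1 + t *: d).
  move=> t01; apply: (path_in_ball By1 By) => i; exists t => //.
  by rewrite !mxE.
pose dg a (t : R) := \sum_i d 0 i * pd i (u a) (y1 + t *: d).
have gd a (t : R) : 0 <= t <= 1 -> is_derive t 1 (g a) (dg a t).
  move=> t01; have df := smooth_differentiable oB (su a) (Bt _ t01).
  rewrite /dg -(differentiable_derive d df); apply: is_derive_line.
  exact: diff_derivable.
pose K := k%:R * `|d| * C.
have K0 : 0 <= K by rewrite !mulr_ge0.
have dgle a (t : R) : 0 <= t <= 1 -> `|dg a t| <= K * \sum_b `|g b t|.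
  move=> t01; apply: le_trans (ler_norm_sum _ _ _) _.
  rewrite /K -!mulrA -[leRHS](_ : \sum_(i < k) (`|d| * (C * \sum_b `|g b t|)) = _); last first.
    by rewrite sumr_const card_ord mulr_natl.
  apply: ler_sum => i _; rewrite normrM ler_pM //; first exact: rV_coord_le.
  exact: hu (Bt _ t01) i a.
(* The 2 comes from differentiating squares, [#|T|] from the Cauchy-Schwarz bound [sum_sqr_le]. *)
pose L := 2 * K * #|T|%:R.
pose E t := \sum_a g a t ^+ 2.
pose dE t := \sum_a (g a t * dg a t) *+ 2.
have EL (t : R) : 0 <= t <= 1 -> dE t <= L * E t.
  move=> t01; apply: (@le_trans _ _ (\sum_a (2 * K) * (`|g a t| * \sum_b `|g b t|))).
    apply: ler_sum => a _; rewrite -mulr_natl -mulrA ler_pM2l //.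
    apply: le_trans (ler_norm _) _; rewrite normrM mulrCA ler_wpM2l //.
    exact: dgle.
  rewrite -mulr_sumr -mulr_suml /L -[leRHS]mulrA ler_wpM2l ?mulr_ge0 //.
  by rewrite -expr2; exact: sum_sqr_le.
(* By [EL] the derivative of [H] is nonpositive, and [H 0 = 0]; the mean value theorem gives
   [H 1 <= 0], hence [E 1 <= 0]. *)
pose H t := E t * expR (- (L * t)).
have Hd (t : R) : 0 <= t <= 1 ->
    is_derive t 1 H (expR (- (L * t)) * (dE t - L * E t)).
  move=> t01.
  have Ed : is_derive t 1 E (dE t).
    apply: is_derive_bigsum => a; have := is_deriveX 2 (gd a t t01).
    rewrite expr1 /GRing.scale /= => h.
    by rewrite -mulrA mulr_natl in h; exact: h.
  have ed : is_derive t 1 (fun t => expR (- (L * t))) (expR (- (L * t)) * - L).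
    apply: (@is_derive1_comp R expR (fun t => - (L * t)) t).
    by apply: is_derive_eq; rewrite /GRing.scale /= mulr1.
  have h := is_deriveM Ed ed; rewrite /GRing.scale /= in h.
  by apply: is_derive_eq; ring.
have Hc : {within `[0, 1], continuous H}.
  by apply: derivable_within_continuous => t; rewrite in_itv/= => /Hd[].
have Hd' (t : R) : t \in `]0, 1[ -> is_derive t 1 H (expR (- (L * t)) * (dE t - L * E t)).
  by rewrite in_itv/= => /andP[/ltW t0 /ltW t1]; apply: Hd; rewrite t0.
have [c] := MVT ltr01 Hd' Hc.
rewrite in_itv/= (subr0 1) mulr1 => /andP[/ltW c0 /ltW c1] HE.
have H0 : H 0 = 0.
  rewrite /H /E big1 ?mul0r // => a _.
  by rewrite /g scale0r addr0 u1 expr0n.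
have E1 : E 1 <= 0.
  have : H 1 <= 0.
    rewrite H0 subr0 in HE; rewrite HE pmulr_rle0 ?expR_gt0 // subr_le0.
    by apply: EL; rewrite c0.
  by rewrite /H pmulr_lle0 // expR_gt0.
move=> a; have : g a 1 ^+ 2 <= 0.
  apply: le_trans E1; rewrite /E (bigD1 a) //= lerDl sumr_ge0 // => b _.
  exact: sqr_ge0.
rewrite real_exprn_even_le0 ?num_real //= => /eqP.
by rewrite /g scale1r /d addrC subrK.
Qed.

End LinearODE.

(** * The inverse function theorem and charts *)

(** Row vectors are thereby a complete space, as the Banach fixed point theorem demands. *)
HB.instance Definition _ (R : realType) m n := Complete.on 'M[R]_(m, n).

Lemma open_normball {R : realType} {n : nat} (a : 'rV[R]_n) (r : R) :
  open [set y | `|y - a| < r].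
Proof.
rewrite openE => y yr; apply: (@near_normI _ _ y _ (r - `|y - a|)).
  by rewrite subr_gt0.
move=> z zy /=; rewrite -(subrK y z) -addrA; apply: le_lt_trans (ler_normD _ _) _.
by rewrite -ltrBrDr.
Qed.

Lemma near_normball {R : realType} {n : nat} (a y : 'rV[R]_n) (r : R) :
  `|y - a| < r -> \forall z \near y, `|z - a| < r.
Proof. by move=> yr; have := @open_normball R n a r; rewrite openE => /(_ y yr). Qed.

Section InverseFunction.
Context {R : realType} {n : nat}.
Implicit Types (x y v : 'rV[R]_n).

Lemma norm_mulmx_le (p q : nat) (v : 'rV[R]_p) (A : 'M[R]_(p, q)) :
  `|v *m A| <= (\sum_i \sum_j `|A i j|) * `|v|.
Proof.
have S0 : 0 <= \sum_i \sum_j `|A i j| by apply: sumr_ge0 => i _; exact: sumr_ge0.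
apply/rV_norm_le => [|j]; first exact: mulr_ge0.
rewrite mxE; apply: le_trans (ler_norm_sum _ _ _) _; rewrite mulr_suml.
apply: ler_sum => i _; rewrite normrM mulrC ler_pM //; last exact: rV_coord_le.
by rewrite (bigD1 j) //= lerDl sumr_ge0.
Qed.

(** The transpose of the usual Jacobian matrix: the differential acts on row vectors by
    multiplication on the right. *)
Definition jacobian_rows (Y : 'rV[R]_n -> 'rV[R]_n) x : 'M[R]_n :=
  \matrix_(l, j) pd l (fun z => Y z 0 j) x.

Lemma contraction_fixed_point (F : 'rV[R]_n -> 'rV[R]_n) x0 (r : R) : 0 <= r ->
  (forall x, `|x - x0| <= r -> `|F x - x0| <= r) ->
  (forall x y, `|x - x0| <= r -> `|y - x0| <= r -> `|F x - F y| <= 2^-1 * `|x - y|) ->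
  exists2 x, `|x - x0| <= r & F x = x.
Proof.
move=> r0 Fr Fc; pose D := [set x | `|x - x0| <= r].
have FD : set_fun D D F by move=> x; exact: Fr.
pose Fm := isFun.Build _ _ D D F FD.
pose FF : {fun D >-> D} := HB.pack F Fm.
have ctr : is_contraction FF.
  have h2 : 0 <= 2^-1 :> R by [].
  exists (NngNum h2); split => /=; first by rewrite invf_lt1 // ltr1n.
  by move=> [x y] /= [xD yD]; exact: Fc.
have cD : closed D.
  have := @closed_closed_ball_ _ 'rV[R]_n x0 r; rewrite /closed_ball_.
  by rewrite (_ : [set y | _] = D) //; apply/funext => y; rewrite /D /= distrC.
have [|p Dp pE] := banach_fixed_point ctr cD; first by exists x0; rewrite /D /= subrr normr0.
by exists p.
Qed.

(** With [K] the inverse of the Jacobian at [x0], the Newton map x - Y(x) K has zero derivative at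
    [x0], so it is a contraction by 1/2 near [x0]; solving Y(x) = y is finding a fixed point of that
    map translated by y K. *)
Theorem inverse_function (U : set 'rV[R]_n) (Y : 'rV[R]_n -> 'rV[R]_n) x0 :
  open U -> U x0 -> (forall j, smooth_on U (fun x => Y x 0 j)) ->
  jacobian_rows Y x0 \in unitmx ->
  exists (r : R) (V : set 'rV[R]_n) (X : 'rV[R]_n -> 'rV[R]_n),
    [/\ 0 < r, open V /\ V `<=` U, V x0,
        forall x, V x -> `|Y x - Y x0| < r /\ X (Y x) = x
     & (forall y, `|y - Y x0| < r -> V (X y) /\ Y (X y) = y) /\
       forall j, smooth_on [set y | `|y - Y x0| < r] (fun y => X y 0 j)].
Proof.
move=> oU Ux0 sY uJ.
have sJ : smooth_mx U (jacobian_rows Y).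
  by move=> l j; apply: smooth_on_eq (smooth_on_pd l (sY j)) => // z _; rewrite mxE.
pose J0 := jacobian_rows Y x0; pose K := invmx J0.
have [r1 r10 rU] := open_ballP oU Ux0.
have [r2 r20 rdet] : exists2 r, 0 < r & forall x, `|x - x0| < r -> jacobian_rows Y x \in unitmx.
  have d0 : \det J0 != 0 by rewrite -unitfE.
  have dc : {for x0, continuous (fun x => \det (jacobian_rows Y x))}.
    exact: (smooth_cont (smooth_det oU sJ) Ux0).
  have [|r r0 hr] := @cont_near_le _ _ _ x0 (`|\det J0| / 2) _ dc.
    by rewrite divr_gt0 // normr_gt0.
  exists r => // x /hr h; rewrite unitmxE unitfE; apply: contraTneq h => ->.
  rewrite sub0r normrN -ltNge ltr_pdivrMr // ltr_pMr ?ltr1n //.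
  by rewrite normr_gt0.
pose T i x : R := x 0 i - \sum_j Y x 0 j * K j i.
have sT i : smooth_on U (T i).
  apply: (smoothB oU (smooth_coord oU i)); apply: (smooth_sum oU) => j.
  exact: (smoothM oU (sY j) (smooth_cst oU _)).
have dT i l : pd l (T i) x0 = 0.
  rewrite /T (smooth_pdB oU _ Ux0 (smooth_coord oU i)); last first.
    by apply: (smooth_sum oU) => j; exact: (smoothM oU (sY j) (smooth_cst oU _)).
  rewrite pd_coord (smooth_pd_sum oU _ _ Ux0); last first.
    by move=> j; exact: (smoothM oU (sY j) (smooth_cst oU _)).
  have : (J0 *m K) l i = (l == i)%:R by rewrite mulmxV // mxE.
  rewrite mxE => <-; apply/eqP; rewrite subr_eq0; apply/eqP/eq_bigr => j _.
  by rewrite (smooth_pdM _ Ux0 (sY j) (smooth_cst oU _)) pd_cst mulr0 addr0 mxE.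
(* Partial derivatives of [TT] below [e] give the Lipschitz constant [n * e], which is below 1/2. *)
pose e : R := (2 * (n%:R + 1))^-1.
have e0 : 0 < e by rewrite invr_gt0 mulr_gt0 // ltr_wpDl.
have [r3 r30 r3h] : exists2 r, 0 < r & forall (il : 'I_n * 'I_n) z, `|z - x0| < r ->
    `|pd il.2 (T il.1) z - pd il.2 (T il.1) x0| <= e.
  apply: (@fin_cont_near_le _ _ _ (fun il : 'I_n * 'I_n => pd il.2 (T il.1)) x0 e e0).
  by move=> il; exact: (smooth_cont (smooth_on_pd _ (sT _)) Ux0).
pose rho := Num.min r1 (Num.min r2 r3).
have rho0 : 0 < rho by rewrite !lt_min r10 r20.
have rhoP z : `|z - x0| < rho -> [/\ U z, jacobian_rows Y z \in unitmx
    & forall i l, `|pd l (T i) z| <= e].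
  rewrite !lt_min => /andP[/rU Uz /andP[/rdet uz /r3h h]]; split => // i l.
  by have := h (i, l); rewrite /= dT subr0.
pose TT x : 'rV[R]_n := \row_i T i x.
have TTE x : TT x = x - Y x *m K by apply/rowP => i; rewrite !mxE.
have TTlip a b : `|a - x0| < rho -> `|b - x0| < rho -> `|TT a - TT b| <= 2^-1 * `|a - b|.
  move=> ha hb; apply/rV_norm_le => [|i]; first by rewrite mulr_ge0.
  have h1 z : `|z - x0| < rho -> forall l, derivable (T i) z (delta_mx 0 l).
    by move=> /rhoP[Uz _ _] l; exact: smooth_derivable (sT i) Uz.
  have h2 z : `|z - x0| < rho -> forall l, `|pd l (T i) z - 0| <= e.
    by move=> /rhoP[_ _ h] l; rewrite subr0.
  have := mean_value h1 h2 hb ha.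
  rewrite big1 => [|l _]; last by rewrite mul0r.
  rewrite subr0 !mxE => h; apply: le_trans h _; rewrite ler_wpM2r //.
  rewrite /e invfM mulrCA ger_pMr // ler_pdivrMr ?ltr_wpDl ?ler0n //.
  by rewrite mul1r lerDl.
pose c : R := 1 + \sum_i \sum_j `|K i j|.
have c0 : 0 < c.
  by rewrite ltr_pwDl // sumr_ge0 // => i _; exact: sumr_ge0.
have cK v : `|v *m K| <= c * `|v|.
  by apply: le_trans (norm_mulmx_le _ _) _; rewrite ler_wpM2r // lerDr.
(* For [y] within [r] the fixed-point map moves the ball of radius [rho / 2] into the one of radius
   rho/4 + rho/8, strictly inside it. *)
pose r := rho / (8 * c).
have r0 : 0 < r by rewrite divr_gt0 // mulr_gt0.
have cr : c * r = rho / 8.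
  by rewrite /r; field; rewrite gt_eqF.
have hrho : rho / 2 < rho by rewrite ltr_pdivrMr // ltr_pMr ?ltr1n.
have sol y : `|y - Y x0| < r -> exists2 x, `|x - x0| < rho / 2 & Y x = y.
  move=> yr; pose F x := TT x + y *m K.
  have F0 x : `|x - x0| <= rho / 2 -> `|F x - x0| <= `|x - x0| / 2 + rho / 8.
    move=> hx; have -> : F x - x0 = (TT x - TT x0) + (y - Y x0) *m K.
      by rewrite /F !TTE mulmxBl; apply/rowP => i; rewrite !mxE; ring.
    apply: le_trans (ler_normD _ _) _; apply: lerD.
      rewrite mulrC; apply: TTlip; first exact: le_lt_trans hrho.
      by rewrite subrr normr0.
    by apply: le_trans (cK _) _; rewrite -cr ler_pM2l // ltW.
  have [|x hx|x x' hx hx'|x hx xE] := @contraction_fixed_point F x0 (rho / 2).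
  - by rewrite divr_ge0 // ltW.
  - by apply: le_trans (F0 x hx) _; clear -hx rho0; lra.
  - by rewrite /F opprD addrACA subrr addr0; apply: TTlip; exact: le_lt_trans hrho.
  exists x.
    by rewrite -xE; apply: le_lt_trans (F0 x hx) _; clear -hx rho0; lra.
  move: xE; rewrite /F TTE -addrA -mulNmx -mulmxDl => /(canRL (addKr _)).
  rewrite addNr => /(congr1 (mulmx^~ J0)); rewrite /= mul0mx mulmxKV // => E.
  by apply/eqP; rewrite -subr_eq0 -oppr_eq0 opprB addrC E.
pose V := [set x | `|x - x0| < rho / 2 /\ `|Y x - Y x0| < r].
have VU x : V x -> `|x - x0| < rho by case=> h _; exact: lt_trans hrho.
(* Besides injectivity this bounds increments of the inverse: [X] is Lipschitz with constant
   [2 * c]. *)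
have inj a b : `|a - x0| < rho -> `|b - x0| < rho ->
    `|a - b| <= 2 * c * `|Y a - Y b|.
  move=> ha hb; have := TTlip _ _ ha hb; rewrite !TTE.
  have -> : a - Y a *m K - (b - Y b *m K) = (a - b) - (Y a - Y b) *m K.
    by rewrite mulmxBl; apply/rowP => i; rewrite !mxE; ring.
  have := cK (Y a - Y b); have := lerB_dist (a - b) ((Y a - Y b) *m K).
  move: `|(Y a - Y b) *m K| `|a - b - _| `|a - b| `|Y a - Y b| => p q s t.
  clear; lra.
have Vx0 : V x0 by rewrite /V /= !subrr normr0; split => //; rewrite divr_gt0.
have [X XP] : {X : 'rV[R]_n -> 'rV[R]_n & forall y, `|y - Y x0| < r ->
    V (X y) /\ Y (X y) = y}.
  apply: (@choice _ _ (fun y x => `|y - Y x0| < r -> V x /\ Y x = y)) => y.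
  have [yr|yr] := pselect (`|y - Y x0| < r); last by exists x0.
  by have [x hx xE] := sol y yr; exists x => _; rewrite /V /= xE.
have oV : open V.
  rewrite openE => x Vx; have [Ux _ _] := rhoP _ (VU _ Vx).
  have cY : {for x, continuous Y}.
    by apply: continuous_rV => j; exact: smooth_cont (sY j) Ux.
  exact: filterI (near_normball Vx.1) (cY _ (near_normball Vx.2)).
have XK x : V x -> X (Y x) = x.
  move=> Vx; have [VX YX] := XP _ Vx.2; apply/eqP; rewrite -subr_eq0 -normr_le0.
  by apply: le_trans (inj _ _ (VU _ VX) (VU _ Vx)) _; rewrite YX subrr normr0 mulr0.
exists r, V, X; split => //.
- by split => // x /VU /rhoP[].
- by move=> x Vx; split; [exact: Vx.2|exact: XK].
split => //.
pose W := [set y | `|y - Y x0| < r].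
have oW : open W by exact: open_normball.
have dX y0 l i : W y0 -> derivable (fun y => X y 0 i) y0 (delta_mx 0 l) /\
    pd l (fun y => X y 0 i) y0 = invmx (jacobian_rows Y (X y0)) l i.
  move=> Wy0; have [VX YX] := XP _ Wy0; have [UX uX _] := rhoP _ (VU _ VX).
  set x := X y0 in VX YX UX uX *; set A := jacobian_rows Y x.
  suff H : (fun h : R => h^-1 *: (X (h *: delta_mx 0 l + y0) 0 i - X y0 0 i)) @ 0^'
      --> invmx A l i.
    split; first by apply/cvg_ex; exists (invmx A l i).
    by rewrite pdE; apply/cvg_lim.
  apply/cvgrPdist_le => /= e1 e10.
  pose c1 : R := 1 + \sum_a \sum_b `|invmx A a b|.
  have c10 : 0 < c1 by rewrite ltr_pwDl // sumr_ge0 // => a _; exact: sumr_ge0.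
  (* Compensates the three losses below: [c1] for the inverse Jacobian, [2 * c] for the Lipschitz
     bound on [X], and [n] for the mean value estimate. *)
  pose e2 := e1 / (c1 * (2 * c) * (n%:R + 1)).
  have e20 : 0 < e2.
    by rewrite divr_gt0 // !mulr_gt0 // ltr_wpDl.
  have [r4 r40 h4] : exists2 r, 0 < r & forall (ab : 'I_n * 'I_n) z, `|z - x| < r ->
      `|pd ab.1 (fun z => Y z 0 ab.2) z - pd ab.1 (fun z => Y z 0 ab.2) x| <= e2.
    apply: (@fin_cont_near_le _ _ _ (fun ab : 'I_n * 'I_n => pd ab.1 (fun z => Y z 0 ab.2)) x e2 e20).
    by move=> ab; exact: (smooth_cont (smooth_on_pd _ (sY _)) UX).
  have [r5 r50 h5] := open_ballP oU UX.
  have [r6 r60 h6] := open_ballP oW Wy0.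
  pose r7 := Num.min r6 (Num.min r4 r5 / (2 * c)).
  have r70 : 0 < r7 by rewrite lt_min r60 divr_gt0 ?mulr_gt0 // lt_min r40.
  near=> h.
  have h0 : h != 0 by near: h; exact: nbhs_dnbhs_neq.
  have hr7 : `|h| < r7 by near: h; exact: dnbhs0_lt.
  pose b := X (h *: delta_mx 0 l + y0); pose kk := b - x.
  have he : `|h *: delta_mx 0 l : 'rV[R]_n| <= `|h|.
    apply/rV_norm_le => // a; rewrite !mxE normrM ler_piMr // normr_nat.
    by case: (_ && _).
  have Wb : W (h *: delta_mx 0 l + y0).
    by apply: h6; rewrite addrK; apply: le_lt_trans he _; apply: lt_le_trans hr7 _;
       rewrite ge_min lexx.
  have [Vb Yb] := XP _ Wb; rewrite -/b in Vb Yb.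
  have kkle : `|kk| <= 2 * c * `|h|.
    apply: le_trans (inj _ _ (VU _ Vb) (VU _ VX)) _; rewrite Yb YX addrK.
    by rewrite ler_wpM2l // mulr_ge0 // ltW.
  have kklt : `|kk| < Num.min r4 r5.
    apply: le_lt_trans kkle _; rewrite mulrC -ltr_pdivlMr ?mulr_gt0 //.
    by apply: lt_le_trans hr7 _; rewrite ge_min lexx orbT.
  pose w := h *: delta_mx 0 l - kk *m A.
  have wle : `|w| <= n%:R * e2 * (2 * c * `|h|).
    have P0 : 0 <= n%:R * e2 * (2 * c * `|h|).
      exact: (mulr_ge0 (mulr_ge0 (ler0n _ _) (ltW e20)) (mulr_ge0 (mulr_ge0 (ler0n _ 2) (ltW c0)) (normr_ge0 _))).
    apply/rV_norm_le => [//|j].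
    have m1 z : `|z - x| < Num.min r4 r5 -> forall a, derivable (fun z => Y z 0 j) z (delta_mx 0 a).
      move=> hz a; have Uz : U z.
        by apply: h5; apply: lt_le_trans hz _; rewrite ge_min lexx orbT.
      exact: smooth_derivable (sY j) Uz.
    have m2 z : `|z - x| < Num.min r4 r5 -> forall a,
        `|pd a (fun z => Y z 0 j) z - pd a (fun z => Y z 0 j) x| <= e2.
      by move=> hz a; apply: (h4 (a, j)); apply: lt_le_trans hz _; rewrite ge_min lexx.
    have m0 : `|x - x| < Num.min r4 r5 by rewrite subrr normr0 lt_min r40.
    have := mean_value m1 m2 m0 kklt; rewrite Yb YX => H.
    have E : w 0 j = (h *: delta_mx 0 l + y0) 0 j - y0 0 j -
        \sum_a pd a (fun z => Y z 0 j) x * (b 0 a - x 0 a).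
      rewrite /w !mxE addrK; congr (_ - _); apply: eq_bigr => a _.
      by rewrite !mxE mulrC.
    rewrite E; apply: le_trans H _; by apply: ler_wpM2l kkle; exact: (mulr_ge0 (ler0n _ _) (ltW e20)).
  have E : invmx A l i - h^-1 *: (b 0 i - x 0 i) = h^-1 * (w *m invmx A) 0 i.
    rewrite /w mulmxBl mulmxK // -scalemxAl -rowE !mxE mulrBr mulKf //.
  rewrite E normrM normfV mulrC ler_pdivrMr ?normr_gt0 //.
  apply: le_trans (rV_coord_le _ _) _; apply: le_trans (norm_mulmx_le _ _) _.
  apply: (@le_trans _ _ (c1 * `|w|)); first by rewrite ler_wpM2r // lerDr.
  apply: (@le_trans _ _ (c1 * (n%:R * e2 * (2 * c * `|h|)))); first by rewrite ler_wpM2l // ltW.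
  rewrite !mulrA ler_wpM2r // (_ : _ * c = e1 * (n%:R / (n%:R + 1))).
    rewrite ger_pMr // ler_pdivrMr ?ltr_wpDl ?ler0n //.
    by rewrite mul1r lerDl.
  rewrite /e2; field; rewrite !gt_eqF // ltr_wpDl //.
have cX y0 : W y0 -> {for y0, continuous X}.
  move=> Wy0; apply/(@cvgrPdist_le _ 'rV[R]_n _ (nbhs y0)) => e1 e10.
  have N1 := near_normball Wy0.
  have N2 : \forall y \near y0, `|y - y0| < e1 / (2 * c).
    by apply: near_normball; rewrite subrr normr0 divr_gt0 // mulr_gt0.
  apply: filterS (filterI N1 N2) => y [Wy ylt].
  have [VX YX] := XP _ Wy0; have [VX' YX'] := XP _ Wy.
  apply: le_trans (inj _ _ (VU _ VX) (VU _ VX')) _; rewrite YX YX' distrC.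
  by move: ylt; rewrite ltr_pdivlMr ?mulr_gt0 // mulrC => /ltW.
have oVr : V `<=` U by move=> x /VU /rhoP[].
have sJV : smooth_mx V (jacobian_rows Y) by move=> a b; exact: smooth_on_sub oVr (sJ a b).
have sI := smooth_mx_inv oV sJV (fun z Vz => let: And3 _ h _ := rhoP _ (VU _ Vz) in h).
(* Bootstrapping: the derivatives of [X] are entries of the inverse Jacobian composed with [X], so
   smoothness of order [N] of [X] yields order [N + 1]. *)
suff H N i : smooth_upto N W (fun y => X y 0 i) by move=> i; apply/smooth_uptoP.
have H0 y : W y -> {for y, continuous (fun y => X y 0 i)} /\
    forall l, derivable (fun y => X y 0 i) y (delta_mx 0 l).
  move=> Wy; split => [|l]; last exact: (dX y l i Wy).1.
  exact: (@continuous_comp _ _ _ X (fun v : 'rV[R]_n => v 0 i) y (cX y Wy) (@coord_continuous _ _ _ _ _ _)).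
elim: N i H0 => [|N IHN] i H0; split => // l.
have H1 j y : W y -> {for y, continuous (fun y => X y 0 j)} /\
    forall l, derivable (fun y => X y 0 j) y (delta_mx 0 l).
  move=> Wy; split => [|l']; last exact: (dX y l' j Wy).1.
  exact: (@continuous_comp _ _ _ X (fun v : 'rV[R]_n => v 0 j) y (cX y Wy) (@coord_continuous _ _ _ _ _ _)).
apply: (@smooth_upto_eq _ _ _ _ (fun y => invmx (jacobian_rows Y (X y)) l i)) => //.
  by move=> z Wz; rewrite (dX z l i Wz).2.
apply: (smooth_upto_comp oW oV (fun y Wy => (XP y Wy).1)
  (iffLR (smooth_uptoP _ _) (sI l i) N.+1)) => j.
by apply: IHN; exact: H1.
Unshelve. all: by end_near.
Qed.

End InverseFunction.

(** * Charts given by coordinate functions *)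

Section Charts.
Context {R : realType} {n : nat}.

Lemma overlap_open (M : topologicalType) (c d : chart R n M) : open (overlap c d).
Proof.
rewrite openE => y [q [cq dq] <-].
have iq : cimg c (cmap c q) by exists q.
have N1 := open_near (@cimg_open _ _ _ c) iq.
have N2 : nbhs (cinv c (cmap c q)) (cdom d).
  by rewrite cmapK //; apply: open_nbhs_nbhs; split => //; exact: cdom_open.
apply: filterS (filterI N1 (cinv_continuous iq N2)) => z [[q' cq' <-]].
by rewrite /= cmapK // => h; exists q'.
Qed.

Lemma cimgP (M : topologicalType) (c : chart R n M) y : cimg c y ->
  cdom c (cinv c y) /\ cmap c (cinv c y) = y.
Proof. by move=> [q cq <-]; rewrite cmapK. Qed.

Lemma transition_cmap (M : topologicalType) (c d : chart R n M) q i : cdom c q ->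
  transition c d i (cmap c q) = cmap d q 0 i.
Proof. by move=> cq; rewrite /transition cmapK. Qed.

(** The domain is cut down so that the image is a full ball, as Poincare's lemma and integration
    along segments will require. Maximality of the atlas admits the new chart, both transition maps
    being compositions of smooth maps. *)
Lemma chart_of_coordinates (M : smooth_manifold R n) (c : chart R n M) (p : M)
  (U : set 'rV[R]_n) (Y : 'rV[R]_n -> 'rV[R]_n) :
  atlas M c -> cdom c p -> open U -> U `<=` cimg c -> U (cmap c p) ->
  (forall j, smooth_on U (fun x => Y x 0 j)) ->
  jacobian_rows Y (cmap c p) \in unitmx ->
  exists (d : chart R n M) (r : R),
    [/\ atlas M d, cdom d p, 0 < r,
        cimg d = [set y | `|y - Y (cmap c p)| < r]
      & forall q, cdom d q -> [/\ cdom c q, U (cmap c q) & cmap d q = Y (cmap c q)]].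
Proof.
move=> Mc cp oU Uc Up sY uJ.
have [r [V [X [r0 [oV VU] Vp VX [XV sX]]]]] := inverse_function oU Up sY uJ.
set B := [set y | `|y - Y (cmap c p)| < r] in sX *.
have oB : open B by exact: open_normball.
pose D : set M := [set q | cdom c q /\ V (cmap c q)].
have imD : (Y \o cmap c) @` D = B.
  apply/seteqP; split => [_ [q [cq Vq] <-]|y By]; first exact: (VX _ Vq).1.
  have [VXy YXy] := XV _ By; have [cq qE] := cimgP (Uc _ (VU _ VXy)).
  by exists (cinv c (X y)); rewrite /D /= qE.
have oD : open D.
  rewrite openE => q [cq Vq]; apply: filterI; first by apply: open_nbhs_nbhs; split => //; exact: cdom_open.
  exact: (cmap_continuous cq (open_near oV Vq)).
have oim : open ((Y \o cmap c) @` D) by rewrite imD.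
have DK q : D q -> (cinv c \o X) ((Y \o cmap c) q) = q.
  by move=> [cq Vq] /=; rewrite (VX _ Vq).2 cmapK.
have Dc q : D q -> {for q, continuous (Y \o cmap c)}.
  move=> [cq Vq]; apply: continuous_comp; first exact: cmap_continuous.
  by apply: continuous_rV => j; exact: smooth_cont (sY j) (VU _ Vq).
have Di y : ((Y \o cmap c) @` D) y -> {for y, continuous (cinv c \o X)}.
  rewrite imD => By; apply: continuous_comp.
    by apply: continuous_rV => j; exact: smooth_cont (sX j) By.
  by apply: cinv_continuous; apply: Uc; apply: VU; exact: (XV _ By).1.
pose d := Chart oD oim DK Dc Di.
have Md : atlas M d; last first.
  by exists d, r; split => // q [cq Vq]; split => //; exact: VU.
apply: atlas_maximal => e Me i; split.
- have [s1 s2] := atlas_compatible Mc Me i.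
  have h1 y : overlap d e y -> overlap c e (X y).
    by move=> [q [[cq Vq] eq] <-]; rewrite /= (VX _ Vq).2; exists q.
  have h2 j : smooth_on (overlap d e) (fun y => X y 0 j).
    by apply: smooth_on_sub (sX j) => y [q [[cq Vq] _] <-]; exact: (VX _ Vq).1.
  have S := smooth_comp (@overlap_open _ d e) (@overlap_open _ c e) h1 s1 h2.
  by apply: smooth_on_eq S; first exact: overlap_open.
- have h1 y : overlap e d y -> U (cmap c (cinv e y)).
    by move=> [q [eq [cq Vq]] <-]; rewrite /= cmapK //; exact: VU.
  have h2 j : smooth_on (overlap e d) (fun y => cmap c (cinv e y) 0 j).
    have [s1 s2] := atlas_compatible Mc Me j.
    by apply: smooth_on_sub s2 => y [q [eq [cq Vq]] <-]; exists q.
  have S := smooth_comp (@overlap_open _ e d) oU h1 (sY i) h2.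
  by apply: smooth_on_eq S; first exact: overlap_open.
Qed.

End Charts.

(** * Infinitesimal affine transformations *)

Section AffineFields.
Context {R : realType} {n : nat}.
Implicit Types (G : conn_comp R n) (eta : vect_comp R n) (y : 'rV[R]_n) (r s k : 'I_n).

(* [conn_mx G r] is the matrix [Gamma_r] with entries Gamma^i_{rs},
   [curv_mx G r k] the endomorphism R(e_r, e_k). *)
Definition conn_mx G r y : 'M[R]_n := \matrix_(i, s) G y i r s.

(** Rows are components and columns are directions of differentiation, the opposite of
    [jacobian_rows], so that it acts on column vectors. *)
Definition diff_mx eta y : 'M[R]_n := \matrix_(i, j) pd j (fun z => eta z 0 i) y.

Definition curv_mx G r k y : 'M[R]_n :=
  pd_mx r (conn_mx G k) y - pd_mx k (conn_mx G r) y
  + (conn_mx G r y *m conn_mx G k y - conn_mx G k y *m conn_mx G r y).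

Lemma curvatureE G y i s r k : curvature G y i s r k = curv_mx G r k y i s.
Proof.
rewrite /curvature /curv_mx 2!mxE pd_mxE [X in _ = _ + X + _]mxE pd_mxE.
rewrite [X in _ = _ + X]mxE [X in _ = _ + (X + _)]mxE [X in _ = _ + (_ + X)]mxE.
rewrite [X in _ = _ + (_ - X)]mxE -sumrB.
congr (_ - _ + _); try by apply: pd_ext => z; rewrite mxE.
by apply: eq_bigr => q _; rewrite !mxE; congr (_ - _); rewrite mulrC.
Qed.

Lemma addmxE (p q : nat) (A B : 'M[R]_(p, q)) i j : (A + B) i j = A i j + B i j.
Proof. by rewrite mxE. Qed.
Lemma oppmxE (p q : nat) (A : 'M[R]_(p, q)) i j : (- A) i j = - A i j.
Proof. by rewrite mxE. Qed.

(** The hypothesis equates the two mixed derivatives of [F], with [Dsr] and [Drs] the derivatives of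
    the connection matrices and [X] the symmetric term. Once the products are expanded they are
    atoms, and the claim is linear in the entries. *)
Lemma lie_curvature_algebra (F Cs Cr Dsr Drs Ps Pr Qs Qr D1 D2 P1 P2 P3 P4 X : 'M[R]_n) :
  (F *m Cs - Cs *m F - Ps - Qs) *m Cr + F *m Dsr - (Dsr *m F + Cr *m (F *m Cs - Cs *m F - Ps - Qs))
    - (P1 + D1) - (X + P2) =
  (F *m Cr - Cr *m F - Pr - Qr) *m Cs + F *m Drs - (Drs *m F + Cs *m (F *m Cr - Cr *m F - Pr - Qr))
    - (P3 + D2) - (X + P4) ->
  D1 - D2 + (Ps *m Cr + Cs *m Pr - (Pr *m Cs + Cr *m Ps)) =
  F *m (Dsr - Drs + (Cs *m Cr - Cr *m Cs)) - (Dsr - Drs + (Cs *m Cr - Cr *m Cs)) *m F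
  - (P1 - P4 + (Qs *m Cr - Cr *m Qs)) - (P2 - P3 + (Cs *m Qr - Qr *m Cs)).
Proof.
rewrite !(mulmxDl, mulmxDr, mulNmx, mulmxN, mulmxBl, mulmxBr) !mulmxA => main.
apply/matrixP => i j; move/matrixP/(_ i j): main; rewrite !(addmxE, oppmxE).
lra.
Qed.

Variable U : set 'rV[R]_n.
Hypothesis oU : open U.

Definition smooth_conn G := forall i r s, smooth_on U (fun z => G z i r s).
Definition smooth_vect eta := forall i, smooth_on U (fun z => eta z 0 i).

Lemma smooth_conn_mx G r : smooth_conn G -> smooth_mx U (conn_mx G r).
Proof. by move=> sG i s; apply: smooth_on_eq (sG i r s) => // z _; rewrite mxE. Qed.

Lemma smooth_diff_mx eta : smooth_vect eta -> smooth_mx U (diff_mx eta).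
Proof.
by move=> se i j; apply: smooth_on_eq (smooth_on_pd j (se i)) => // z _; rewrite mxE.
Qed.

Lemma smooth_curv_mx G r k : smooth_conn G -> smooth_mx U (curv_mx G r k).
Proof.
move=> sG; have sC l := smooth_conn_mx l sG.
apply: (smooth_mxD oU).
  apply: (smooth_mxD oU); first exact: smooth_mx_pd.
  by apply: (smooth_mxN oU); exact: smooth_mx_pd.
apply: (smooth_mxD oU); first exact: smooth_mxM.
by apply: (smooth_mxN oU); exact: smooth_mxM.
Qed.

(** Solving the determining equation for the second derivatives makes the pair of [eta] and
    [diff_mx eta] a solution of a linear homogeneous first-order system. *)
Lemma affine_mx G eta y : smooth_vect eta -> U y -> infinitesimal_affine eta G y ->
  forall r, pd_mx r (diff_mx eta) y =
    diff_mx eta y *m conn_mx G r y - conn_mx G r y *m diff_mx eta y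
    - \sum_k eta y 0 k *: pd_mx k (conn_mx G r) y
    - \sum_k diff_mx eta y k r *: conn_mx G k y.
Proof.
move=> se Uy aff r; apply/matrixP => i s; have := aff i r s.
rewrite pd_mxE !addmxE !oppmxE !summxE.
have -> : pd r (fun z => diff_mx eta z i s) y = pd r (pd s (fun z => eta z 0 i)) y.
  by apply: pd_ext => z; rewrite mxE.
rewrite !big_split /= [(diff_mx eta y *m _) i s]mxE [(conn_mx G r y *m _) i s]mxE.
under [in X in X = _ -> _]eq_bigr do rewrite mulrC.
set a := (X in X = _) => H.
have -> : \sum_k diff_mx eta y i k * conn_mx G r y k s = a.
  by apply: eq_bigr => k _; rewrite !mxE mulrC.
have -> : \sum_k conn_mx G r y i k * diff_mx eta y k s =
    \sum_k G y i r k * pd s (fun z => eta z 0 k) y.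
  by apply: eq_bigr => k _; rewrite !mxE.
have -> : \sum_k (eta y 0 k *: pd_mx k (conn_mx G r) y) i s =
    \sum_k pd k (fun z => G z i r s) y * eta y 0 k.
  apply: eq_bigr => k _; rewrite [LHS]mxE pd_mxE mulrC; congr (_ * _).
  by apply: pd_ext => z; rewrite mxE.
have -> : \sum_k (diff_mx eta y k r *: conn_mx G k y) i s =
    \sum_k G y i k s * pd r (fun z => eta z 0 k) y.
  by apply: eq_bigr => k _; rewrite !mxE mulrC.
have key (a' d u v w : R) : a' = d + (u + v + w) -> d = a' - w - u - v.
  by move=> ->; ring.
exact: key H.
Qed.

Section LieCurvature.
Context (G : conn_comp R n) (eta : vect_comp R n).
Hypothesis sG : smooth_conn G.
Hypothesis se : smooth_vect eta.
Hypothesis aff : forall y, U y -> infinitesimal_affine eta G y.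
Local Notation F := (diff_mx eta).
Local Notation C := (conn_mx G).
Let sC r := smooth_conn_mx r sG.
Let sF := smooth_diff_mx se.
Let sdC k r := smooth_mx_pd oU k (sC r).
Let seC k l r := smooth_mxZ oU (se k) (sdC l r).
Let sFC k a l := smooth_mxZ oU (sF k a) (sC l).

Lemma pd_diff_mx_sym y r s k : U y -> pd_mx s F y k r = pd_mx r F y k s.
Proof.
move=> Uy; have E a b : pd_mx a F y k b = pd a (pd b (fun z => eta z 0 k)) y.
  by rewrite pd_mxE; apply: pd_ext => z; rewrite mxE.
by apply: (etrans (E s r)); apply: (etrans (pd_comm s r oU Uy (se k))); rewrite E.
Qed.

(* Equality of the mixed second derivatives of [F]. *)
Lemma lie_curvature y r s : U y ->
  \sum_k eta y 0 k *: pd_mx k (curv_mx G s r) y =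
  F y *m curv_mx G s r y - curv_mx G s r y *m F y
  - \sum_k F y k s *: curv_mx G k r y - \sum_k F y k r *: curv_mx G s k y.
Proof.
move=> Uy.
pose P a := \sum_k eta y 0 k *: pd_mx k (C a) y.
pose Q a := \sum_k F y k a *: C k y.
pose D1 a b := \sum_k eta y 0 k *: pd_mx k (pd_mx a (C b)) y.
pose P1 a b := \sum_k F y k a *: pd_mx k (C b) y.
pose P2 a b := \sum_k F y k b *: pd_mx a (C k) y.
pose X a b := \sum_k pd_mx a F y k b *: C k y.
have Fr a z : U z -> pd_mx a F z = F z *m C a z - C a z *m F z
    - \sum_k eta z 0 k *: pd_mx k (C a) z - \sum_k F z k a *: C k z.
  by move=> Uz; exact: affine_mx (aff Uz) a.
have FrE a : pd_mx a F y = F y *m C a y - C a y *m F y - P a - Q a by exact: Fr.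
(* [X] is the only term with second derivatives of [eta]; being symmetric, it cancels between the
   two mixed derivatives of [F]. *)
have Xsym a b : X a b = X b a by apply: eq_bigr => k _; congr (_ *: _); exact: pd_diff_mx_sym.
have second a b : pd_mx b (pd_mx a F) y =
    pd_mx b F y *m C a y + F y *m pd_mx b (C a) y
    - (pd_mx b (C a) y *m F y + C a y *m pd_mx b F y)
    - (P1 b a + D1 b a) - (X b a + P2 b a).
  rewrite (pd_mx_eq oU b Uy (Fr a)).
  have sP := smooth_mx_sum oU (index_enum 'I_n) (fun k => seC k k a).
  have sQ := smooth_mx_sum oU (index_enum 'I_n) (fun k => sFC k a k).
  have s1 := smooth_mxM oU sF (sC a); have s2 := smooth_mxM oU (sC a) sF.
  have s3 := smooth_mxD oU s1 (smooth_mxN oU s2).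
  have s4 := smooth_mxD oU s3 (smooth_mxN oU sP).
  rewrite (pd_mxB oU b Uy s4 sQ) (pd_mxB oU b Uy s3 sP) (pd_mxB oU b Uy s1 s2).
  rewrite (pd_mxM oU b Uy sF (sC a)) (pd_mxM oU b Uy (sC a) sF).
  congr (_ - _ - _).
    rewrite (pd_mx_sum oU _ b Uy (fun k => seC k k a)).
    rewrite -big_split; apply: eq_bigr => k _ /=.
    rewrite (pd_mxZ b Uy (se k) (sdC k a)) (pd_mx_comm oU b k Uy (sC a)).
    by congr (_ *: _ + _); rewrite mxE.
  rewrite (pd_mx_sum oU _ b Uy (fun k => sFC k a k)).
  rewrite -big_split; apply: eq_bigr => k _ /=.
  rewrite (pd_mxZ b Uy (sF k a) (sC k)).
  by congr (_ *: _ + _); rewrite pd_mxE.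
have main := pd_mx_comm oU s r Uy sF.
rewrite (second r s) (second s r) (Xsym r s) (FrE r) (FrE s) in main.
have curvD a k l : pd_mx k (curv_mx G a l) y =
    pd_mx k (pd_mx a (C l)) y - pd_mx k (pd_mx l (C a)) y
    + (pd_mx k (C a) y *m C l y + C a y *m pd_mx k (C l) y
       - (pd_mx k (C l) y *m C a y + C l y *m pd_mx k (C a) y)).
  have s1 := smooth_mxM oU (sC a) (sC l); have s2 := smooth_mxM oU (sC l) (sC a).
  have d1 := smooth_mx_pd oU a (sC l); have d2 := smooth_mx_pd oU l (sC a).
  rewrite /curv_mx (pd_mxD k Uy (smooth_mxD oU d1 (smooth_mxN oU d2))
    (smooth_mxD oU s1 (smooth_mxN oU s2))).
  rewrite (pd_mxB oU k Uy d1 d2) (pd_mxB oU k Uy s1 s2).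
  by rewrite (pd_mxM oU k Uy (sC a) (sC l)) (pd_mxM oU k Uy (sC l) (sC a)).
have L : \sum_k eta y 0 k *: pd_mx k (curv_mx G s r) y =
   D1 s r - D1 r s + (P s *m C r y + C s y *m P r - (P r *m C s y + C r y *m P s)).
  rewrite /P !mulmx_suml !mulmx_sumr -!sumrB -!big_split -!sumrB -big_split /=.
  apply: eq_bigr => k _; rewrite curvD !scalerDr !scalerN -!scalemxAl -!scalemxAr.
  by rewrite scalerDr.
have R1 : \sum_k F y k s *: curv_mx G k r y =
   P1 s r - P2 r s + (Q s *m C r y - C r y *m Q s).
  rewrite /Q mulmx_suml mulmx_sumr -!sumrB -!big_split /=.
  apply: eq_bigr => k _; rewrite /curv_mx !scalerDr !scalerN.
  by rewrite -!scalemxAl -!scalemxAr.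
have R2 : \sum_k F y k r *: curv_mx G s k y =
   P2 s r - P1 r s + (C s y *m Q r - Q r *m C s y).
  rewrite /Q mulmx_suml mulmx_sumr -!sumrB -!big_split /=.
  apply: eq_bigr => k _; rewrite /curv_mx !scalerDr !scalerN.
  by rewrite -!scalemxAl -!scalemxAr.
rewrite L R1 R2; exact: lie_curvature_algebra main.
Qed.

End LieCurvature.
End AffineFields.

(** The bracket is the derivative of F^T S + S F, with the derivative of [F] replaced by its value
    at a zero of the field. Since [F] is skew for [S], the terms that still contain connection
    matrices cancel. *)
Lemma nabla_S_algebra {R : realType} {n : nat} (S F Ct dS Q : 'M[R]_n) :
  S *m F = - (F^T *m S) ->
  - ((F *m Ct - Ct *m F - Q)^T *m S + F^T *m dS +
     (dS *m F + S *m (F *m Ct - Ct *m F - Q)))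
  - S *m Q - Q^T *m S + F^T *m (dS - S *m Ct - Ct^T *m S)
  + (dS - S *m Ct - Ct^T *m S) *m F = 0.
Proof.
move=> I; have IT : S *m F *m Ct = - (F^T *m S *m Ct) by rewrite I mulNmx.
have IT' : Ct^T *m S *m F = - (Ct^T *m F^T *m S) by rewrite -mulmxA I mulmxN mulmxA.
have trB (A B : 'M[R]_n) : (A - B)^T = A^T - B^T by rewrite linearB.
rewrite !trB !trmx_mul !(mulmxBl, mulmxBr) !mulmxA IT IT'.
 apply/matrixP => i j; rewrite !(addmxE, oppmxE) [in RHS]mxE; ring.
Qed.

(** * Invariance of the Ricci tensor and of its covariant derivative *)

Section InvariantTensors.
Context {R : realType} {n : nat} (U : set 'rV[R]_n) (oU : open U).
Context (G : conn_comp R n) (sG : smooth_conn U G).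
Local Notation C := (conn_mx G).
Let sC r := smooth_conn_mx oU r sG.

(** Entry (i, s) is d_s eta^i + Gamma^i_{ks} eta^k, which is the covariant derivative of [eta] when
    the connection is symmetric. *)
Definition nabla_mx (eta : vect_comp R n) y : 'M[R]_n :=
  diff_mx eta y + \sum_k eta y 0 k *: C k y.

Definition nabla_S t y : 'M[R]_n :=
  pd_mx t (ricci_sym G) y - ricci_sym G y *m C t y - (C t y)^T *m ricci_sym G y.

Lemma ricciE y i j : ricci G y i j = \sum_k curv_mx G k j y k i.
Proof. by rewrite mxE; apply: eq_bigr => k _; rewrite curvatureE. Qed.

Lemma smooth_ricci : smooth_mx U (ricci G).
Proof.
move=> i j; have S := smooth_sum oU (index_enum 'I_n) (fun k => smooth_curv_mx oU k j sG k i).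
by apply: smooth_on_eq S => // z _; rewrite ricciE.
Qed.

Lemma smooth_ricci_sym : smooth_mx U (ricci_sym G).
Proof.
have S := smooth_mxZ oU (smooth_cst oU 2^-1)
  (smooth_mxD oU smooth_ricci (smooth_mx_tr oU smooth_ricci)).
by move=> i j; apply: smooth_on_eq (S i j).
Qed.

Lemma ricci_symT y : (ricci_sym G y)^T = ricci_sym G y.
Proof. by rewrite /ricci_sym linearZ /= linearD /= trmxK addrC. Qed.

Lemma pd_ricci t y i j : U y ->
  pd_mx t (ricci G) y i j = \sum_k pd_mx t (curv_mx G k j) y k i.
Proof.
move=> Uy; have sR k := smooth_curv_mx oU k j sG.
rewrite pd_mxE (pd_ext _ _ (fun z => ricciE z i j)).
rewrite (smooth_pd_sum oU _ _ Uy (fun k => sR k k i)).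
by apply: eq_bigr => k _; rewrite pd_mxE.
Qed.

Section Field.
Context (eta : vect_comp R n) (se : smooth_vect U eta).
Hypothesis aff : forall y, U y -> infinitesimal_affine eta G y.
Local Notation F := (diff_mx eta).
Let sF := smooth_diff_mx oU se.

(** Contraction of [lie_curvature] over the upper index and the first form index: the two terms in
    which [F] acts on contracted indices cancel. *)
Lemma lie_ricci y : U y ->
  \sum_l eta y 0 l *: pd_mx l (ricci G) y = - ((F y)^T *m ricci G y + ricci G y *m F y).
Proof.
move=> Uy; apply/matrixP => i j.
have E k := congr1 (fun A : 'M[R]_n => A k i) (lie_curvature oU sG se aff j k Uy).
rewrite /= in E.
transitivity (\sum_k (\sum_l eta y 0 l *: pd_mx l (curv_mx G k j) y) k i).
  rewrite summxE; under [RHS]eq_bigr do rewrite summxE.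
  rewrite exchange_big /=; apply: eq_bigr => l _; rewrite mxE pd_ricci // mulr_sumr.
  by apply: eq_bigr => k _; rewrite [RHS]mxE.
rewrite (eq_bigr _ (fun k _ => E k)).
under eq_bigr do rewrite !addmxE !oppmxE.
rewrite !sumrB oppmxE addmxE.
have -> : \sum_k (F y *m curv_mx G k j y) k i =
    \sum_k (\sum_l F y l k *: curv_mx G l j y) k i.
  under eq_bigr do rewrite mxE.
  under [RHS]eq_bigr do rewrite summxE.
  rewrite exchange_big; apply: eq_bigr => k _; apply: eq_bigr => l _.
  by rewrite [RHS]mxE.
have -> : \sum_k (curv_mx G k j y *m F y) k i = ((F y)^T *m ricci G y) i j.
  rewrite mxE; under eq_bigr do rewrite mxE.
  rewrite exchange_big; apply: eq_bigr => l _ /=.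
  by rewrite [(_^T) i l]mxE ricciE mulr_sumr; apply: eq_bigr => k _; rewrite mulrC.
have -> : \sum_k (\sum_l F y l j *: curv_mx G k l y) k i = (ricci G y *m F y) i j.
  rewrite mxE; under eq_bigr do rewrite summxE.
  rewrite exchange_big; apply: eq_bigr => l _ /=; rewrite ricciE mulr_suml.
  by apply: eq_bigr => k _; rewrite mxE mulrC.
move: (\sum_k _) (_ i j) (_ i j) => a b c; ring.
Qed.

Lemma lie_ricci_sym y : U y -> \sum_l eta y 0 l *: pd_mx l (ricci_sym G) y =
  - ((F y)^T *m ricci_sym G y + ricci_sym G y *m F y).
Proof.
move=> Uy; have E := lie_ricci Uy; have := congr1 trmx E.
rewrite linearN linearD /= !trmx_mul !trmxK linear_sum /=.
under eq_bigr do rewrite linearZ /=.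
move=> ET.
have dS l : pd_mx l (ricci_sym G) y = 2^-1 *: (pd_mx l (ricci G) y + (pd_mx l (ricci G) y)^T).
  have s1 := smooth_ricci; have s2 := smooth_mx_tr oU s1.
  rewrite /ricci_sym (pd_mxZ l Uy (smooth_cst oU _) (smooth_mxD oU s1 s2)) pd_cst scale0r add0r.
  by rewrite (pd_mxD l Uy s1 s2) pd_mx_tr.
under eq_bigr do rewrite dS scalerA mulrC -scalerA scalerDr.
rewrite -scaler_sumr big_split /= E ET /ricci_sym -scalemxAr -scalemxAl -scalerDr -scalerN.
congr (_ *: _); rewrite mulmxDr mulmxDl.
apply/matrixP => i j; rewrite !(addmxE, oppmxE); ring.
Qed.

(** Kostant's formula: the covariant derivative of nabla eta along e_r is R(e_r, eta). In the jet
    equations written covariantly, curvature is thus the only coefficient beyond the connection. *)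
Lemma pd_nabla_mx y r : U y -> pd_mx r (nabla_mx eta) y =
  nabla_mx eta y *m C r y - C r y *m nabla_mx eta y
  + \sum_k eta y 0 k *: curv_mx G r k y.
Proof.
move=> Uy; have seC k := smooth_mxZ oU (se k) (sC k).
rewrite /nabla_mx (pd_mxD r Uy sF (smooth_mx_sum oU _ seC)).
rewrite (pd_mx_sum oU _ r Uy seC) (affine_mx se Uy (aff Uy) r).
rewrite [in LHS](eq_bigr _ (fun k _ => pd_mxZ r Uy (se k) (sC k))).
rewrite big_split /=.
have -> : \sum_k pd r (fun z => eta z 0 k) y *: C k y = \sum_k F y k r *: C k y.
  by apply: eq_bigr => k _; congr (_ *: _); rewrite mxE.
have -> : \sum_k eta y 0 k *: curv_mx G r k y =
   \sum_k eta y 0 k *: pd_mx r (C k) y - \sum_k eta y 0 k *: pd_mx k (C r) y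
   + (C r y *m (\sum_k eta y 0 k *: C k y) - (\sum_k eta y 0 k *: C k y) *m C r y).
  rewrite mulmx_suml mulmx_sumr -!sumrB -!big_split /=.
  apply: eq_bigr => k _; rewrite /curv_mx !scalerDr !scalerN.
  by rewrite -!scalemxAl -!scalemxAr.
rewrite mulmxDl mulmxDr.
move: (\sum_k _) (\sum_k _) (\sum_k _) (\sum_k _) => a b c d.
apply/matrixP => i j; rewrite !(addmxE, oppmxE); ring.
Qed.

Section Isotropy.
Context (y : 'rV[R]_n) (Uy : U y) (eta0 : eta y = 0).

(** At a zero of [eta] the transport term of the Lie derivative drops out, and only the algebraic
    action of the linear part on the tensor remains. *)
Lemma isotropy_curvature r s :
  F y *m curv_mx G s r y - curv_mx G s r y *m F y =
  \sum_k F y k s *: curv_mx G k r y + \sum_k F y k r *: curv_mx G s k y.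
Proof.
have := lie_curvature oU sG se aff r s Uy; rewrite eta0.
rewrite big1 => [|k _]; last by rewrite mxE scale0r.
by move/esym/eqP; rewrite -addrA -opprD subr_eq0 => /eqP.
Qed.

Lemma isotropy_ricci_sym : (F y)^T *m ricci_sym G y + ricci_sym G y *m F y = 0.
Proof.
have := lie_ricci_sym Uy; rewrite eta0 big1 => [|k _]; last by rewrite mxE scale0r.
by move/esym/eqP; rewrite oppr_eq0 => /eqP.
Qed.

(** Obtained by differentiating the vanishing Lie derivative of S before evaluating at the zero;
    [affine_mx] eliminates the second derivatives of [eta]. *)
Lemma isotropy_nabla_S t :
  \sum_l F y l t *: nabla_S l y + (F y)^T *m nabla_S t y + nabla_S t y *m F y = 0.
Proof.
set S := ricci_sym G; have sS : smooth_mx U S := smooth_ricci_sym.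
have seS k := smooth_mxZ oU (se k) (smooth_mx_pd oU k sS).
have sFT := smooth_mx_tr oU sF.
have E := pd_mx_eq oU t Uy (fun z Uz => lie_ricci_sym Uz).
have s1 := smooth_mxM oU sFT sS; have s2 := smooth_mxM oU sS sF.
rewrite (pd_mx_sum oU _ t Uy seS) (pd_mxN oU t Uy (smooth_mxD oU s1 s2)) in E.
rewrite (pd_mxD t Uy s1 s2) (pd_mxM oU t Uy sFT sS) (pd_mxM oU t Uy sS sF) in E.
rewrite pd_mx_tr in E.
have EL : \sum_k pd_mx t (fun z => eta z 0 k *: pd_mx k S z) y = \sum_k F y k t *: pd_mx k S y.
  apply: eq_bigr => k _; rewrite (pd_mxZ t Uy (se k) (smooth_mx_pd oU k sS)).
  by rewrite eta0 [X in _ + X *: _]mxE scale0r addr0; congr (_ *: _); rewrite mxE.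
rewrite EL (affine_mx se Uy (aff Uy) t) eta0 in E.
rewrite [\sum_k (0 : 'rV_n) 0 k *: _]big1 ?subr0 in E; last by move=> k _; rewrite mxE scale0r.
have I : S y *m F y = - ((F y)^T *m S y).
  by apply/eqP; rewrite -addr_eq0 addrC isotropy_ricci_sym.
have EN : \sum_l F y l t *: nabla_S l y = \sum_l F y l t *: pd_mx l S y
    - S y *m (\sum_l F y l t *: C l y) - (\sum_l F y l t *: C l y)^T *m S y.
  rewrite mulmx_sumr [X in _ - _ - X *m _]linear_sum mulmx_suml -!sumrB.
  apply: eq_bigr => l _ /=.
  have Z (a : R) (D S1 C1 : 'M[R]_n) : a *: (D - S1 *m C1 - C1^T *m S1) =
      a *: D - S1 *m (a *: C1) - (a *: C1)^T *m S1.
    have -> : (a *: C1)^T = a *: C1^T by apply/matrixP => ? ?; rewrite !mxE.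
    by rewrite -scalemxAr -scalemxAl !scalerBr.
  exact: Z.
rewrite EN E /nabla_S -/S; exact: nabla_S_algebra.
Qed.

End Isotropy.
End Field.
End InvariantTensors.

(** * Local uniqueness for infinitesimal affine transformations *)

Section Domination.
Context {R : realType} {n : nat} (U : set 'rV[R]_n) (oU : open U).
Context (p : 'rV[R]_n) (rho : R).
Hypothesis rhoU : forall z, `|z - p| <= rho -> U z.
Local Notation B := [set z | `|z - p| < rho].

Lemma continuous_bounded (f : 'rV[R]_n -> R) :
  (forall z, U z -> {for z, continuous f}) ->
  exists2 C : R, 0 <= C & forall z, B z -> `|f z| <= C.
Proof.
move=> fc; pose D := [set z | `|z - p| <= rho].
have [r0|r0] := leP 0 rho; last first.
  by exists 0 => // z /= /lt_trans /(_ r0); rewrite normr_lt0.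
have cD : closed D.
  have := @closed_closed_ball_ _ 'rV[R]_n p rho; rewrite /closed_ball_.
  by rewrite (_ : [set y | _] = D) //; apply/funext => y; rewrite /D /= distrC.
have bD : bounded_set D.
  exists (`|p| + rho); split; first by rewrite num_real.
  move=> x xlt z /= Dz; rewrite -(subrK p z); apply: le_trans (ler_normD _ _) _.
  by rewrite addrC; apply: ltW; apply: le_lt_trans xlt; rewrite lerD2l.
have [|||c cD' cmax] := @EVT_max_rV R n (fun z => `|f z|) D.
- by exists p; rewrite /D /= subrr normr0.
- exact: bounded_closed_compact.
- apply: continuous_in_subspaceT => z; rewrite inE /D /= => /rhoU Uz.
  by apply: continuous_comp; [exact: fc|exact: norm_continuous].
exists `|f c| => // z Bz; apply: cmax; rewrite inE /D /=; exact: ltW.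
Qed.

Section Ode.
Context (T : finType) (u : T -> 'rV[R]_n -> R).
Local Notation N := (fun z => \sum_b `|u b z|).

(** Linear growth in the unknowns, uniformly on [B]. It is stable under sums and under continuous
    coefficients, so a system is recognised as linear homogeneous term by term, without explicit
    constants. *)
Definition dominated (f : 'rV[R]_n -> R) : Prop :=
  exists2 C : R, 0 <= C & forall z, B z -> `|f z| <= C * N z.

Let N_ge0 z : 0 <= N z. Proof. exact: sumr_ge0. Qed.

Lemma dominated_unknown b : dominated (u b).
Proof.
by exists 1 => // z _; rewrite mul1r (bigD1 b) //= lerDl sumr_ge0.
Qed.

Lemma dominated_eq f g : (forall z, B z -> g z = f z) -> dominated f -> dominated g.
Proof. by move=> fg [C C0 h]; exists C => // z Bz; rewrite fg //; exact: h. Qed.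

Lemma dominatedD f g : dominated f -> dominated g -> dominated (fun z => f z + g z).
Proof.
move=> [C C0 hf] [D D0 hg]; exists (C + D) => [|z Bz]; first exact: addr_ge0.
by apply: le_trans (ler_normD _ _) _; rewrite mulrDl lerD ?hf ?hg.
Qed.

Lemma dominatedN f : dominated f -> dominated (fun z => - f z).
Proof. by move=> [C C0 h]; exists C => // z Bz; rewrite normrN; exact: h. Qed.

Lemma dominatedB f g : dominated f -> dominated g -> dominated (fun z => f z - g z).
Proof. by move=> df dg; exact: dominatedD df (dominatedN dg). Qed.

Lemma dominated0 : dominated (fun=> 0).
Proof. by exists 0 => // z _; rewrite normr0 mul0r. Qed.

Lemma dominated_sum (I : Type) (s : seq I) (F : I -> 'rV[R]_n -> R) :
  (forall a, dominated (F a)) -> dominated (fun z => \sum_(a <- s) F a z).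
Proof.
move=> dF; elim: s => [|a s IHs].
  by apply: dominated_eq dominated0 => z _; rewrite big_nil.
by apply: dominated_eq (dominatedD (dF a) IHs) => z _; rewrite big_cons.
Qed.

Lemma dominatedM (f g : 'rV[R]_n -> R) : (forall z, U z -> {for z, continuous f}) -> dominated g ->
  dominated (fun z => f z * g z).
Proof.
move=> /continuous_bounded[D D0 hD] [C C0 hC]; exists (D * C) => [|z Bz].
  exact: mulr_ge0.
by rewrite normrM -mulrA ler_pM // ?hD ?hC.
Qed.

Lemma dominated_ode_zero :
  (forall a, smooth_on B (u a)) -> (forall i a, dominated (pd i (u a))) ->
  forall y1, B y1 -> (forall a, u a y1 = 0) -> forall y, B y -> forall a, u a y = 0.
Proof.
move=> su du.
have [C CP] : {C : 'I_n * T -> R & forall ia, 0 <= C ia /\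
    forall z, B z -> `|pd ia.1 (u ia.2) z| <= C ia * N z}.
  apply: (@choice _ _ (fun (ia : 'I_n * T) (c : R) => 0 <= c /\
    forall z, B z -> `|pd ia.1 (u ia.2) z| <= c * N z)) => -[i a].
  by have [C C0 h] := du i a; exists C.
have oB : open B by exact: open_normball.
apply: (@linear_ode_zero R n T u p rho (\sum_ia C ia)) => //.
  by apply: sumr_ge0 => ia _; have [] := CP ia.
move=> y By i a; have [C0 h] := CP (i, a); apply: le_trans (h y By) _.
rewrite ler_wpM2r // (bigD1 (i, a)) //= lerDl sumr_ge0 // => ia _.
by have [] := CP ia.
Qed.

End Ode.

Lemma affine_unique (G : conn_comp R n) (eta : vect_comp R n) :
  smooth_conn U G -> smooth_vect U eta ->
  (forall y, U y -> infinitesimal_affine eta G y) ->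
  forall y1, B y1 -> eta y1 = 0 -> diff_mx eta y1 = 0 ->
  forall y, B y -> eta y = 0.
Proof.
move=> sG se aff y1 By1 e0 d0.
have BU : B `<=` U by move=> z /ltW /rhoU.
pose u (a : 'I_n + 'I_n * 'I_n) z : R := match a with
  | inl i => eta z 0 i | inr ij => diff_mx eta z ij.1 ij.2 end.
have H : forall y, B y -> forall a, u a y = 0.
  apply: (dominated_ode_zero (u := u)) By1 _.
  - case=> [i|[i j]]; first exact: (smooth_on_sub BU (se i)).
    exact: (smooth_on_sub BU (smooth_diff_mx oU se i j)).
  - have dF i j : dominated u (fun z => diff_mx eta z i j) by exact: (dominated_unknown u (inr (i, j))).
    have de i : dominated u (fun z => eta z 0 i) by exact: (dominated_unknown u (inl i)).
    have cC r i j z : U z -> {for z, continuous (fun z => conn_mx G r z i j)}.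
      by move=> Uz; exact: (smooth_cont (smooth_conn_mx oU r sG i j) Uz).
    have cD k r i j z : U z -> {for z, continuous (fun z => pd_mx k (conn_mx G r) z i j)}.
      by move=> Uz; exact: (smooth_cont (smooth_mx_pd oU k (smooth_conn_mx oU r sG) i j) Uz).
    move=> r [i|[i j]] /=.
      by apply: dominated_eq (dF i r) => z _; rewrite mxE.
    apply: (@dominated_eq _ _ (fun z =>
      \sum_k conn_mx G r z k j * diff_mx eta z i k - \sum_k conn_mx G r z i k * diff_mx eta z k j
      - \sum_k pd_mx k (conn_mx G r) z i j * eta z 0 k - \sum_k conn_mx G k z i j * diff_mx eta z k r)).
      move=> z /BU Uz; rewrite -pd_mxE (affine_mx se Uz (aff z Uz)) !addmxE !oppmxE !summxE.
      rewrite ![(_ *m _) _ _]mxE; congr (_ - _ - _ - _).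
      + by apply: eq_bigr => k _; rewrite mulrC.
      + by apply: eq_bigr => k _; rewrite mxE mulrC.
      + by apply: eq_bigr => k _; rewrite mxE mulrC.
    have d1 := dominated_sum (index_enum 'I_n) (fun k => dominatedM (cC r k j) (dF i k)).
    have d2 := dominated_sum (index_enum 'I_n) (fun k => dominatedM (cC r i k) (dF k j)).
    have d3 := dominated_sum (index_enum 'I_n) (fun k => dominatedM (cD k r i j) (de k)).
    have d4 := dominated_sum (index_enum 'I_n) (fun k => dominatedM (cC k i j) (dF k r)).
    exact: dominatedB (dominatedB (dominatedB d1 d2) d3) d4.
  - by case=> [i|[i j]] /=; rewrite ?e0 ?d0 mxE.
by move=> y By; apply/rowP => i; rewrite mxE; exact: (H y By (inl i)).
Qed.

End Domination.

(** * Unique continuation over a connected manifold *)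

Section UniqueContinuation.
Context {R : realType} {n : nat} (M : smooth_manifold R n).
Context (G : chart R n M -> conn_comp R n).
Hypothesis sG : forall c, atlas M c -> smooth_conn (cimg c) (G c).
Implicit Types (c d : chart R n M) (q : M).

Definition affine_field (eta : chart R n M -> vect_comp R n) : Prop :=
  vector_field eta /\
  forall c, atlas M c -> forall y, cimg c y -> infinitesimal_affine (eta c) (G c) y.

Lemma cimg_nbhs c q (P : set M) : cdom c q -> nbhs q P ->
  nbhs (cmap c q) [set y | cimg c y /\ P (cinv c y)].
Proof.
move=> cq Pq; have iq : cimg c (cmap c q) by exists q.
apply: filterI; first exact: open_near (@cimg_open _ _ _ c) iq.
by apply: (cinv_continuous iq); rewrite cmapK.
Qed.

Lemma closed_ball_in (U : set 'rV[R]_n) y : open U -> U y ->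
  exists2 r : R, 0 < r & forall z, `|z - y| <= r -> U z.
Proof.
move=> oU Uy; have [r r0 rU] := open_ballP oU Uy.
exists (r / 2) => [|z zr]; first by rewrite divr_gt0.
by apply: rU; apply: le_lt_trans zr _; rewrite ltr_pdivrMr // ltr_pMr // ltr1n.
Qed.

Lemma pd_zero_near (f : 'rV[R]_n -> R) y i : (\forall z \near y, f z = 0) -> pd i f y = 0.
Proof. by move=> f0; rewrite (@pd_near _ _ f (fun=> 0)) // pd_cst. Qed.

(** The interior of the zero set is nonempty by local uniqueness at [q], and it is open and closed,
    hence everything. *)
Lemma affine_field_unique (eta : chart R n M -> vect_comp R n) c q :
  connected [set: M] -> affine_field eta -> atlas M c -> cdom c q ->
  eta c (cmap c q) = 0 -> diff_mx (eta c) (cmap c q) = 0 ->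
  vect_eq eta (fun _ _ => 0).
Proof.
move=> hM [[se te] aff] Mc cq e0 d0.
pose E : set M := [set q' | forall d, atlas M d -> cdom d q' -> eta d (cmap d q') = 0].
have E1 d q' : atlas M d -> cdom d q' -> eta d (cmap d q') = 0 -> E q'.
  move=> Md dq' z d' Md' d'q'; apply/rowP => i.
  rewrite (te d d' Md Md' q' dq' d'q' i) mxE big1 // => j _.
  by rewrite z mxE mulr0.
have loc d q' : atlas M d -> cdom d q' -> exists2 N : set M, nbhs q' N &
    (forall q1, N q1 -> cdom d q1) /\
    forall q1, N q1 -> eta d (cmap d q1) = 0 -> diff_mx (eta d) (cmap d q1) = 0 ->
    forall q2, N q2 -> E q2.
  move=> Md dq'; have oU := @cimg_open _ _ _ d.
  have iq' : cimg d (cmap d q') by exists q'.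
  have [r r0 rU] := closed_ball_in oU iq'.
  exists [set q1 | cdom d q1 /\ `|cmap d q1 - cmap d q'| < r].
    apply: filterI; first by apply: open_nbhs_nbhs; split => //; exact: cdom_open.
    have nb : \forall z \near cmap d q', `|z - cmap d q'| < r.
      by apply: near_normball; rewrite subrr normr0.
    exact: (cmap_continuous dq' nb).
  split=> [q1 []//|q1 [dq1 Nq1] z1 z2 q2 [dq2 Nq2]].
  apply: (E1 d q2 Md dq2).
  exact: (affine_unique oU rU (sG Md) (se d Md) (aff d Md) Nq1 z1 z2 Nq2).
(* The interior is used, not the zero set itself: near an interior zero the field vanishes
   identically, so its derivative vanishes as well and uniqueness can restart from there. *)
have Eall : E° = [set: M].
  apply: hM.
  - exists q; have [N Nq [Nc Nz]] := loc c q Mc cq.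
    have Nqq := nbhs_singleton Nq.
    by apply: (filterS _ Nq) => q2; exact: (Nz q Nqq e0 d0).
  - by exists E°; [exact: open_interior|rewrite setTI].
  - exists (closure E°); first exact: closed_closure.
    rewrite setTI; apply/seteqP; split; first exact: subset_closure.
    move=> q1 cl; have [d Md dq1] := atlas_cover q1.
    have [N Nq1 [Nd Nz]] := loc d q1 Md dq1.
    have [q2 [Eq2 Nq2]] := cl N Nq1.
    have dq2 := Nd _ Nq2.
    have near0 : \forall z \near cmap d q2, eta d z = 0.
      apply: filterS (cimg_nbhs dq2 Eq2) => z [iz Ez].
      have [dz zE] := cimgP iz; rewrite -zE; exact: Ez Md dz.
    have z1 : diff_mx (eta d) (cmap d q2) = 0.
      apply/matrixP => i j; rewrite !mxE; apply: pd_zero_near.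
      by apply: filterS near0 => z ->; rewrite mxE.
    apply: (filterS _ Nq1); exact: (Nz q2 Nq2 (nbhs_singleton near0) z1).
move=> d Md y /cimgP[dy yE]; rewrite -yE.
have : E° (cinv d y) by rewrite Eall.
by move/nbhs_singleton; exact.
Qed.

End UniqueContinuation.

(** * The space of 1-jets of symmetries *)

Section DiagonalForm.
Context {F : fieldType}.
Hypothesis two : 2 != 0 :> F.

(** Polarisation: if the diagonal vanishes and S_ij does not, replacing e_i by e_i + e_j produces
    the diagonal entry 2 S_ij. *)
Lemma symmetric_nonzero_diag n (S : 'M[F]_n) : S^T = S -> S != 0 ->
  exists2 P : 'M[F]_n, P \in unitmx & exists i, (P^T *m S *m P) i i != 0.
Proof.
move=> sS S0; have [[i Sii]|nd] := pselect (exists i, S i i != 0).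
  by exists 1%:M; [exact: unitmx1|exists i; rewrite trmx1 mul1mx mulmx1].
have d0 i : S i i = 0.
  by apply/eqP; apply: contra_notT nd => h; exists i.
have [i [j Sij]] : exists i j, S i j != 0.
  apply: contra_notP (elimN eqP S0) => h; apply/matrixP => i j; rewrite mxE.
  by apply/eqP; apply: contra_notT h => h; exists i, j.
have ij : i != j by apply: contra_neq Sij => ->; rewrite d0.
exists (1%:M + delta_mx j i).
  have : (1%:M + delta_mx j i) *m (1%:M - delta_mx j i) = 1%:M :> 'M[F]_n.
    rewrite mulmxDl mul1mx mulmxBr mulmx1 mul_delta_mx_cond (negbTE ij) mulr0n subr0.
    by rewrite subrK.
  by move/mulmx1_unit => [].
have dl (A : 'M[F]_n) b : (delta_mx i j *m A) i b = A j b.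
  rewrite mxE (bigD1 j) //= mxE !eqxx mul1r big1 ?addr0 // => k kj.
  by rewrite mxE (negbTE kj) andbF mul0r.
have dr (A : 'M[F]_n) a : (A *m delta_mx j i) a i = A a j.
  rewrite mxE (bigD1 j) //= mxE !eqxx mulr1 big1 ?addr0 // => k kj.
  by rewrite mxE (negbTE kj) mulr0.
have Sji : S j i = S i j by rewrite -[in LHS]sS mxE.
have PT : (1%:M + delta_mx j i)^T = 1%:M + delta_mx i j :> 'M[F]_n.
  by rewrite [LHS]raddfD /= trmx1 trmx_delta.
exists i; rewrite PT mulmxDl mul1mx mulmxDr mulmx1 mxE (dr _ i).
rewrite [(S + _) i i]mxE [(S + _) i j]mxE dl dl !d0 Sji addr0 add0r -mulr2n.
by rewrite -mulr_natl mulf_neq0.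
Qed.

(** Lagrange's reduction: a nonzero diagonal entry is moved to position 0 and clears its row and
    column. Pivots are taken from the front until the remainder is 0, so the nonzero entries of [s]
    form an initial segment. *)
Lemma symmetric_diag n (S : 'M[F]_n) : S^T = S ->
  exists (P : 'M[F]_n) (s : 'rV[F]_n) (m : nat), [/\ P \in unitmx,
    P^T *m S *m P = diag_mx s & forall i : 'I_n, (s 0 i != 0) = (i < m)%N].
Proof.
elim: n S => [|n IHn] S sS.
  by exists 1%:M, 0, 0%N; split => [||[]//]; [exact: unitmx1|apply/matrixP => -[]].
have [->|S0] := eqVneq S 0.
  exists 1%:M, 0, 0%N; split; first exact: unitmx1.
    by rewrite mulmx0 mul0mx; apply/matrixP => i j; rewrite !mxE mul0rn.
  by move=> i; rewrite mxE eqxx.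
have [P0 uP0 [i0 P0i]] := symmetric_nonzero_diag sS S0.
have [P1 uP1 P100] : exists2 P1 : 'M[F]_n.+1, P1 \in unitmx & (P1^T *m S *m P1) 0 0 != 0.
  exists (P0 *m perm_mx (tperm 0 i0)); first by rewrite unitmx_mul uP0 unitmx_perm.
  have -> : (P0 *m perm_mx (tperm 0 i0))^T *m S *m (P0 *m perm_mx (tperm 0 i0)) =
      row_perm (tperm 0 i0) (col_perm (tperm 0 i0) (P0^T *m S *m P0)).
    by rewrite row_permE col_permE tpermV trmx_mul tr_perm_mx tpermV !mulmxA.
  by rewrite mxE mxE tpermL.
pose S1 : 'M[F]_(1 + n) := P1^T *m S *m P1.
have sS1 : S1^T = S1 by rewrite /S1 !trmx_mul trmxK sS mulmxA.
have S100 : S1 0 0 != 0 by [].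
pose a := S1 0 0; pose b : 'rV[F]_n := ursubmx S1; pose D := drsubmx S1.
have S1E : S1 = block_mx a%:M b b^T D.
  rewrite -[S1]submxK; congr block_mx.
    apply/matrixP => i j; rewrite !ord1 [RHS]mxE mulr1n [LHS]mxE [LHS]mxE /a.
    by congr (S1 _ _); apply: val_inj.
  by rewrite /b trmx_ursub sS1.
pose P2 : 'M[F]_(1 + n) := block_mx 1%:M (- (a^-1 *: b)) 0 1%:M.
have uP2 : P2 \in unitmx by rewrite unitmxE det_ublock !det1 mulr1 unitr1.
pose D' := D - a^-1 *: (b^T *m b).
have S2 : P2^T *m S1 *m P2 = block_mx a%:M 0 0 D'.
  rewrite S1E /P2 tr_block_mx !mulmx_block !trmx1 trmx0.
  rewrite !mul1mx !mul0mx !mulmx1 !mulmx0 !addr0 mul_scalar_mx.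
  have -> : (- (a^-1 *: b))^T = - (a^-1 *: b^T).
    by apply/matrixP => ? ?; rewrite !mxE.
  rewrite mul_mx_scalar !scalerN !scalerA divff // !scale1r !addNr mul0mx add0r.
  by rewrite mulNmx -scalemxAl addrC.
have sD' : D'^T = D'.
  rewrite /D' linearB linearZ /= trmx_mul trmxK; congr (_ - _).
  by rewrite /D trmx_drsub sS1.
have [P3 [s [m [uP3 P3E sm]]]] := IHn D' sD'.
pose P4 : 'M[F]_(1 + n) := block_mx 1%:M 0 0 P3.
have uP4 : P4 \in unitmx by rewrite unitmxE det_ublock det1 mul1r.
have S3 : P4^T *m (P2^T *m S1 *m P2) *m P4 = diag_mx (row_mx a%:M s).
  rewrite S2 diag_mx_row /P4 tr_block_mx !mulmx_block trmx1 !trmx0.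
  rewrite !(mul1mx, mul0mx, mulmx1, mulmx0, addr0, add0r) P3E.
  congr (block_mx _ _ _ _).
  by apply/matrixP => i j; rewrite !ord1 !mxE.
exists (P1 *m (P2 *m P4 : 'M[F]_n.+1)), (row_mx a%:M s), m.+1; split.
- by rewrite unitmx_mul uP1 /=; move: (unitmx_mul P2 P4); rewrite uP2 uP4.
- by rewrite -S3 /S1 trmx_mul (trmx_mul P2 P4) !mulmxA.
- move=> i; rewrite mxE; case: (@splitP 1 n i) => j ->.
    by rewrite ord1 mxE mulr1n S100.
  by rewrite sm.
Qed.

End DiagonalForm.

Lemma symmetric_diag_rank {F : fieldType} (two : 2 != 0 :> F) n (S : 'M[F]_n) (m : nat) :
  S^T = S -> \rank S = m ->
  exists (P : 'M[F]_n) (s : 'rV[F]_n), [/\ P \in unitmx,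
    P^T *m S *m P = diag_mx s & forall i : 'I_n, (s 0 i != 0) = (i < m)%N].
Proof.
move=> sS rS; have [P [s [m' [uP PE sm]]]] := symmetric_diag two sS.
exists P, s; split => // i; rewrite sm -rS.
have <- : \rank (diag_mx s) = \rank S.
  rewrite -PE mxrankMfree ?row_free_unit // -mxrank_tr trmx_mul trmxK.
  by rewrite mxrankMfree ?row_free_unit // mxrank_tr.
(* Replacing the zero entries by 1 splits [diag_mx s] into an invertible factor and [pid_mx m'],
   whose rank is known. *)
pose t : 'rV[F]_n := \row_i (if (i < m')%N then s 0 i else 1).
have ut : diag_mx t \in unitmx.
  rewrite unitmxE det_diag unitfE; apply/prodf_neq0 => j _; rewrite mxE.
  by case: ifP => [jm|_]; [rewrite sm|exact: oner_neq0].
have -> : diag_mx s = diag_mx t *m pid_mx m'.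
  apply/matrixP => a b; rewrite mul_diag_mx !mxE.
  have [->|ab] := eqVneq a b; last first.
    by rewrite (_ : (a == b :> nat) = false) ?mulr0 //; exact/negbTE.
  rewrite eqxx /= mulr1n; case: ifP => [|h]; first by rewrite mulr1.
  by rewrite mulr0; apply/eqP; apply: contraFT h; rewrite sm.
rewrite -mxrank_tr trmx_mul mxrankMfree ?row_free_unit ?unitmx_tr // mxrank_tr.
(* The cut-off [m'] has not been bounded by [n]; above [n] the matrix [pid_mx m'] is the
   identity. *)
have [mn|nm] := leqP m' n; first by rewrite rank_pid_mx.
have -> : pid_mx m' = 1%:M :> 'M[F]_n.
  by apply/matrixP => a b; rewrite !mxE (ltn_trans (ltn_ord a) nm) andbT.
by rewrite mxrank1 ltn_ord (ltn_trans (ltn_ord i) nm).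
Qed.

Section PointSymmetries.
Context {R : realType} {n : nat} (M : smooth_manifold R n).
Context (G : chart R n M -> conn_comp R n) (A : chart R n M -> op_comp R n).
Hypothesis sG : forall c, atlas M c -> smooth_conn (cimg c) (G c).

Lemma lie_derivative_mx (eta : vect_comp R n) (A0 : op_comp R n) y :
  (forall i j, lie_derivative eta A0 y i j = 0) ->
  \sum_k eta y 0 k *: pd_mx k A0 y = diff_mx eta y *m A0 y - A0 y *m diff_mx eta y.
Proof.
move=> h; apply/matrixP => i j; have := h i j; rewrite /lie_derivative big_split sumrB /=.
rewrite summxE addmxE oppmxE ![(_ *m _) i j]mxE.
have -> : \sum_k (eta y 0 k *: pd_mx k A0 y) i j = \sum_k eta y 0 k * pd k (fun z => A0 z i j) y.
  by apply: eq_bigr => k _; rewrite mxE pd_mxE.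
have -> : \sum_k diff_mx eta y i k * A0 y k j = \sum_k A0 y k j * pd k (fun z => eta z 0 i) y.
  by apply: eq_bigr => k _; rewrite mxE mulrC.
have -> : \sum_k A0 y i k * diff_mx eta y k j = \sum_k A0 y i k * pd j (fun z => eta z 0 k) y.
  by apply: eq_bigr => k _; rewrite mxE.
have key (a b d : R) : a - b + d = 0 -> a = b - d by move=> E; rewrite -[b](addrK d) -[LHS]subr0 -E; ring.
exact: key.
Qed.

Lemma point_symmetry_affine eta : point_symmetry A G eta -> affine_field G eta.
Proof. by move=> [v h]; split => // c Mc y cy; have [] := h c Mc y cy. Qed.

Section LinearCombination.
Context (N : nat) (a : 'I_N -> R) (e : 'I_N -> chart R n M -> vect_comp R n).
Hypothesis se : forall k, point_symmetry A G (e k).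

Lemma lin_combE c y i : lin_comb a e c y 0 i = \sum_k a k * e k c y 0 i.
Proof. by rewrite summxE; apply: eq_bigr => k _; rewrite mxE. Qed.

Let sec c k i : atlas M c -> smooth_on (cimg c) (fun z => e k c z 0 i).
Proof. by move=> Mc; have [[h _] _] := se k; exact: h. Qed.

Lemma pd_lin_comb c y r i : atlas M c -> cimg c y ->
  pd r (fun z => lin_comb a e c z 0 i) y = \sum_k a k * pd r (fun z => e k c z 0 i) y.
Proof.
move=> Mc cy; have oU := @cimg_open _ _ _ c.
rewrite (pd_ext _ _ (fun z => lin_combE c z i)).
rewrite (smooth_pd_sum oU _ _ cy (fun k => smoothM oU (smooth_cst oU (a k)) (sec k i Mc))).
apply: eq_bigr => k _; rewrite (smooth_pdM _ cy (smooth_cst oU (a k)) (sec k i Mc)).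
by rewrite pd_cst mul0r add0r.
Qed.

Lemma pd2_lin_comb c y r s i : atlas M c -> cimg c y ->
  pd r (pd s (fun z => lin_comb a e c z 0 i)) y =
  \sum_k a k * pd r (pd s (fun z => e k c z 0 i)) y.
Proof.
move=> Mc cy; have oU := @cimg_open _ _ _ c.
rewrite (pd_eq_on oU r cy (fun z cz => pd_lin_comb s i Mc cz)).
have sd k := smooth_on_pd s (sec k i Mc).
rewrite (smooth_pd_sum oU _ _ cy (fun k => smoothM oU (smooth_cst oU (a k)) (sd k))).
apply: eq_bigr => k _; rewrite (smooth_pdM _ cy (smooth_cst oU (a k)) (sd k)).
by rewrite pd_cst mul0r add0r.
Qed.

Lemma point_symmetry_lin_comb : point_symmetry A G (lin_comb a e).
Proof.
split; [split|].
- move=> c Mc i; have oU := @cimg_open _ _ _ c.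
  have S := smooth_sum oU (index_enum 'I_N) (fun k => smoothM oU (smooth_cst oU (a k)) (sec k i Mc)).
  by apply: smooth_on_eq S => // z _; rewrite lin_combE.
- move=> c d Mc Md p cp dp i /=; rewrite lin_combE.
  under [RHS]eq_bigr do rewrite lin_combE mulr_sumr.
  rewrite exchange_big; apply: eq_bigr => k _ /=.
  have [[_ te] _] := se k; rewrite (te c d Mc Md p cp dp i) /= mulr_sumr.
  by apply: eq_bigr => j _; rewrite mulrCA.
- move=> c Mc y cy; split => [i j|i r s].
    rewrite /lie_derivative.
    transitivity (\sum_k a k * lie_derivative (e k c) (A c) y i j).
      rewrite /lie_derivative; under [RHS]eq_bigr do rewrite mulr_sumr.
      rewrite exchange_big; apply: eq_bigr => l _ /=.
      rewrite lin_combE !pd_lin_comb // mulr_suml !mulr_sumr -sumrB -big_split /=.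
      by apply: eq_bigr => k _; ring.
    by rewrite big1 // => k _; have [_ /(_ c Mc y cy)[-> _]] := se k; rewrite mulr0.
  transitivity (\sum_k a k * \sum_l pd l (fun z => e k c z 0 i) y * G c y l r s).
    under [RHS]eq_bigr do rewrite mulr_sumr.
    rewrite exchange_big; apply: eq_bigr => l _ /=.
    by rewrite pd_lin_comb // mulr_suml; apply: eq_bigr => k _; rewrite mulrA.
  transitivity (\sum_k a k * (pd r (pd s (fun z => e k c z 0 i)) y +
      \sum_l (pd l (fun z => G c z i r s) y * e k c y 0 l
       + G c y i l s * pd r (fun z => e k c z 0 l) y
       + G c y i r l * pd s (fun z => e k c z 0 l) y))).
    by apply: eq_bigr => k _; have [_ /(_ c Mc y cy)[_ ->]] := se k.
  rewrite pd2_lin_comb //; under eq_bigr do rewrite mulrDr mulr_sumr.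
  rewrite big_split /= exchange_big; congr (_ + _); apply: eq_bigr => l _ /=.
  rewrite lin_combE !pd_lin_comb // !mulr_sumr -!big_split /=.
  by apply: eq_bigr => k _; ring.
Qed.

Lemma diff_mx_lin_comb c y : atlas M c -> cimg c y ->
  diff_mx (lin_comb a e c) y = \sum_k a k *: diff_mx (e k c) y.
Proof.
move=> Mc cy; apply/matrixP => i j; rewrite mxE pd_lin_comb // summxE.
by apply: eq_bigr => k _; rewrite !mxE.
Qed.

End LinearCombination.
End PointSymmetries.

(** * Counting and realising the jets of symmetries *)

Section JetCount.
Local Open Scope nat_scope.

(** Positions of the independent entries of X subject to X^T S + S X = 0, for S diagonal with
    exactly its first [m] entries nonzero: the rows from [m] on are free, the upper left block is
    determined by its strict upper triangle, and the upper right block is zero. *)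
Definition jet_entry (n m : nat) (ij : 'I_n * 'I_n) : bool :=
  (m <= ij.1) || (ij.1 < ij.2 < m).

(** The summand ['I_n] stands for the components of the value at the point. A row [i < m]
    contributes m - i - 1 entries, in total the binomial coefficient (m choose 2). *)
Lemma card_jet_entry (n m : nat) : m <= n ->
  #|{: 'I_n + {ij : 'I_n * 'I_n | jet_entry m ij}}| = n * (n + 1 - m) + (m * (m - 1)) %/ 2.
Proof.
move=> mn; rewrite card_sum card_ord card_sig.
have -> : #|[pred ij : 'I_n * 'I_n | jet_entry m ij]| =
    \sum_(i < n) \sum_(j < n) jet_entry m (i, j).
  rewrite pair_big -sum1_card big_mkcond; apply: eq_bigr => -[i j] _.
  by rewrite inE; case: (jet_entry m (i, j)).
have inner (i : 'I_n) : \sum_(j < n) jet_entry m (i, j) = if m <= i then n else m - i.+1.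
  rewrite /jet_entry /=; case: ifP => mi.
    by rewrite sum1_card card_ord.
  rewrite -(big_mkord xpredT (fun j => nat_of_bool (i < j < m))) /=.
  rewrite (big_cat_nat (n := i.+1)) ?ltn_ord //=.
  rewrite big_nat_cond big1 ?add0n; last first.
    by move=> j /andP[/andP[_ ji] _]; rewrite ltnNge -ltnS ji.
  have im : i < m by rewrite ltnNge mi.
  rewrite (big_cat_nat (n := m)) //=.
  rewrite [X in _ + X]big_nat_cond [X in _ + X]big1 ?addn0; last first.
    by move=> j /andP[/andP[mj _] _]; rewrite (ltnNge j m) mj andbF.
  rewrite big_nat_cond (eq_bigr (fun=> 1)); last first.
    by move=> j /andP[/andP[ij jm] _]; rewrite ij jm.
  by rewrite -big_nat_cond sum_nat_const_nat muln1.
rewrite (eq_bigr _ (fun i _ => inner i)).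
rewrite -(big_mkord xpredT (fun i => if m <= i then n else m - i.+1)) /=.
rewrite (big_cat_nat (n := m)) //=.
have -> : \sum_(0 <= i < m) (if m <= i then n else m - i.+1) = 'C(m, 2).
  rewrite -bin2_sum big_nat_rev /= !big_nat; apply: eq_bigr => i /andP[_ im].
  rewrite add0n; case: ifP => h; first by move: h im; lia.
  by move: im; clear; lia.
have -> : \sum_(m <= i < n) (if m <= i then n else m - i.+1) = (n - m) * n.
  by rewrite big_nat (eq_bigr (fun=> n)) => [|i /andP[->]] //; rewrite -big_nat sum_nat_const_nat.
rewrite bin2 -divn2 subn1; set x := _ %/ 2.
have -> : n + 1 - m = (n - m) + 1 by rewrite addnC -addnBA // addnC.
by rewrite mulnDr muln1 [n * (n - m)]mulnC [LHS]addnC -addnA [RHS]addnC.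
Qed.

End JetCount.

Section Jets.
Context {R : realType} {n m : nat} (M : smooth_manifold R n).
Context (G : chart R n M -> conn_comp R n) (A : chart R n M -> op_comp R n).
Hypothesis hM : connected [set: M].
Hypothesis sG : forall c, atlas M c -> smooth_conn (cimg c) (G c).
Hypothesis mn : (m <= n)%N.
Hypothesis hrank : forall c, atlas M c -> forall y, cimg c y -> \rank (ricci_sym (G c) y) = m.
Hypothesis hdim : vect_dim [set eta | point_symmetry A G eta]
            (n * (n + 1 - m) + (m * (m - 1)) %/ 2)%N.
Context (c : chart R n M) (Mc : atlas M c) (y : 'rV[R]_n) (cy : cimg c y).
Local Notation S := (ricci_sym (G c)).
Context (P : 'M[R]_n) (s : 'rV[R]_n) (uP : P \in unitmx).
Hypothesis PS : P^T *m S y *m P = diag_mx s.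
Hypothesis sm : forall i : 'I_n, (s 0 i != 0) = (i < m)%N.

Lemma isotropy_coords (X : 'M[R]_n) : X^T *m S y + S y *m X = 0 ->
  forall i j, s 0 i * (invmx P *m X *m P) i j + s 0 j * (invmx P *m X *m P) j i = 0.
Proof.
move=> h i j; set X' := invmx P *m X *m P.
have XE : X *m P = P *m X' by rewrite /X' !mulmxA mulmxV // mul1mx.
have : P^T *m (X^T *m S y + S y *m X) *m P = 0 by rewrite h mulmx0 mul0mx.
rewrite mulmxDr mulmxDl.
have -> : P^T *m (X^T *m S y) *m P = X'^T *m diag_mx s.
  by rewrite mulmxA -trmx_mul XE trmx_mul -PS !mulmxA.
have -> : P^T *m (S y *m X) *m P = diag_mx s *m X'.
  by rewrite -PS -!mulmxA XE.
clearbody X'; move/matrixP/(_ i j); rewrite mul_diag_mx mul_mx_diag !mxE => E.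
by rewrite addrC [X in X + _]mulrC.
Qed.

Lemma isotropy_coords_zero (X : 'M[R]_n) : X^T *m S y + S y *m X = 0 ->
  (forall i j, jet_entry m (i, j) -> (invmx P *m X *m P) i j = 0) -> X = 0.
Proof.
move=> /isotropy_coords h hz; set X' := invmx P *m X *m P in h hz *.
suff X0 : X' = 0.
  have -> : X = P *m X' *m invmx P by rewrite /X' !mulmxA mulmxV // mul1mx mulmxK.
  by rewrite X0 mulmx0 mul0mx.
apply/matrixP => i j; rewrite [RHS]mxE.
have [e|e] := boolP (jet_entry m (i, j)); first exact: hz.
move: e; rewrite /jet_entry /= negb_or -ltnNge => /andP[im e].
have si : s 0 i != 0 by rewrite sm.
have hij := h i j.
have z : s 0 j * X' j i = 0.
  have [jm|mj] := ltnP j m; last first.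
    have : ~~ (s 0 j != 0) by rewrite sm -leqNgt.
    by rewrite negbK => /eqP->; rewrite mul0r.
  move: e; rewrite jm andbT -leqNgt leq_eqVlt => /predU1P[/val_inj ji|ji].
    have := h i i; rewrite ji -mulr2n -mulr_natl => /eqP.
    by rewrite mulf_eq0 pnatr_eq0 /= => /eqP.
  by rewrite hz ?mulr0 // /jet_entry /= ji im orbT.
by move: hij; rewrite z addr0 => /eqP; rewrite mulf_eq0 (negbTE si) => /eqP.
Qed.

(** Evaluation of free jet coordinates is injective: a symmetry vanishing at [y] has a linear part
    skew for S, determined by its free entries, and a zero 1-jet forces the symmetry to vanish on M.
    The matrix [J] of this map is square by [card_jet_entry], so the map is onto. *)
Lemma jets_surjective (v : 'rV[R]_n) (F0 : 'M[R]_n) :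
  exists2 eta, point_symmetry A G eta &
    eta c y = v /\ forall i j, jet_entry m (i, j) ->
      (invmx P *m diff_mx (eta c) y *m P) i j = F0 i j.
Proof.
case: hdim => e [se ind _].
set N := (n * (n + 1 - m) + (m * (m - 1)) %/ 2)%N in e se ind.
pose T : finType := ('I_n + {ij : 'I_n * 'I_n | jet_entry m ij})%type.
have cT : #|T| = N by exact: card_jet_entry.
pose jet (eta : chart R n M -> vect_comp R n) (t : T) : R :=
  match t with
  | inl i => eta c y 0 i
  | inr ij => (invmx P *m diff_mx (eta c) y *m P) (sval ij).1 (sval ij).2
  end.
have jetE (a : 'I_N -> R) t : jet (lin_comb a e) t = \sum_k a k * jet (e k) t.
  case: t => [i|[[i j] ij]] /=; first by rewrite lin_combE.
  rewrite (diff_mx_lin_comb a se Mc cy) mulmx_sumr mulmx_suml summxE.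
  by apply: eq_bigr => k _; rewrite -scalemxAr -scalemxAl mxE.
pose J : 'M[R]_(N, #|T|) := \matrix_(k, t) jet (e k) (enum_val t).
have fJ : row_free J.
  apply/row_freeP; apply/row_freeP; rewrite -kermx_eq0; apply/eqP/row_matrixP => l.
  rewrite row0; set a := row l (kermx J).
  have aJ : a *m J = 0 by rewrite /a -row_mul mulmx_ker row0.
  have j0 t : jet (lin_comb (fun k => a 0 k) e) t = 0.
    move/rowP/(_ (enum_rank t)): aJ; rewrite !mxE => <-; rewrite jetE.
    by apply: eq_bigr => k _; rewrite [X in _ = _ * X]mxE enum_rankK.
  have psy := point_symmetry_lin_comb (fun k => a 0 k) se.
  set eta := lin_comb _ e in j0 psy.
  have e0 : eta c y = 0 by apply/rowP => i; rewrite mxE; exact: (j0 (inl i)).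
  have [afv aff] := point_symmetry_affine psy.
  have oU := @cimg_open _ _ _ c.
  have iso := isotropy_ricci_sym oU (sG Mc) (afv.1 c Mc) (aff c Mc) cy e0.
  have d0 : diff_mx (eta c) y = 0.
    apply: (isotropy_coords_zero iso) => i j ij.
    exact: (j0 (inr (exist _ (i, j) ij))).
  have [cq qE] := cimgP cy; rewrite -qE in e0 d0.
  have z := affine_field_unique sG hM (conj afv aff) Mc cq e0 d0.
  by apply/rowP => k; rewrite [RHS]mxE; exact: (ind (fun k => a 0 k) z k).
have uJ : row_full J.
  by rewrite /row_full (eqP fJ) -[X in X == _]cT eqxx.
pose b : 'rV[R]_(#|T|) := \row_t match enum_val t with
  | inl i => v 0 i | inr ij => F0 (sval ij).1 (sval ij).2 end.
have /submxP[a aE] : (b <= J)%MS by exact: submx_full.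
exists (lin_comb (fun k => a 0 k) e); first exact: point_symmetry_lin_comb.
have jb t : jet (lin_comb (fun k => a 0 k) e) t = b 0 (enum_rank t).
  by rewrite jetE aE mxE; apply: eq_bigr => k _; rewrite [X in _ = _ * X]mxE enum_rankK.
split; first by apply/rowP => i; rewrite -[LHS]/(jet _ (inl i)) jb mxE enum_rankK.
move=> i j ij; rewrite -[LHS]/(jet _ (inr (exist _ (i, j) ij))) jb mxE.
by rewrite enum_rankK.
Qed.

End Jets.

(** * Consequences of isotropy at a point *)

Lemma scalemxE (R : pzRingType) (p q : nat) (a : R) (A : 'M[R]_(p, q)) i j :
  (a *: A) i j = a * A i j.
Proof. by rewrite mxE. Qed.

Section IsotropyAlgebra.
Context {R : realType} {n : nat} (hn : (2 <= n)%N).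
Implicit Types (v : 'cV[R]_n) (F : 'M[R]_n).

Lemma outer_isotropy (S : 'M[R]_n) v (xi : 'rV[R]_n) : S^T = S -> S *m v = 0 ->
  (v *m xi)^T *m S + S *m (v *m xi) = 0.
Proof.
move=> sS Sv; rewrite trmx_mul mulmxA Sv mul0mx addr0 -mulmxA -[S]sS -trmx_mul Sv.
by rewrite trmx0 mulmx0.
Qed.

Lemma cV_nonzero v : v != 0 -> exists i, v i 0 != 0.
Proof.
move=> v0; apply: contra_notP (elimN eqP v0) => h; apply/colP => i; rewrite mxE.
by apply/eqP; apply: contra_notT h => vi; exists i.
Qed.

Lemma outerE v t i j : (v *m (delta_mx 0 t : 'rV[R]_n)) i j = v i 0 * (j == t)%:R.
Proof. by rewrite mxE big_ord1 mxE eqxx. Qed.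

Lemma other_index (i : 'I_n) : exists j, j != i.
Proof.
case: n hn i => [//|[//|n']] _ i.
have [->|i0] := eqVneq i 0; first by exists 1.
by exists 0; rewrite eq_sym.
Qed.

Lemma sum_delta (f : 'I_n -> R) t : \sum_k f k * (k == t)%:R = f t.
Proof.
rewrite (bigD1 t) //= eqxx mulr1 big1 ?addr0 // => k kt.
by rewrite (negbTE kt) mulr0.
Qed.

(** Where v_i is nonzero, row i of the hypothesis says xi B = ((B v)_i / v_i) xi, with a factor that
    does not depend on xi. *)
Lemma scalar_of_commute (B : 'M[R]_n) v : v != 0 ->
  (forall xi : 'rV[R]_n, B *m (v *m xi) = (v *m xi) *m B) -> exists a, B = a%:M.
Proof.
move=> /cV_nonzero[i vi] h; exists ((B *m v) i 0 / v i 0); apply/matrixP => t j.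
have := h (delta_mx 0 t); rewrite mulmxA -[v *m _ *m B]mulmxA -rowE => /matrixP/(_ i j).
rewrite mxE big_ord1 [in X in _ = X -> _]mxE big_ord1.
rewrite [delta_mx 0 t 0 j]mxE eqxx /= [row t B 0 j]mxE => E.
rewrite mxE eq_sym; apply: (mulfI vi); rewrite -E.
by case: (j == t); rewrite ?mulr1n ?mulr0n ?mulr1 ?mulr0 // mulrCA divff ?mulr1.
Qed.

Section Curvature.
Variable Rm : 'I_n -> 'I_n -> 'M[R]_n.
Hypothesis anti : forall s r, Rm s r = - Rm r s.
Hypothesis bianchi : forall r k s i, Rm r k i s + Rm k s i r + Rm s r i k = 0.
Context (v : 'cV[R]_n) (v0 : v != 0).
Hypothesis inv : forall (xi : 'rV[R]_n) r s, let F := v *m xi in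
  F *m Rm s r - Rm s r *m F = \sum_k F k s *: Rm k r + \sum_k F k r *: Rm s k.

Let Rv r := \sum_k v k 0 *: Rm k r.
Let Ric j r := \sum_k Rm k r k j.
Let g s r := (n%:R + 1)^-1 * \tr (Rm s r).
Let S j r := 2^-1 * (Ric j r + Ric r j).

Lemma outer_invariance s r t i j :
  v i 0 * Rm s r t j - (Rm s r *m v) i 0 * (j == t)%:R =
  (s == t)%:R * Rv r i j - (r == t)%:R * Rv s i j.
Proof.
have /matrixP/(_ i j) := inv (delta_mx 0 t) r s; rewrite /= addmxE oppmxE.
rewrite -mulmxA -rowE mulmxA [(v *m row t _) i j]mxE big_ord1 [row t _ 0 j]mxE.
rewrite [(Rm s r *m v *m _) i j]mxE big_ord1 [delta_mx 0 t 0 j]mxE eqxx /= => ->.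
rewrite mxE; congr (_ + _).
  rewrite /Rv !summxE mulr_sumr; apply: eq_bigr => k _.
  by rewrite mxE outerE [in RHS]mxE mulrCA mulrA.
rewrite /Rv !summxE mulr_sumr -sumrN; apply: eq_bigr => k _.
by rewrite mxE outerE anti !mxE; ring.
Qed.

(** Sum [outer_invariance] over j = t. By the Bianchi identity the right side is R(s, r) v itself;
    joined to the n copies on the left it produces the factor n + 1 in [g]. *)
Lemma curvature_at_kernel s r i : (Rm s r *m v) i 0 = g s r * v i 0.
Proof.
have E : \sum_t (v i 0 * Rm s r t t - (Rm s r *m v) i 0 * (t == t)%:R) =
         \sum_t ((s == t)%:R * Rv r i t - (r == t)%:R * Rv s i t).
  by apply: eq_bigr => t _; exact: outer_invariance.
rewrite !sumrB -mulr_sumr in E.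
have E1 : \sum_(t < n) (Rm s r *m v) i 0 * (t == t)%:R = n%:R * (Rm s r *m v) i 0.
  under eq_bigr do rewrite eqxx mulr1.
  by rewrite sumr_const card_ord mulr_natl.
have D (f : 'I_n -> R) u : \sum_t (u == t)%:R * f t = f u.
  by rewrite -[RHS](sum_delta f); apply: eq_bigr => t _; rewrite eq_sym mulrC.
rewrite E1 !D in E.
have B : Rv r i s - Rv s i r = (Rm s r *m v) i 0.
  rewrite /Rv !summxE -sumrB mxE; apply: eq_bigr => k _.
  have := bianchi r k s i; rewrite (anti r k) oppmxE !scalemxE => h.
  by rewrite -mulrBr mulrC; congr (_ * _); clear E; lra.
rewrite B in E.
have n1 : n%:R + 1 != 0 :> R by rewrite gt_eqF // ltr_wpDl.
rewrite /g mulrAC -mulrA; apply: (canRL (mulKf n1)).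
by move/eqP: E; rewrite subr_eq => /eqP ->; rewrite mulrDl mul1r addrC.
Qed.

(** The other contraction of [outer_invariance], over s = t, which brings in the Ricci tensor. *)
Lemma curvature_kernel_slot r i j : (n%:R - 1) * Rv r i j = v i 0 * (Ric j r - g j r).
Proof.
have E : \sum_t (v i 0 * Rm t r t j - (Rm t r *m v) i 0 * (j == t)%:R) =
         \sum_t ((t == t)%:R * Rv r i j - (r == t)%:R * Rv t i j).
  by apply: eq_bigr => t _; exact: outer_invariance.
rewrite !sumrB -mulr_sumr in E.
have E1 : \sum_(t < n) (t == t)%:R * Rv r i j = n%:R * Rv r i j.
  under eq_bigr do rewrite eqxx mul1r.
  by rewrite sumr_const card_ord mulr_natl.
have D (f : 'I_n -> R) u : \sum_t (u == t)%:R * f t = f u.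
  by rewrite -[RHS](sum_delta f); apply: eq_bigr => t _; rewrite eq_sym mulrC.
have D2 : \sum_(t < n) (Rm t r *m v) i 0 * (j == t)%:R = (Rm j r *m v) i 0.
  by rewrite -[RHS](D (fun t => (Rm t r *m v) i 0)); apply: eq_bigr => t _; rewrite mulrC.
rewrite E1 (D (fun t => Rv t i j)) D2 curvature_at_kernel in E.
by rewrite mulrBl mul1r -E /Ric; ring.
Qed.

(** Contracting the Bianchi identity shows that Ric j r - Ric r j is the trace of R(j, r), that is
    (n + 1) g j r. *)
Lemma ricci_skew j r : Ric j r = S j r + (n%:R + 1) / 2 * g j r.
Proof.
have n1 : n%:R + 1 != 0 :> R by rewrite gt_eqF // ltr_wpDl.
have E : Ric j r - Ric r j = (n%:R + 1) * g j r.
  rewrite /g mulVKf // /mxtrace /Ric -sumrB; apply: eq_bigr => k _.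
  have := bianchi k r j k; rewrite (anti j k) (anti r j) !oppmxE => h.
  lra.
have -> : (n%:R + 1) / 2 * g j r = (n%:R + 1) * g j r / 2 by rewrite mulrAC.
by rewrite /S -E; field.
Qed.

(* The curvature of a projectively flat connection, [g] being the trace part. *)
Lemma curvature_structure s r t j : Rm s r t j = g s r * (j == t)%:R
  + (s == t)%:R * ((n%:R - 1)^-1 * S j r + 2^-1 * g j r)
  - (r == t)%:R * ((n%:R - 1)^-1 * S j s + 2^-1 * g j s).
Proof.
have [i vi] := cV_nonzero v0.
have n1 : n%:R - 1 != 0 :> R by rewrite subr_eq0 pnatr_eq1; case: n hn => [|[]].
have RvE u : Rv u i j = v i 0 * ((n%:R - 1)^-1 * S j u + 2^-1 * g j u).
  apply: (mulfI n1); rewrite curvature_kernel_slot ricci_skew.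
  rewrite [RHS]mulrCA; congr (_ * _); rewrite mulrDr mulVKf //.
  by move: (g j u) (S j u) => a b; field.
apply: (mulfI vi); have := outer_invariance s r t i j.
rewrite curvature_at_kernel !RvE => E.
move: E; move: (g s r) (_ * S j r + _) (_ * S j s + _) (Rm s r t j) => a b d e.
move: (_%:R) (_%:R) (_%:R) (v i 0) => p q u w E.
have -> : w * e = (w * e - a * w * u) + a * w * u by ring.
rewrite E; ring.
Qed.

(** The left side of the invariance is a commutator and has trace zero. Taking for xi a coordinate
    covector of index other than [r], which exists as n >= 2, kills the second sum. *)
Lemma trace_kernel r : \sum_k v k 0 * g k r = 0.
Proof.
have [s sr] := other_index r.
have := congr1 mxtrace (inv (delta_mx 0 s) r s); rewrite /=.
rewrite linearB /= mxtrace_mulC subrr mxtraceD !(linear_sum, raddf_sum) /=.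
rewrite [X in _ = _ + X]big1 => [|k _]; last first.
  by rewrite linearZ /= outerE eq_sym (negbTE sr) mulr0 mul0r.
rewrite addr0 => E.
transitivity ((n%:R + 1)^-1 * \sum_k \tr ((v *m (delta_mx 0 s : 'rV[R]_n)) k s *: Rm k r)).
  rewrite mulr_sumr; apply: eq_bigr => k _.
  by rewrite linearZ /= outerE eqxx mulr1 /g mulrCA.
by rewrite -E mulr0.
Qed.

End Curvature.

Section Derivative.
Variable T : 'I_n -> 'M[R]_n.
Hypothesis symT : forall t, (T t)^T = T t.
Context (v : 'cV[R]_n).
Hypothesis inv : forall (xi : 'rV[R]_n) t, let F := v *m xi in
  \sum_l F l t *: T l + F^T *m T t + T t *m F = 0.

Let outer_inv t u a b : (t == u)%:R * (\sum_l v l 0 *: T l) a b +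
  (a == u)%:R * (T t *m v) b 0 + (b == u)%:R * (T t *m v) a 0 = 0.
Proof.
have H i j : (T t *m (v *m (delta_mx 0 u : 'rV[R]_n))) i j = (j == u)%:R * (T t *m v) i 0.
  by rewrite mulmxA outerE mulrC.
have /matrixP/(_ a b) := inv (delta_mx 0 u) t; rewrite /= !addmxE [RHS]mxE => <-.
congr (_ + _ + _).
- rewrite !summxE mulr_sumr; apply: eq_bigr => l _.
  by rewrite !scalemxE outerE mulrCA mulrA.
- by rewrite -[in RHS](symT t) -trmx_mul [RHS]mxE H.
- by rewrite H.
Qed.

(** The indices in [outer_inv] are chosen so that only T v survives: a second index is used when t =
    b, equal indices when t differs from b. *)
Lemma derivative_kernel t : T t *m v = 0.
Proof.
apply/colP => b; rewrite [RHS]mxE.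
have [tb|tb] := eqVneq t b.
  have [a ab] := other_index b; have := outer_inv t a a b.
  by rewrite tb ![b == a]eq_sym (negbTE ab) eqxx !mul0r mul1r add0r addr0.
have := outer_inv t b b b; rewrite (negbTE tb) eqxx mul0r mul1r add0r.
by move=> /eqP; rewrite -mulr2n mulrn_eq0 /= => /eqP.
Qed.

Lemma derivative_along_kernel : \sum_l v l 0 *: T l = 0.
Proof.
apply/matrixP => a b; rewrite [RHS]mxE.
have := outer_inv a a a b; rewrite eqxx derivative_kernel [_ b 0]mxE [_ a 0]mxE.
by rewrite mul1r !mulr0 !addr0.
Qed.

End Derivative.

End IsotropyAlgebra.

(** * Tensors invariant under the rotations of a degenerate quadratic form *)

Section RecurrentDerivative.
Context {R : realType} {n : nat} (hn : (2 <= n)%N).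

Section Trilinear.
Context (I : eqType) (s : I -> R) (T : I -> I -> I -> R).
Hypothesis symT : forall c u w, T c u w = T c w u.
(* Invariance of [T] under the infinitesimal rotation [e_b -> s_b e_a],
   [e_a -> - s_a e_b] of the quadratic form [diag s]. *)
Hypothesis rot : forall a b c u w,
  ((b == c)%:R * s b * T a u w - (a == c)%:R * s a * T b u w) +
  ((b == u)%:R * s b * T c a w - (a == u)%:R * s a * T c b w) +
  ((b == w)%:R * s b * T c u a - (a == w)%:R * s a * T c u b) = 0.

Lemma trilinear_pair a b : a != b -> s a != 0 -> s b != 0 ->
  [/\ T a a a = 0, T a b b = 0, T b a a = 0, T a a b = 0 & T b a b = 0].
Proof.
move=> ab sa sb; have ba : b != a by rewrite eq_sym.
have := (rot a b a a a, rot a b b a a, rot a b a a b, rot a b b b b,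
         rot a b b b a, rot a b a b b).
rewrite !eqxx (negbTE ab) (negbTE ba) !(symT _ b a) !mul1r !mul0r !(addr0, add0r, subr0, sub0r).
move: (T a a a) (T b b b) (T a b b) (T b a a) (T a a b) (T b a b) sa sb.
move: (s a) (s b) => x y aaa bbb abb baa aab bab x0 y0 [[[[[h1 h2] h3] h4] h5] h6].
have e1 : abb = bab by apply: (mulfI x0); lra.
have e2 : baa = aab by apply: (mulfI y0); lra.
have e3 : bab = 0 by apply: (mulfI y0); move: h4; rewrite e1 mulr0; lra.
have e4 : aab = 0 by apply: (mulfI x0); move: h1; rewrite e2 mulr0; lra.
by rewrite e1 e2 e3 e4; split=> //; apply: (mulfI y0); move: h2; rewrite e3 !mulr0 !subr0.
Qed.

(** Components involving at most two distinct axes vanish by rotation in a plane. For three distinct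
    axes the rotation of [u] and [w] gives T c u w + T c w u = 0; the symmetry [symT] then excludes
    the volume form, which is invariant in rank 3. *)
Lemma trilinear_zero : (forall c u w, s c = 0 \/ s u = 0 \/ s w = 0 -> T c u w = 0) ->
  (exists a b, [/\ a != b, s a != 0 & s b != 0]) -> forall c u w, T c u w = 0.
Proof.
move=> deg [a0 [b0 [ab0 sa0 sb0]]] c u w.
have [sc|sc] := eqVneq (s c) 0; first by apply: deg; left.
have [su|su] := eqVneq (s u) 0; first by apply: deg; right; left.
have [sw|sw] := eqVneq (s w) 0; first by apply: deg; right; right.
have [uw|uw] := eqVneq u w.
  rewrite -uw; have [cu|cu] := eqVneq c u; last by case: (trilinear_pair cu).
  rewrite -cu; have [ca|ca] := eqVneq c a0; last by case: (trilinear_pair ca).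
  by rewrite ca; case: (trilinear_pair ab0).
have [cu|cu] := eqVneq c u; first by rewrite cu; case: (trilinear_pair uw).
have [cw|cw] := eqVneq c w.
  by rewrite symT cw; case: (trilinear_pair uw) => // ? _ _ _; rewrite symT.
have := rot u w c u u; rewrite eqxx (symT _ w u) [w == c]eq_sym (negbTE cw).
rewrite [u == c]eq_sym (negbTE cu) [w == u]eq_sym (negbTE uw).
rewrite !mul1r !mul0r !(oppr0, addr0, add0r, subr0, sub0r) => h.
by apply: (mulfI su); rewrite mulr0; lra.
Qed.
End Trilinear.

Lemma col_form (P B : 'M[R]_n) a b :
  ((col a P)^T *m B *m col b P) 0 (0 : 'I_1) = (P^T *m B *m P) a b.
Proof.
rewrite [LHS]mxE [RHS]mxE; apply: eq_bigr => k _; rewrite [col b P k 0]mxE; congr (_ * _).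
by rewrite [LHS]mxE [RHS]mxE; apply: eq_bigr => l _; rewrite !mxE.
Qed.

Lemma diag_kernel (P S : 'M[R]_n) (s : 'rV[R]_n) a : P \in unitmx ->
  P^T *m S *m P = diag_mx s -> s 0 a = 0 -> S *m col a P = 0.
Proof.
move=> uP dP sa; have uPt : P^T \in unitmx by rewrite unitmx_tr.
apply: (can_inj (mulKmx uPt)); rewrite mulmx0 mulmxA.
apply/colP => i; rewrite [RHS]mxE; have := congr1 (fun X : 'M[R]_n => X i a) dP.
rewrite [X in _ = X]mxE => h; transitivity ((P^T *m S *m P) i a); last first.
  by rewrite h; case: eqVneq => [->|_]; rewrite ?mulr0n // mulr1n.
by rewrite [LHS]mxE [RHS]mxE; apply: eq_bigr => k _; rewrite [col a P k 0]mxE.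
Qed.

(** Invariance under v xi with v in ker S confines T to the nondegenerate directions. If there are
    at least two of these, rotations force T = 0; if there is at most one, T has a single component
    and is proportional to S. *)
Lemma recurrent_derivative (S : 'M[R]_n) (T : 'I_n -> 'M[R]_n) m :
  S^T = S -> \rank S = m -> (m < n)%N -> (forall t, (T t)^T = T t) ->
  (forall F, F^T *m S + S *m F = 0 ->
     forall t, \sum_l F l t *: T l + F^T *m T t + T t *m F = 0) ->
  (exists nu : 'I_n -> R, forall t, T t = nu t *: S) /\ ((1 < m)%N -> forall t, T t = 0).
Proof.
move=> symS rS mn symT inv.
have ker (v : 'cV[R]_n) : S *m v = 0 -> (forall t, T t *m v = 0) /\ \sum_l v l 0 *: T l = 0.
  move=> Sv; have h xi t := inv _ (outer_isotropy xi symS Sv) t.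
  split=> [t|]; [exact: (derivative_kernel hn symT h)|exact: (derivative_along_kernel hn symT h)].
have two : 2 != 0 :> R by rewrite pnatr_eq0.
have [P [s [uP dP hs]]] := symmetric_diag_rank two symS rS.
pose e a := col a P.
(* Components of [T] in the S-orthogonal basis formed by the columns of [P]; the first slot is the
   direction of differentiation. *)
pose T3 z u w := ((e u)^T *m (\sum_l e z l 0 *: T l) *m e w) 0 (0 : 'I_1).
have eSe a b : (e a)^T *m S *m e b = ((a == b)%:R * s 0 a)%:M.
  by apply/matrixP => i j; rewrite !ord1 col_form dP !mxE eqxx mulr1n mulr_natl.
have lin z u w (F : 'M[R]_n) : F^T *m S + S *m F = 0 -> 
   ((e u)^T *m (\sum_l (F *m e z) l 0 *: T l) *m e w) 0 0 +
   ((F *m e u)^T *m (\sum_l e z l 0 *: T l) *m e w) 0 0 +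
   ((e u)^T *m (\sum_l e z l 0 *: T l) *m (F *m e w)) 0 (0 : 'I_1) = 0.
  move=> hF.
  have E : \sum_l (F *m e z) l 0 *: T l + F^T *m (\sum_l e z l 0 *: T l) + (\sum_l e z l 0 *: T l) *m F = 0.
    transitivity (\sum_t e z t 0 *: (\sum_l F l t *: T l + F^T *m T t + T t *m F)); last first.
      by rewrite big1 // => t _; rewrite inv // scaler0.
    rewrite mulmx_sumr mulmx_suml.
    under [RHS]eq_bigr do rewrite !scalerDr scalemxAr scalemxAl.
    rewrite !big_split /=; congr (_ + _ + _).
    under [RHS]eq_bigr do rewrite scaler_sumr.
    rewrite exchange_big /=; apply: eq_bigr => l _.
    by rewrite mxE scaler_suml; apply: eq_bigr => t _; rewrite scalerA mulrC.
  have := congr1 (fun X => ((e u)^T *m X *m e w) 0 (0 : 'I_1)) E.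
  rewrite mulmx0 mul0mx [X in _ = X -> _]mxE => <-.
  by rewrite !mulmxDr !mulmxDl !addmxE trmx_mul !mulmxA.
have rot a b c u w :
  ((b == c)%:R * s 0 b * T3 a u w - (a == c)%:R * s 0 a * T3 b u w) +
  ((b == u)%:R * s 0 b * T3 c a w - (a == u)%:R * s 0 a * T3 c b w) +
  ((b == w)%:R * s 0 b * T3 c u a - (a == w)%:R * s 0 a * T3 c u b) = 0.
  (* The infinitesimal rotation in the plane of e_a and e_b; lowering one index with [S] makes it
     skew for [S]. *)
  pose F := e a *m ((e b)^T *m S) - e b *m ((e a)^T *m S).
  have Fe c' : F *m e c' = ((b == c')%:R * s 0 b) *: e a - ((a == c')%:R * s 0 a) *: e b.
    by rewrite mulmxBl -!mulmxA !(mulmxA _ S) !eSe !mul_mx_scalar.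
  have hF : F^T *m S + S *m F = 0.
    rewrite /F linearB /= !trmx_mul !trmxK symS mulmxBl mulmxBr !mulmxA.
    by rewrite addrC addrA subrK subrr.
  have := lin c u w F hF; rewrite !Fe /T3 => <-; congr (_ + _ + _).
  - have -> : \sum_l (((b == c)%:R * s 0 b) *: e a - ((a == c)%:R * s 0 a) *: e b) l 0 *: T l =
        ((b == c)%:R * s 0 b) *: (\sum_l e a l 0 *: T l)
        - ((a == c)%:R * s 0 a) *: (\sum_l e b l 0 *: T l).
      rewrite !scaler_sumr -sumrB; apply: eq_bigr => l _.
      by rewrite addmxE oppmxE !scalemxE scalerBl !scalerA.
    by rewrite mulmxBr mulmxBl -!scalemxAr -!scalemxAl addmxE oppmxE !scalemxE.
  - have trZ (x z : R) (X Z : 'cV[R]_n) : (x *: X - z *: Z)^T = x *: X^T - z *: Z^T.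
      by apply/matrixP => i j; rewrite !mxE.
    by rewrite trZ !mulmxBl -!scalemxAl addmxE oppmxE !scalemxE.
  - by rewrite mulmxBr -!scalemxAr addmxE oppmxE !scalemxE.
have Q0 a : s 0 a = 0 -> \sum_l e a l 0 *: T l = 0 /\ forall t, T t *m e a = 0.
  move=> sa; suff /ker[] : S *m e a = 0 by [].
  exact: diag_kernel uP dP sa.
have symQ z : (\sum_l e z l 0 *: T l)^T = \sum_l e z l 0 *: T l.
  by rewrite linear_sum /=; apply: eq_bigr => l _; rewrite linearZ /= symT.
have symT3 c u w : T3 c u w = T3 c w u.
  have -> : T3 c u w = (((e u)^T *m (\sum_l e c l 0 *: T l) *m e w)^T) 0 0 by rewrite [RHS]mxE.
  by rewrite !trmx_mul trmxK symQ mulmxA.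
have deg c u w : s 0 c = 0 \/ s 0 u = 0 \/ s 0 w = 0 -> T3 c u w = 0.
  have Qe b : s 0 b = 0 -> (\sum_l e c l 0 *: T l) *m e b = 0.
    move=> /Q0[_ hb]; rewrite mulmx_suml big1 // => l _.
    by rewrite -scalemxAl hb scaler0.
  case=> [/Q0[hc _]|[hu|hw]]; first by rewrite /T3 hc mulmx0 mul0mx mxE.
    by rewrite symT3 /T3 -mulmxA Qe // mulmx0 mxE.
  by rewrite /T3 -mulmxA Qe // mulmx0 mxE.
have uPt : P^T \in unitmx by rewrite unitmx_tr.
have Tmu (mu : 'I_n -> R) : (forall a i j, T3 a i j = mu a * (diag_mx s) i j) ->
    forall t, T t = (\sum_a invmx P a t * mu a) *: S.
  move=> h t; have Qmu a : \sum_l e a l 0 *: T l = mu a *: S.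
    apply: (can_inj (mulKmx uPt)); apply: (can_inj (mulmxK uP)).
    apply/matrixP => i j; rewrite -col_form -/(T3 a i j) h -dP.
    by rewrite -scalemxAr -scalemxAl scalemxE.
  rewrite scaler_suml; under eq_bigr do rewrite -scalerA -Qmu scaler_sumr.
  rewrite exchange_big /= (bigD1 t) //= [X in _ + X]big1 ?addr0 => [|l lt].
    under eq_bigr do rewrite scalerA mulrC.
    rewrite -scaler_suml; have <- : (P *m invmx P) t t = \sum_(i < n) e i t 0 * invmx P i t.
      by rewrite mxE; apply: eq_bigr => i _; rewrite [e i t 0]mxE.
    by rewrite mulmxV // mxE eqxx scale1r.
  under eq_bigr do rewrite scalerA mulrC.
  rewrite -scaler_suml; have <- : (P *m invmx P) l t = \sum_(i < n) e i l 0 * invmx P i t.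
    by rewrite mxE; apply: eq_bigr => i _; rewrite [e i l 0]mxE.
  by rewrite mulmxV // mxE (negbTE lt) scale0r.
have [m1|m1] := ltnP 1 m.
  have h : forall t, T t = 0.
    move=> t; rewrite (Tmu (fun=> 0)) => [|a i j].
      by under eq_bigr do rewrite mulr0; rewrite big1_eq scale0r.
    rewrite mul0r; apply: (trilinear_zero symT3 rot deg).
    have m0 : (0 < m)%N := ltnW m1.
    exists (Ordinal (ltn_trans m0 mn)), (Ordinal (ltn_trans m1 mn)).
    by rewrite !hs -val_eqE.
  by split=> [|_]; [exists (fun=> 0) => t; rewrite scale0r|].
split=> //.
pose o := Ordinal (leq_ltn_trans (leq0n m) mn).
(* Here m <= 1, so [o] is the only index at which [s] can be nonzero. *)
eexists; apply: (Tmu (fun a => T3 a o o / s 0 o)) => a i j.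
have s0 k : k != o -> s 0 k = 0.
  move=> ko; apply/eqP; rewrite -[_ == 0]negbK hs -leqNgt (leq_trans m1) // lt0n.
  exact: ko.
have [-> |io] := eqVneq i o; last first.
  by rewrite (deg a i j); [rewrite mxE (s0 i io) mul0rn mulr0|right; left; apply: s0].
have [-> |jo] := eqVneq j o; last first.
  by rewrite (deg a o j); [rewrite mxE eq_sym (negbTE jo) mulr0n mulr0|right; right; apply: s0].
(* If s_o = 0, which is the case m = 0, the component also vanishes, by [deg]. *)
rewrite mxE eqxx mulr1n; have [so|so] := eqVneq (s 0 o) 0; last by rewrite mulfVK.
by rewrite so mulr0 deg //; right; left.
Qed.

End RecurrentDerivative.

Lemma curv_mx_anti {R : realType} {n : nat} (G : conn_comp R n) r k y :
  curv_mx G r k y = - curv_mx G k r y.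
Proof. by rewrite /curv_mx opprD opprB opprB. Qed.

Lemma curv_mx_bianchi {R : realType} {n : nat} (U : set 'rV[R]_n) (G : conn_comp R n) y :
  open U -> smooth_conn U G -> (forall z, U z -> forall i r s, G z i r s = G z i s r) -> U y ->
  forall r k s i, curv_mx G r k y i s + curv_mx G k s y i r + curv_mx G s r y i k = 0.
Proof.
move=> oU sG sym Uy r k s i.
have dsym a b c : pd a (fun z => G z i b c) y = pd a (fun z => G z i c b) y.
  by apply: (pd_eq_on oU) Uy _ => z Uz; exact: sym.
have pdC a b c : pd_mx a (conn_mx G b) y i c = pd a (fun z => G z i b c) y.
  by rewrite pd_mxE; congr (pd _ _ _); apply: funext => z; rewrite mxE.
have CC a b c : (conn_mx G a y *m conn_mx G b y) i c = (conn_mx G a y *m conn_mx G c y) i b.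
  by rewrite [LHS]mxE [RHS]mxE; apply: eq_bigr => q _; rewrite !mxE (sym y Uy q b c).
have E a b c : curv_mx G a b y i c = pd a (fun z => G z i b c) y - pd b (fun z => G z i a c) y +
    ((conn_mx G a y *m conn_mx G b y) i c - (conn_mx G b y *m conn_mx G a y) i c).
  by rewrite /curv_mx addmxE [X in X + _ = _]addmxE oppmxE !pdC [X in _ + X = _]addmxE oppmxE.
rewrite !E.
rewrite (CC r k s) (CC k r s) (CC s k r) (dsym k r s) (dsym s r k) (dsym r s k).
ring.
Qed.

(** The form descends to the quotient by ker S. For m <= 1 that quotient is at most a line and
    carries no nonzero skew form; for m > 1 the last hypothesis applies to the basis vectors with
    nonzero S-square. *)
Lemma skew_zero {R : realType} {n m : nat} (S g : 'M[R]_n) :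
  S^T = S -> \rank S = m -> g^T = - g -> (forall v : 'cV[R]_n, S *m v = 0 -> g *m v = 0) ->
  ((1 < m)%N -> forall x : 'cV[R]_n, (x^T *m S *m x) 0 0 != 0 -> g *m x = 0) -> g = 0.
Proof.
move=> symS rS skew ker nz.
have two : 2 != 0 :> R by rewrite pnatr_eq0.
have [P [s [uP dP hs]]] := symmetric_diag_rank two symS rS.
have g0 a : s 0 a = 0 -> g *m col a P = 0 by move=> sa; exact: ker (diag_kernel uP dP sa).
have uPt : P^T \in unitmx by rewrite unitmx_tr.
apply: (can_inj (mulKmx uPt)); apply: (can_inj (mulmxK uP)); rewrite mulmx0 mul0mx.
have h0 a b : g *m col b P = 0 -> (P^T *m g *m P) a b = 0.
  by move=> h; rewrite -col_form -mulmxA h mulmx0 mxE.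
have sk a b : (P^T *m g *m P) a b = - (P^T *m g *m P) b a.
  have -> : (P^T *m g *m P) a b = (P^T *m g *m P)^T b a by rewrite [RHS]mxE.
  by rewrite !trmx_mul trmxK skew mulNmx mulmxN oppmxE mulmxA.
apply/matrixP => a b; rewrite [RHS]mxE.
have [sb|sb] := eqVneq (s 0 b) 0; first exact/h0/g0.
have [sa|sa] := eqVneq (s 0 a) 0; first by rewrite sk h0 ?oppr0 //; exact: g0.
have [m1|m1] := ltnP 1 m.
  by apply/h0/(nz m1); rewrite col_form dP mxE eqxx.
have ab : a = b.
  apply: val_inj; move: sa sb; rewrite !hs => am bm.
  by move: am bm m1; clear; rewrite /=; lia.
rewrite ab; have /eqP := sk b b; rewrite -subr_eq0 opprK -mulr2n mulrn_eq0 /=.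
by move/eqP.
Qed.

(* Contracting [x^T S R_(rt) x = 0] with [x^r] gives [3/2 (x^T S x) (g x)_t = 0]. *)
Lemma skew_of_invariant {R : realType} {n : nat} (S g : 'M[R]_n) (Rm : 'I_n -> 'I_n -> 'M[R]_n) a
  (x : 'cV[R]_n) : S^T = S -> g^T = - g ->
  (forall s r t j, Rm s r t j = g s r * (j == t)%:R + (s == t)%:R * (a * S j r + 2^-1 * g j r)
    - (r == t)%:R * (a * S j s + 2^-1 * g j s)) ->
  (forall r t, S *m Rm r t + (Rm r t)^T *m S = 0) -> (x^T *m S *m x) 0 0 != 0 -> g *m x = 0.
Proof.
move=> symS skew hR inv nz; pose q := (x^T *m S *m x) 0 (0 : 'I_1).
pose b r := (S *m x) r 0; pose d r := (g *m x) r 0.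
have Rx r t i : (Rm r t *m x) i 0 = g r t * x i 0 + (r == i)%:R * (a * b t - 2^-1 * d t)
    - (t == i)%:R * (a * b r - 2^-1 * d r).
  have bE u : a * b u - 2^-1 * d u = \sum_j (a * S j u + 2^-1 * g j u) * x j 0.
    rewrite /b /d [(S *m x) u 0]mxE [(g *m x) u 0]mxE !mulr_sumr -sumrB.
    apply: eq_bigr => j _; rewrite -{1}symS [S^T _ _]mxE.
    have -> : g u j = - g j u by have := congr1 (fun X : 'M[R]_n => X j u) skew; rewrite !mxE.
    ring.
  rewrite mxE !bE !mulr_sumr -(sum_delta (fun j => g r t * x j 0)) -big_split -sumrB /=.
  by apply: eq_bigr => j _; rewrite hR; ring.
have key r t : g r t * q + 2^-1 * (b t * d r - b r * d t) = 0.
  have h : (x^T *m S *m (Rm r t *m x)) 0 (0 : 'I_1) = 0.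
    have := congr1 (fun X => (x^T *m X *m x) 0 (0 : 'I_1)) (inv r t).
    rewrite mulmx0 mul0mx [X in _ = X -> _]mxE mulmxDr mulmxDl addmxE !mulmxA.
    have -> : (x^T *m (Rm r t)^T *m S *m x) 0 0 = (x^T *m S *m Rm r t *m x) 0 (0 : 'I_1).
      have -> : (x^T *m S *m Rm r t *m x) 0 (0 : 'I_1) = ((x^T *m S *m Rm r t *m x)^T) 0 0.
        by rewrite [RHS]mxE.
      by rewrite !trmx_mul trmxK symS !mulmxA.
    by move=> /eqP; rewrite -mulr2n mulrn_eq0 /= => /eqP.
  rewrite -h mxE; transitivity (\sum_i b i * (Rm r t *m x) i 0); last first.
    apply: eq_bigr => i _; congr (_ * _).
    by rewrite /b -{1}symS -[x]trmxK -trmx_mul [LHS]mxE trmxK.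
  have qE : q = \sum_i b i * x i 0.
    rewrite /q mxE; apply: eq_bigr => i _; congr (_ * _).
    by rewrite /b -{2}symS -{2}[x]trmxK -trmx_mul [RHS]mxE.
  under eq_bigr do rewrite Rx mulrBr mulrDr.
  rewrite sumrB big_split /=.
  have D (f : 'I_n -> R) u e : \sum_i f i * ((u == i)%:R * e) = f u * e.
    rewrite -(sum_delta f) mulr_suml; apply: eq_bigr => i _.
    by rewrite mulrA [i == u]eq_sym.
  rewrite !D; under eq_bigr do rewrite mulrCA.
  by rewrite -mulr_sumr -qE; ring.
apply/colP => t; rewrite [RHS]mxE -/(d t).
have xd : \sum_r x r 0 * d r = 0.
  have h : (x^T *m g *m x) 0 (0 : 'I_1) = 0.
    have h2 : (x^T *m g *m x) 0 (0 : 'I_1) = - (x^T *m g *m x) 0 (0 : 'I_1).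
      have {1}-> : (x^T *m g *m x) 0 (0 : 'I_1) = ((x^T *m g *m x)^T) 0 0 by rewrite [RHS]mxE.
      by rewrite !trmx_mul trmxK skew mulNmx mulmxN oppmxE mulmxA.
    by move/eqP: h2; rewrite -subr_eq0 opprK -mulr2n mulrn_eq0 /= => /eqP.
  move: h; rewrite -mulmxA mxE => h; rewrite -[RHS]h; apply: eq_bigr => r _; congr (_ * _); by rewrite mxE.
have E : \sum_r x r 0 * (g r t * q + 2^-1 * (b t * d r - b r * d t)) = 0.
  by rewrite big1 // => r _; rewrite key mulr0.
have qE : \sum_r x r 0 * b r = q.
  by rewrite /q -mulmxA [RHS]mxE; apply: eq_bigr => i _; rewrite mxE.
have dE : \sum_r x r 0 * g r t = - d t.
  rewrite /d mxE -sumrN; apply: eq_bigr => r _.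
  have -> : g r t = - g t r by have := congr1 (fun X : 'M[R]_n => X t r) skew; rewrite !mxE.
  ring.
have : - d t * q + 2^-1 * (b t * 0 - q * d t) = 0.
  transitivity ((\sum_r x r 0 * g r t) * q + 2^-1 * (b t * (\sum_r x r 0 * d r)
    - (\sum_r x r 0 * b r) * d t)); first by rewrite dE xd qE.
  rewrite -[RHS]E !mulr_suml [b t * _]mulr_sumr -sumrB [2^-1 * _]mulr_sumr -big_split /=.
  by apply: eq_bigr => r _; ring.
rewrite mulr0 sub0r => h; apply: (mulfI nz); rewrite mulr0 -/q.
move: h; clear; clearbody q d; lra.
Qed.

(** The Ricci identity for a parallel S: equality of its mixed derivatives says that each curvature
    endomorphism is skew for S. *)
Lemma parallel_algebra {R : realType} {n : nat} (S Cr Ct Drt Dtr : 'M[R]_n) :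
  (S *m Cr + Cr^T *m S) *m Ct + S *m Drt + (Drt^T *m S + Ct^T *m (S *m Cr + Cr^T *m S)) =
  (S *m Ct + Ct^T *m S) *m Cr + S *m Dtr + (Dtr^T *m S + Cr^T *m (S *m Ct + Ct^T *m S)) ->
  S *m (Drt - Dtr + (Cr *m Ct - Ct *m Cr)) + (Drt - Dtr + (Cr *m Ct - Ct *m Cr))^T *m S = 0.
Proof.
move=> /eqP; rewrite -subr_eq0 => /eqP <-.
have -> : (Drt - Dtr + (Cr *m Ct - Ct *m Cr))^T =
    Drt^T - Dtr^T + (Ct^T *m Cr^T - Cr^T *m Ct^T).
  by rewrite -!trmx_mul; apply/matrixP => i j; rewrite !(addmxE, oppmxE) [LHS]mxE !(addmxE, oppmxE) ![_^T _ _]mxE.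
rewrite !(mulmxBl, mulmxBr, mulmxDl, mulmxDr, mulmxN, mulNmx) !mulmxA.
apply/matrixP => i j; rewrite !(addmxE, oppmxE); ring.
Qed.

(** * Curvature and operator field of a system with maximal symmetry *)

Section Structure.
Context {R : realType} {n m : nat} (hn : (2 <= n)%N) (M : smooth_manifold R n).
Context (G : chart R n M -> conn_comp R n) (A : chart R n M -> op_comp R n).
Hypothesis hM : connected [set: M].
Hypothesis sG : forall c, atlas M c -> smooth_conn (cimg c) (G c).
Hypothesis symG : symmetric_connection G.
Hypothesis mn : (m < n)%N.
Hypothesis hrank : forall c, atlas M c -> forall y, cimg c y -> \rank (ricci_sym (G c) y) = m.
Hypothesis hdim : vect_dim [set eta | point_symmetry A G eta]
            (n * (n + 1 - m) + (m * (m - 1)) %/ 2)%N.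

Section AtChart.
Context (c : chart R n M) (Mc : atlas M c).
Local Notation S := (ricci_sym (G c)).
Let two : 2 != 0 :> R. Proof. by rewrite pnatr_eq0. Qed.
Let oU : open (cimg c) := @cimg_open _ _ _ c.

Lemma smooth_symmetry eta : point_symmetry A G eta -> smooth_vect (cimg c) (eta c).
Proof. by case=> -[se _] _ i; exact: se. Qed.

Lemma affine_symmetry eta : point_symmetry A G eta -> forall y, cimg c y ->
  infinitesimal_affine (eta c) (G c) y.
Proof. by case=> _ h y /(h c Mc y)[]. Qed.

(** [jets_surjective] prescribes free entries only. The hypothesis makes the difference to [F0] skew
    for S, and a skew matrix whose free entries vanish is zero. *)
Lemma jet_exists y v (F0 : 'M[R]_n) : cimg c y ->
  (forall eta, point_symmetry A G eta -> eta c y = v ->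
    let X := diff_mx (eta c) y - F0 in X^T *m S y + S y *m X = 0) ->
  exists2 eta, point_symmetry A G eta & eta c y = v /\ diff_mx (eta c) y = F0.
Proof.
move=> cy h.
have [P [s [uP dP hs]]] := symmetric_diag_rank two (ricci_symT _ _) (hrank Mc cy).
have [eta se [ev ej]] := jets_surjective hM sG (ltnW mn) hdim Mc cy uP dP hs v
  (invmx P *m F0 *m P).
exists eta => //; split=> //; apply/eqP; rewrite -subr_eq0; apply/eqP.
apply: (isotropy_coords_zero uP dP hs (h eta se ev)) => i j ij.
by rewrite mulmxBr mulmxBl addmxE oppmxE ej // subrr.
Qed.

Lemma isotropy_exists y (F : 'M[R]_n) : cimg c y -> F^T *m S y + S y *m F = 0 ->
  exists2 eta, point_symmetry A G eta & eta c y = 0 /\ diff_mx (eta c) y = F.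
Proof.
move=> cy hF; apply: jet_exists => // eta se e0 X.
have := isotropy_ricci_sym oU (sG Mc) (smooth_symmetry se) (affine_symmetry se) cy e0.
rewrite /X linearB /= mulmxBl mulmxBr addrACA -opprD hF subr0.
by [].
Qed.

Lemma outer_exists y (v : 'cV[R]_n) (xi : 'rV[R]_n) : cimg c y -> S y *m v = 0 ->
  exists2 eta, point_symmetry A G eta & eta c y = 0 /\ diff_mx (eta c) y = v *m xi.
Proof. by move=> cy Sv; apply: isotropy_exists => //; apply: outer_isotropy => //; exact: ricci_symT. Qed.

Lemma nabla_S_sym t y : (nabla_S (G c) t y)^T = nabla_S (G c) t y.
Proof.
have fE : (fun z => (S z)^T) = S by apply: funext => z; exact: ricci_symT.
have := pd_mx_tr t S y; rewrite fE /nabla_S; move: (pd_mx t S y) (conn_mx (G c) t y) => D C dT.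
have tB (X Y : 'M[R]_n) : (X - Y)^T = X^T - Y^T by apply/matrixP => i j; rewrite !mxE.
by rewrite !tB !trmx_mul trmxK ricci_symT -dT addrAC.
Qed.

Lemma nabla_isotropy y (F : 'M[R]_n) : cimg c y -> F^T *m S y + S y *m F = 0 -> forall t,
  \sum_l F l t *: nabla_S (G c) l y + F^T *m nabla_S (G c) t y + nabla_S (G c) t y *m F = 0.
Proof.
move=> cy hF t; have [eta se [e0 <-]] := isotropy_exists cy hF.
exact: (isotropy_nabla_S oU (sG Mc) (smooth_symmetry se) (affine_symmetry se) cy e0).
Qed.

Lemma nabla_recurrent y : cimg c y ->
  (exists nu : 'I_n -> R, forall t, nabla_S (G c) t y = nu t *: S y) /\
  ((1 < m)%N -> forall t, nabla_S (G c) t y = 0).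
Proof.
move=> cy; apply: (recurrent_derivative hn (ricci_symT _ _) (hrank Mc cy) mn).
  by move=> t; exact: nabla_S_sym.
by move=> F hF; exact: nabla_isotropy.
Qed.

Lemma kernel_nonzero y : cimg c y -> exists2 v : 'cV[R]_n, v != 0 & S y *m v = 0.
Proof.
move=> cy; have [P [s [uP dP hs]]] := symmetric_diag_rank two (ricci_symT _ _) (hrank Mc cy).
exists (col (Ordinal mn) P); last first.
  apply: (diag_kernel uP dP); apply/eqP; rewrite -[_ == 0]negbK hs.
  by rewrite /= ltnn.
apply/negP => /eqP; rewrite colE => /(congr1 (mulmx (invmx P))).
rewrite mulmx0 mulKmx // => /matrixP/(_ (Ordinal mn) 0); rewrite !mxE !eqxx => /eqP.
by rewrite oner_eq0.
Qed.

Lemma outer_curvature y (v : 'cV[R]_n) : cimg c y -> S y *m v = 0 ->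
  forall (xi : 'rV[R]_n) r s, let F := v *m xi in
  F *m curv_mx (G c) s r y - curv_mx (G c) s r y *m F =
  \sum_k F k s *: curv_mx (G c) k r y + \sum_k F k r *: curv_mx (G c) s k y.
Proof.
move=> cy Sv xi r s F; have [eta se [e0 eF]] := outer_exists xi cy Sv.
rewrite /F -eF.
exact: (isotropy_curvature oU (sG Mc) (smooth_symmetry se) (affine_symmetry se) cy e0).
Qed.

Lemma nabla_along_kernel y (v : 'cV[R]_n) : cimg c y -> S y *m v = 0 ->
  \sum_l v l 0 *: nabla_S (G c) l y = 0.
Proof.
move=> cy Sv; apply: (derivative_along_kernel hn (T := fun l => nabla_S (G c) l y)).
  by move=> t; exact: nabla_S_sym.
move=> xi t F; apply: nabla_isotropy => //; apply: outer_isotropy => //; exact: ricci_symT.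
Qed.

(** For v in ker S the derivative of S along v vanishes, so invariance of S says that any symmetry
    with value v has nabla eta skew for S at y. Zero is therefore an admissible covariant
    derivative. *)
Lemma kernel_exists y (v : 'cV[R]_n) : cimg c y -> S y *m v = 0 ->
  exists2 eta, point_symmetry A G eta & eta c y = v^T /\ nabla_mx (G c) (eta c) y = 0.
Proof.
move=> cy Sv; pose N := \sum_k v k 0 *: conn_mx (G c) k y.
have [eta se [ev eF]] : exists2 eta, point_symmetry A G eta &
    eta c y = v^T /\ diff_mx (eta c) y = - N.
  apply: jet_exists => // eta se ev X; have vE k : eta c y 0 k = v k 0 by rewrite ev mxE.
  have := lie_ricci_sym oU (sG Mc) (smooth_symmetry se) (affine_symmetry se) cy.
  have := nabla_along_kernel cy Sv; rewrite /nabla_S.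
  under eq_bigr do rewrite -vE !scalerBr scalemxAr (scalemxAl _ (conn_mx _ _ _)^T).
  rewrite !sumrB -mulmx_sumr -mulmx_suml => E1 E2.
  have NE : \sum_k eta c y 0 k *: conn_mx (G c) k y = N by apply: eq_bigr => k _; rewrite vE.
  have NTE : \sum_k eta c y 0 k *: (conn_mx (G c) k y)^T = N^T.
    by rewrite -NE linear_sum; apply: eq_bigr => k _; rewrite linearZ.
  move: E1; rewrite NE NTE E2 => E1; rewrite /X opprK mulmxDr.
  have -> : (diff_mx (eta c) y + N)^T = (diff_mx (eta c) y)^T + N^T.
    by apply/matrixP => i j; rewrite !mxE.
  move: E1; move: (diff_mx _ _) (S y) => F S0 E1; rewrite mulmxDl.
  rewrite -[RHS]oppr0 -E1; apply/matrixP => i j; rewrite !(addmxE, oppmxE); ring.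
exists eta => //; split=> //; rewrite /nabla_mx eF addrC; apply/eqP; rewrite subr_eq0.
by apply/eqP; apply: eq_bigr => k _; rewrite ev mxE.
Qed.

Lemma op_scalar y : cimg c y -> exists a, A c y = a%:M.
Proof.
move=> cy; have [v v0 Sv] := kernel_nonzero cy.
apply: (scalar_of_commute v0) => xi.
have [eta [_ h] [e0 eF]] := outer_exists xi cy Sv.
have [/lie_derivative_mx + _] := h c Mc y cy.
rewrite eF big1 => [/esym/eqP|k _]; last by rewrite e0 mxE scale0r.
by rewrite subr_eq0 => /eqP ->.
Qed.

(** As A is scalar it commutes with the linear part, and invariance reduces to the vanishing of its
    derivative along eta, whose value at y is arbitrary. *)
Lemma op_constant y k : cimg c y -> pd_mx k (A c) y = 0.
Proof.
move=> cy; have [P [s [uP dP hs]]] := symmetric_diag_rank two (ricci_symT _ _) (hrank Mc cy).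
have [eta [_ h] [ev _]] := jets_surjective hM sG (ltnW mn) hdim Mc cy uP dP hs (delta_mx 0 k) 0.
have [/lie_derivative_mx + _] := h c Mc y cy; have [a ->] := op_scalar cy.
rewrite mul_mx_scalar mul_scalar_mx subrr => <-.
rewrite (bigD1 k) //= ev mxE !eqxx scale1r big1 ?addr0 // => l lk.
by rewrite mxE (negbTE lk) andbF scale0r.
Qed.

Lemma parallel_curvature r t y : (forall z, cimg c z -> forall t, nabla_S (G c) t z = 0) ->
  cimg c y -> S y *m curv_mx (G c) r t y + (curv_mx (G c) r t y)^T *m S y = 0.
Proof.
move=> par cy; have sS := smooth_ricci_sym oU (sG Mc).
have sC k := smooth_conn_mx oU k (sG Mc).
have dS k z : cimg c z -> pd_mx k S z = S z *m conn_mx (G c) k z + (conn_mx (G c) k z)^T *m S z.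
  move=> cz; have /eqP := par z cz k; rewrite /nabla_S subr_eq0 subr_eq addrC => /eqP.
  by [].
have := pd_mx_comm oU r t cy sS.
rewrite (pd_mx_eq oU r cy (dS t)) (pd_mx_eq oU t cy (dS r)).
have s1 k := smooth_mxM oU sS (sC k).
have s2 k := smooth_mxM oU (smooth_mx_tr oU (sC k)) sS.
rewrite !(pd_mxD _ cy (s1 _) (s2 _)) !(pd_mxM oU _ cy sS (sC _)).
rewrite !(pd_mxM oU _ cy (smooth_mx_tr oU (sC _)) sS) !pd_mx_tr !dS // /curv_mx.
exact: parallel_algebra.
Qed.

Let g y : 'M[R]_n := \matrix_(s, r) ((n%:R + 1)^-1 * \tr (curv_mx (G c) s r y)).

Lemma curvature_trace_form y s r t j : cimg c y ->
  curv_mx (G c) s r y t j = g y s r * (j == t)%:R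
  + (s == t)%:R * ((n%:R - 1)^-1 * S y j r + 2^-1 * g y j r)
  - (r == t)%:R * ((n%:R - 1)^-1 * S y j s + 2^-1 * g y j s).
Proof.
move=> cy; have [v v0 Sv] := kernel_nonzero cy.
have SE a b : 2^-1 * (\sum_k curv_mx (G c) k b y k a + \sum_k curv_mx (G c) k a y k b) = S y a b.
  by rewrite /ricci_sym scalemxE addmxE [_^T a b]mxE !ricciE.
have := curvature_structure hn (fun s r => curv_mx_anti (G c) s r y)
  (curv_mx_bianchi oU (sG Mc) (symG Mc) cy) v0 (outer_curvature cy Sv) s r t j.
by rewrite /= !SE => ->; rewrite /g ![(\matrix_(_, _) _) _ _]mxE.
Qed.

(** The two ranges of m meet in [skew_zero]: [trace_kernel] handles ker S, and for m > 1 the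
    parallelism of S makes [skew_of_invariant] available. *)
Lemma curvature_trace_zero y : cimg c y -> g y = 0.
Proof.
move=> cy; have skew z : (g z)^T = - g z.
  by apply/matrixP => i j; rewrite !mxE curv_mx_anti linearN /= mulrN.
apply: (skew_zero (ricci_symT _ _) (hrank Mc cy) (skew y)).
  move=> v Sv; apply/colP => r; rewrite [RHS]mxE -[g y]opprK -skew mulNmx oppmxE.
  have := trace_kernel hn (outer_curvature cy Sv) r => /= h.
  apply/eqP; rewrite oppr_eq0; apply/eqP; rewrite -[RHS]h mxE; apply: eq_bigr => k _.
  by rewrite mulrC [(g y)^T _ _]mxE [g y _ _]mxE.
move=> m1 x; apply: (skew_of_invariant (ricci_symT _ _) (skew y)).
  by move=> s r t j; exact: curvature_trace_form.
move=> r t; apply: parallel_curvature => // z cz k.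
by have [_ ->] := nabla_recurrent cz.
Qed.

Lemma curvature_form y s r t j : cimg c y -> curv_mx (G c) s r y t j =
  (n%:R - 1)^-1 * ((s == t)%:R * S y j r - (r == t)%:R * S y j s).
Proof.
move=> cy; rewrite curvature_trace_form // curvature_trace_zero // !mxE; ring.
Qed.

Lemma curvature_trace y s r : cimg c y -> \tr (curv_mx (G c) s r y) = 0.
Proof.
move=> cy; have := congr1 (fun X : 'M[R]_n => X s r) (curvature_trace_zero cy).
rewrite /g !mxE => /eqP; rewrite mulf_eq0 invr_eq0 gt_eqF ?ltr_wpDl //=.
by move/eqP.
Qed.

End AtChart.
End Structure.

(** * Symmetries along the kernel of the Ricci tensor *)

Section KernelJets.
Context {R : realType} {n : nat} (U : set 'rV[R]_n) (oU : open U).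
Context (p : 'rV[R]_n) (rho : R).
Hypothesis rhoU : forall z, `|z - p| <= rho -> U z.
Hypothesis rho0 : 0 < rho.
Local Notation B := [set z | `|z - p| < rho].
Let BU : B `<=` U. Proof. by move=> z /ltW /rhoU. Qed.
Let Bp : B p. Proof. by rewrite /= subrr normr0. Qed.

Section DominatedMatrices.
Context (T : finType) (u : T -> 'rV[R]_n -> R).

Definition dominated_mx (a b : nat) (X : 'rV[R]_n -> 'M[R]_(a, b)) :=
  forall i j, dominated p rho u (fun z => X z i j).

Lemma dominated_mx_eq a b (X Y : 'rV[R]_n -> 'M[R]_(a, b)) :
  (forall z, B z -> Y z = X z) -> dominated_mx X -> dominated_mx Y.
Proof. by move=> XY dX i j; apply: dominated_eq (dX i j) => z Bz; rewrite XY. Qed.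

Lemma dominated_mxD a b (X Y : 'rV[R]_n -> 'M[R]_(a, b)) :
  dominated_mx X -> dominated_mx Y -> dominated_mx (fun z => X z + Y z).
Proof.
by move=> dX dY i j; apply: dominated_eq (dominatedD (dX i j) (dY i j)) => z _; rewrite mxE.
Qed.

Lemma dominated_mxZ a b (f : 'rV[R]_n -> R) (X : 'rV[R]_n -> 'M[R]_(a, b)) :
  (forall z, U z -> {for z, continuous f}) -> dominated_mx X ->
  dominated_mx (fun z => f z *: X z).
Proof.
by move=> cf dX i j; apply: dominated_eq (dominatedM rhoU cf (dX i j)) => z _; rewrite mxE.
Qed.

Lemma dominated_mxN a b (X : 'rV[R]_n -> 'M[R]_(a, b)) :
  dominated_mx X -> dominated_mx (fun z => - X z).
Proof. by move=> dX i j; apply: dominated_eq (dominatedN (dX i j)) => z _; rewrite mxE. Qed.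

Lemma dominated_mulmx a b e (A : 'rV[R]_n -> 'M[R]_(a, b)) (X : 'rV[R]_n -> 'M[R]_(b, e)) :
  smooth_mx U A -> dominated_mx X -> dominated_mx (fun z => A z *m X z).
Proof.
move=> sA dX i j; apply: dominated_eq (dominated_sum _ (fun k =>
  dominatedM rhoU (fun z Uz => smooth_cont (sA i k) Uz) (dX k j))) => z _.
by rewrite mxE.
Qed.

Lemma dominated_mulmxr a b e (A : 'rV[R]_n -> 'M[R]_(b, e)) (X : 'rV[R]_n -> 'M[R]_(a, b)) :
  smooth_mx U A -> dominated_mx X -> dominated_mx (fun z => X z *m A z).
Proof.
move=> sA dX i j; apply: dominated_eq (dominated_sum _ (fun k =>
  dominatedM rhoU (fun z Uz => smooth_cont (sA k j) Uz) (dX i k))) => z _.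
by rewrite mxE; apply: eq_bigr => k _; rewrite mulrC.
Qed.

End DominatedMatrices.

Context (G : conn_comp R n) (sG : smooth_conn U G).
Hypothesis symG : forall z, U z -> forall i r s, G z i r s = G z i s r.
Local Notation S := (ricci_sym G).
Local Notation C := (conn_mx G).
Hypothesis curvG : forall z, U z -> forall s r t j, curv_mx G s r z t j =
  (n%:R - 1)^-1 * ((s == t)%:R * S z j r - (r == t)%:R * S z j s).

Section Field.
Context (eta : vect_comp R n) (se : smooth_vect U eta).
Hypothesis aff : forall z, U z -> infinitesimal_affine eta G z.
Local Notation V := (fun z => (eta z)^T).
Local Notation F := (nabla_mx G eta).

Lemma smooth_vect_tr : smooth_mx U V.
Proof. by move=> i j; apply: (smooth_on_eq oU _ (se i)) => z _; rewrite mxE ord1. Qed.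

Lemma smooth_nabla_mx : smooth_mx U F.
Proof.
have h k := smooth_mxZ oU (se k) (smooth_conn_mx oU k sG).
exact: (smooth_mxD oU (smooth_diff_mx oU se) (smooth_mx_sum oU _ h)).
Qed.

Lemma pd_vect r z : U z -> pd_mx r V z = col r (F z) - C r z *m V z.
Proof.
move=> Uz; apply/colP => a; rewrite pd_mxE addmxE oppmxE.
have -> : pd r (fun z => V z a 0) z = diff_mx eta z a r.
  by rewrite mxE; apply: pd_ext => w; rewrite mxE.
rewrite [col r _ a 0]mxE /nabla_mx addmxE -addrA -[LHS]addr0; congr (_ + _).
rewrite summxE [(C r z *m _) a 0]mxE -sumrB big1 // => k _.
by rewrite !mxE symG // mulrC subrr.
Qed.

(** The first term contains S V, and the second acquires it after multiplication by S; this closes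
    the system for S times the jet. *)
Lemma curvature_contraction r z : U z -> \sum_k eta z 0 k *: curv_mx G r k z =
  (n%:R - 1)^-1 *: (delta_mx r 0 *m (S z *m V z)^T - V z *m row r (S z)).
Proof.
move=> Uz; apply/matrixP => a s.
rewrite summxE scalemxE addmxE oppmxE [(delta_mx r 0 *m _) a s]mxE big_ord1.
rewrite [(V z *m _) a s]mxE big_ord1 [delta_mx r 0 a 0]mxE eqxx andbT [_^T 0 s]mxE.
rewrite [V z a 0]mxE [row r _ 0 s]mxE [(S z *m V z) s 0]mxE [a == r]eq_sym.
under eq_bigr do rewrite scalemxE curvG // mulrCA mulrBr.
rewrite -mulr_sumr sumrB; congr (_ * (_ - _)).
  by rewrite mulr_sumr; apply: eq_bigr => k _; rewrite [V z k 0]mxE mulrCA [S z s k * _]mulrC.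
transitivity (\sum_k eta z 0 k * S z s r * (k == a)%:R).
  by apply: eq_bigr => k _; rewrite mulrA mulrAC.
by rewrite sum_delta -[in LHS](ricci_symT G z) [_^T s r]mxE.
Qed.

Section Kernel.
Variable nu : 'I_n -> 'rV[R]_n -> R.
Hypothesis cnu : forall t z, U z -> {for z, continuous (nu t)}.
Hypothesis recG : forall z, U z -> forall t, nabla_S G t z = nu t z *: S z.

(* The jet multiplied by [S] solves a linear homogeneous system, because the
   curvature term of the jet equation is expressed through [S]. *)
Lemma kernel_jet : S p *m V p = 0 -> S p *m F p = 0 ->
  forall z, B z -> S z *m V z = 0 /\ S z *m F z = 0.
Proof.
move=> v0 f0; pose SV z := S z *m V z; pose SF z := S z *m F z.
have sS := smooth_ricci_sym oU sG; have sV := smooth_vect_tr; have sF := smooth_nabla_mx.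
have sC r := smooth_conn_mx oU r sG.
pose u (a : 'I_n + 'I_n * 'I_n) z : R := match a with
  | inl i => SV z i 0 | inr ij => SF z ij.1 ij.2 end.
have sSV : smooth_mx U SV := smooth_mxM oU sS sV.
have sSF : smooth_mx U SF := smooth_mxM oU sS sF.
have dS r z : U z -> pd_mx r S z = nu r z *: S z + S z *m C r z + (C r z)^T *m S z.
  move=> Uz; have := recG Uz r; rewrite /nabla_S => <-.
  by apply/matrixP => i j; rewrite !(addmxE, oppmxE); ring.
have dSV r z : U z -> pd_mx r SV z = nu r z *: SV z + (C r z)^T *m SV z + col r (SF z).
  move=> Uz; rewrite (pd_mxM oU r Uz sS sV) dS // pd_vect // /SV /SF.
  have -> : col r (S z *m F z) = S z *m col r (F z) by rewrite !colE mulmxA.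
  rewrite !(mulmxBr, mulmxDl) -scalemxAl !mulmxA.
  by apply/matrixP => i j; rewrite !(addmxE, oppmxE); ring.
have dSF r z : U z -> pd_mx r SF z = nu r z *: SF z + (C r z)^T *m SF z + SF z *m C r z
    + (n%:R - 1)^-1 *: (col r (S z) *m (SV z)^T - SV z *m row r (S z)).
  move=> Uz; rewrite (pd_mxM oU r Uz sS sF) dS // (pd_nabla_mx oU sG se aff r Uz).
  rewrite curvature_contraction // /SV /SF colE.
  have sB (k : R) (X Y : 'M[R]_n) : S z *m (k *: (X - Y)) = k *: (S z *m X - S z *m Y).
    by rewrite -scalemxAr mulmxBr.
  move: (F z) => Fz; rewrite [S z *m (_ + _)]mulmxDr sB mulmxBr !mulmxDl -scalemxAl !mulmxA.
  by apply/matrixP => i j; rewrite !(addmxE, oppmxE); ring.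
have DV : dominated_mx u SV by move=> i j; rewrite (ord1 j); exact: (dominated_unknown p rho u (inl i)).
have DF : dominated_mx u SF by move=> i j; exact: (dominated_unknown p rho u (inr (i, j))).
have H : forall y, B y -> forall a, u a y = 0.
  apply: (dominated_ode_zero (u := u)) Bp _.
  - case=> [i|[i j]]; [exact: smooth_on_sub BU (sSV i 0)|exact: smooth_on_sub BU (sSF i j)].
  - have eV r : dominated_mx u (pd_mx r SV).
      apply: (dominated_mx_eq (fun z Bz => dSV r z (BU Bz))).
      apply: dominated_mxD; last by move=> i j; apply: dominated_eq (DF i r) => z _; rewrite mxE.
      apply: (dominated_mxD (dominated_mxZ (@cnu r) DV)).
      exact: dominated_mulmx (smooth_mx_tr oU (sC r)) DV.
    have eF r : dominated_mx u (pd_mx r SF).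
      apply: (dominated_mx_eq (fun z Bz => dSF r z (BU Bz))).
      apply: dominated_mxD; first apply: dominated_mxD; first apply: dominated_mxD.
      + exact: (dominated_mxZ (@cnu r) DF).
      + exact: dominated_mulmx (smooth_mx_tr oU (sC r)) DF.
      + exact: dominated_mulmxr (sC r) DF.
      apply: (@dominated_mxZ _ _ _ _ (fun=> (n%:R - 1)^-1)); first by move=> z _; exact: continuous_const.
      have sc : smooth_mx U (fun z => col r (S z)).
        by move=> i j; apply: (smooth_on_eq oU _ (sS i r)) => z _; rewrite [RHS]mxE.
      have sr : smooth_mx U (fun z => row r (S z)).
        by move=> i j; apply: (smooth_on_eq oU _ (sS r j)) => z _; rewrite [RHS]mxE.
      apply: dominated_mxD.
        apply: (dominated_mulmx sc) => i j; apply: dominated_eq (DV j i) => z _.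
        by rewrite mxE.
      apply: dominated_mxN; exact: dominated_mulmxr sr DV.
    move=> r [i|[i j]] /=; [have := eV r i 0|have := eF r i j];
    by apply: dominated_eq => z _; rewrite pd_mxE.
  - by case=> [i|[i j]] /=; rewrite ?/SV ?/SF ?v0 ?f0 mxE.
move=> z Bz; split; apply/matrixP => i j; rewrite [RHS]mxE.
  by rewrite (ord1 j); exact: (H z Bz (inl i)).
exact: (H z Bz (inr (i, j))).
Qed.

End Kernel.
End Field.
End KernelJets.

(** * Jets in the kernel as solutions of one linear connection *)

Section ProportionalJets.
Context {R : realType} {n : nat} (U : set 'rV[R]_n) (oU : open U).
Context (p : 'rV[R]_n) (rho : R).
Hypothesis rhoU : forall z, `|z - p| <= rho -> U z.
Hypothesis rho0 : 0 < rho.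
Local Notation B := [set z | `|z - p| < rho].
Let BU : B `<=` U. Proof. by move=> z /ltW /rhoU. Qed.
Let Bp : B p. Proof. by rewrite /= subrr normr0. Qed.

(* The difference of the two sides is a four-index unknown solving a linear
   homogeneous system. *)
Lemma bilinear_unique (q s : nat) (C : 'I_n -> 'rV[R]_n -> 'M[R]_q) (D : 'I_n -> 'rV[R]_n -> 'M[R]_s)
  (W1 W2 W3 W4 : 'rV[R]_n -> 'M[R]_(q, s)) :
  (forall r, smooth_mx U (C r)) -> (forall r, smooth_mx U (D r)) ->
  smooth_mx U W1 -> smooth_mx U W2 -> smooth_mx U W3 -> smooth_mx U W4 ->
  (forall r z, B z -> pd_mx r W1 z = W1 z *m D r z - C r z *m W1 z) ->
  (forall r z, B z -> pd_mx r W2 z = W2 z *m D r z - C r z *m W2 z) ->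
  (forall r z, B z -> pd_mx r W3 z = W3 z *m D r z - C r z *m W3 z) ->
  (forall r z, B z -> pd_mx r W4 z = W4 z *m D r z - C r z *m W4 z) ->
  (forall a b k l, W1 p a k * W4 p b l = W2 p a l * W3 p b k) ->
  forall z, B z -> forall a b k l, W1 z a k * W4 z b l = W2 z a l * W3 z b k.
Proof.
move=> sC sD s1 s2 s3 s4 d1 d2 d3 d4 h0.
pose u (t : 'I_q * 'I_q * ('I_s * 'I_s)) z :=
  W1 z t.1.1 t.2.1 * W4 z t.1.2 t.2.2 - W2 z t.1.1 t.2.2 * W3 z t.1.2 t.2.1.
suff H : forall z, B z -> forall t, u t z = 0.
  by move=> z Bz a b k l; apply/eqP; rewrite -subr_eq0; apply/eqP; exact: (H z Bz (a, b, (k, l))).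
have su t : smooth_on U (u t).
  have h1 := smoothM oU (s1 t.1.1 t.2.1) (s4 t.1.2 t.2.2).
  exact: (smoothB oU h1 (smoothM oU (s2 t.1.1 t.2.2) (s3 t.1.2 t.2.1))).
apply: (dominated_ode_zero (u := u)) Bp _.
- by move=> t; exact: smooth_on_sub BU (su t).
- move=> r [[a b] [k l]].
  have du i j x y : dominated p rho u (u (i, j, (x, y))) by exact: dominated_unknown.
  have cC i j z : U z -> {for z, continuous (fun z => C r z i j)}.
    by move=> Uz; exact: smooth_cont (sC r i j) Uz.
  have cD i j z : U z -> {for z, continuous (fun z => D r z i j)}.
    by move=> Uz; exact: smooth_cont (sD r i j) Uz.
  have t1 := dominated_sum (index_enum 'I_q) (fun i => dominatedM rhoU (cC a i) (du i b k l)).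
  have t2 := dominated_sum (index_enum 'I_q) (fun i => dominatedM rhoU (cC b i) (du a i k l)).
  have t3 := dominated_sum (index_enum 'I_s) (fun i => dominatedM rhoU (cD i k) (du a b i l)).
  have t4 := dominated_sum (index_enum 'I_s) (fun i => dominatedM rhoU (cD i l) (du a b k i)).
  apply: dominated_eq (dominatedB (dominatedB (dominatedD t3 t4) t1) t2) => z Bz.
  have Uz := BU Bz; rewrite /u /=.
  rewrite (smooth_pdB oU _ Uz (smoothM oU (s1 a k) (s4 b l)) (smoothM oU (s2 a l) (s3 b k))).
  rewrite (smooth_pdM _ Uz (s1 a k) (s4 b l)) (smooth_pdM _ Uz (s2 a l) (s3 b k)) -!pd_mxE.
  rewrite d1 // d2 // d3 // d4 // !addmxE !oppmxE ![(_ *m _) _ _]mxE.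
  rewrite !mulrDl !mulrDr !mulNr !mulrN !mulr_suml !mulr_sumr.
  rewrite !opprD !opprK.
  have E (I : finType) (f g h : I -> R) : (forall i, f i = g i - h i) ->
      \sum_i f i = \sum_i g i - \sum_i h i by move=> fE; rewrite -sumrB; exact: eq_bigr.
  rewrite (E _ (fun i => D r z i k * (W1 z a i * W4 z b l - W2 z a l * W3 z b i))
    (fun i => W1 z a i * D r z i k * W4 z b l) (fun i => W2 z a l * (W3 z b i * D r z i k))); last by move=> i; ring.
  rewrite (E _ (fun i => D r z i l * (W1 z a k * W4 z b i - W2 z a i * W3 z b k))
    (fun i => W1 z a k * (W4 z b i * D r z i l)) (fun i => W2 z a i * D r z i l * W3 z b k)); last by move=> i; ring.
  rewrite (E _ (fun i => C r z a i * (W1 z i k * W4 z b l - W2 z i l * W3 z b k))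
    (fun i => C r z a i * W1 z i k * W4 z b l) (fun i => C r z a i * W2 z i l * W3 z b k)); last by move=> i; ring.
  rewrite (E _ (fun i => C r z b i * (W1 z a k * W4 z i l - W2 z a l * W3 z i k))
    (fun i => W1 z a k * (C r z b i * W4 z i l)) (fun i => W2 z a l * (C r z b i * W3 z i k))); last by move=> i; ring.
  ring.
- by case=> -[a b] [k l]; rewrite /u /= h0 subrr.
Qed.

Context (G : conn_comp R n) (sG : smooth_conn U G).
Hypothesis symG : forall z, U z -> forall i r s, G z i r s = G z i s r.
Local Notation S := (ricci_sym G).
Local Notation C := (conn_mx G).
Hypothesis curvG : forall z, U z -> forall s r t j, curv_mx G s r z t j =
  (n%:R - 1)^-1 * ((s == t)%:R * S z j r - (r == t)%:R * S z j s).
Variable nu : 'I_n -> 'rV[R]_n -> R.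
Hypothesis cnu : forall t z, U z -> {for z, continuous (nu t)}.
Hypothesis recG : forall z, U z -> forall t, nabla_S G t z = nu t z *: S z.

(* On jets lying in ker S the equation of infinitesimal affine transformations
   is the linear connection [jet_conn]. *)
Definition jet_mx (eta : vect_comp R n) z : 'M[R]_(n, 1 + n) :=
  row_mx (eta z)^T (nabla_mx G eta z).

Definition jet_conn r z : 'M[R]_(1 + n) :=
  block_mx 0 (- (n%:R - 1)^-1 *: row r (S z)) (delta_mx r 0) (C r z).

Lemma smooth_row_mx q s t (X : 'rV[R]_n -> 'M[R]_(q, s)) (Y : 'rV[R]_n -> 'M[R]_(q, t)) :
  smooth_mx U X -> smooth_mx U Y -> smooth_mx U (fun z => row_mx (X z) (Y z)).
Proof.
move=> sX sY i j; case: (split_ordP j) => k ->.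
  by apply: (smooth_on_eq oU _ (sX i k)) => z _; rewrite row_mxEl.
by apply: (smooth_on_eq oU _ (sY i k)) => z _; rewrite row_mxEr.
Qed.

Lemma smooth_col_mx q s t (X : 'rV[R]_n -> 'M[R]_(q, s)) (Y : 'rV[R]_n -> 'M[R]_(t, s)) :
  smooth_mx U X -> smooth_mx U Y -> smooth_mx U (fun z => col_mx (X z) (Y z)).
Proof.
move=> sX sY i j; case: (split_ordP i) => k ->.
  by apply: (smooth_on_eq oU _ (sX k j)) => z _; rewrite col_mxEu.
by apply: (smooth_on_eq oU _ (sY k j)) => z _; rewrite col_mxEd.
Qed.

Lemma smooth_jet_conn r : smooth_mx U (jet_conn r).
Proof.
have s0 : smooth_mx U (fun=> 0 : 'M[R]_1) := smooth_mx_cst oU _.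
have s1 : smooth_mx U (fun=> delta_mx r 0 : 'cV[R]_n) := smooth_mx_cst oU _.
have s2 : smooth_mx U (fun z => - (n%:R - 1)^-1 *: row r (S z)).
  have h : smooth_mx U (fun z => row r (S z)).
    by move=> i j; apply: (smooth_on_eq oU _ (smooth_ricci_sym oU sG r j)) => z _; rewrite [RHS]mxE.
  exact: (smooth_mxZ oU (smooth_cst oU _) h).
exact: (smooth_col_mx (smooth_row_mx s0 s2) (smooth_row_mx s1 (smooth_conn_mx oU r sG))).
Qed.

Lemma smooth_jet_mx eta : smooth_vect U eta -> smooth_mx U (jet_mx eta).
Proof. by move=> se; exact: (smooth_row_mx (smooth_vect_tr oU se) (smooth_nabla_mx oU sG se)). Qed.

Lemma jet_mx_ode eta : smooth_vect U eta -> (forall z, U z -> infinitesimal_affine eta G z) ->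
  S p *m jet_mx eta p = 0 ->
  forall r z, B z -> pd_mx r (jet_mx eta) z = jet_mx eta z *m jet_conn r z - C r z *m jet_mx eta z.
Proof.
move=> se aff; rewrite mul_mx_row => /eqP; rewrite row_mx_eq0 => /andP[/eqP v0 /eqP f0] r z Bz.
have Uz := BU Bz.
have [SV0 SF0] := kernel_jet oU rhoU rho0 sG symG curvG se aff cnu recG v0 f0 Bz.
rewrite /jet_mx /jet_conn mul_row_block mul_mx_row opp_row_mx add_row_mx.
apply/matrixP => i j; rewrite pd_mxE; case: (split_ordP j) => k ->.
  rewrite row_mxEl.
  transitivity (pd_mx r (fun z => (eta z)^T) z i k).
    by rewrite pd_mxE; apply: pd_ext => w; rewrite row_mxEl.
  rewrite (pd_vect symG _ r Uz) colE mulmx0 add0r (ord1 k).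
  by [].
rewrite row_mxEr; transitivity (pd_mx r (nabla_mx G eta) z i k).
  by rewrite pd_mxE; apply: pd_ext => w; rewrite row_mxEr.
rewrite (pd_nabla_mx oU sG se aff r Uz) (curvature_contraction curvG eta r Uz) SV0.
rewrite trmx0 mulmx0 sub0r scalerN -scaleNr -scalemxAr.
by move: (_ *: (_ *m _)) (C r z *m _) (_ *m C r z) => X Y Z; rewrite !(addmxE, oppmxE); ring.
Qed.

(** At [p] both products are v_a w_b xi_l when [k] is the value column and [l] a derivative column,
    and zero otherwise. [bilinear_unique] carries the equality to [z], where the value columns give
    the claim. *)
Lemma proportional_jets (v0 vj w0 wj : vect_comp R n) (v w : 'cV[R]_n) (xi : 'rV[R]_n) :
  smooth_vect U v0 -> smooth_vect U vj -> smooth_vect U w0 -> smooth_vect U wj ->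
  (forall z, U z -> infinitesimal_affine v0 G z) -> (forall z, U z -> infinitesimal_affine vj G z) ->
  (forall z, U z -> infinitesimal_affine w0 G z) -> (forall z, U z -> infinitesimal_affine wj G z) ->
  S p *m v = 0 -> S p *m w = 0 ->
  jet_mx v0 p = row_mx v 0 -> jet_mx vj p = row_mx 0 (v *m xi) ->
  jet_mx w0 p = row_mx w 0 -> jet_mx wj p = row_mx 0 (w *m xi) ->
  forall z, B z -> forall a b, v0 z 0 a * wj z 0 b = vj z 0 a * w0 z 0 b.
Proof.
move=> sv0 svj sw0 swj av0 avj aw0 awj Sv Sw jv0 jvj jw0 jwj z Bz a b.
have k0 x : S p *m x = 0 -> S p *m row_mx x (0 : 'M[R]_n) = 0.
  by move=> h; rewrite mul_mx_row h mulmx0 row_mx0.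
have kj x : S p *m x = 0 -> S p *m row_mx (0 : 'cV[R]_n) (x *m xi) = 0.
  by move=> h; rewrite mul_mx_row mulmxA h mulmx0 mul0mx row_mx0.
have := @bilinear_unique n (1 + n) C jet_conn (jet_mx v0) (jet_mx vj) (jet_mx w0) (jet_mx wj)
  (fun r => smooth_conn_mx oU r sG) smooth_jet_conn
  (smooth_jet_mx sv0) (smooth_jet_mx svj) (smooth_jet_mx sw0) (smooth_jet_mx swj)
  (jet_mx_ode sv0 av0 _) (jet_mx_ode svj avj _) (jet_mx_ode sw0 aw0 _) (jet_mx_ode swj awj _).
rewrite jv0 jvj jw0 jwj !k0 // !kj // => /(_ erefl erefl erefl erefl) H.
have {}H := H _ z Bz a b (lshift n 0) (lshift n 0); rewrite /jet_mx !row_mxEl !mxE in H.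
have z0E q s (i : 'I_q) (j : 'I_s) : (0 : 'M[R]_(q, s)) i j = 0 by rewrite mxE.
apply: H => i j k l; case: (split_ordP k) => k' ->; case: (split_ordP l) => l' ->;
  rewrite ?row_mxEl ?row_mxEr ?z0E ?mul0r ?mulr0 //.
by rewrite ![(_ *m xi) _ _]mxE !big_ord1 !(ord1 k'); ring.
Qed.

End ProportionalJets.

Lemma open_nonzero {R : realType} {n : nat} (U : set 'rV[R]_n) (f : 'rV[R]_n -> R) :
  open U -> smooth_on U f -> open (U `&` [set z | f z != 0]).
Proof.
move=> oU sf; rewrite openE => z [Uz fz]; rewrite /interior /=.
have h1 := open_near oU Uz; have h2 := cvgr_neq0 _ (smooth_cont sf Uz) fz.
by near=> w; split; [near: w; exact: h1|near: w; exact: h2].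
Unshelve. all: by end_near. Qed.

(** * Symmetries that generate the new coordinates *)

Section ProjectiveCoordinates.
Context {R : realType} {n m : nat} (hn : (2 <= n)%N) (M : smooth_manifold R n).
Context (G : chart R n M -> conn_comp R n) (A : chart R n M -> op_comp R n).
Hypothesis hM : connected [set: M].
Hypothesis sG : forall c, atlas M c -> smooth_conn (cimg c) (G c).
Hypothesis symG : symmetric_connection G.
Hypothesis m0 : (0 < m)%N.
Hypothesis mn : (m < n)%N.
Hypothesis hrank : forall c, atlas M c -> forall y, cimg c y -> \rank (ricci_sym (G c) y) = m.
Hypothesis hdim : vect_dim [set eta | point_symmetry A G eta]
            (n * (n + 1 - m) + (m * (m - 1)) %/ 2)%N.

(** The columns of [P] with index at least [m] span ker S(p), and the rows of its inverse are the
    dual coframe, so the coordinate directions from [m] on will be the kernel directions at [p]. *)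
Lemma proportional_symmetries c p (P : 'M[R]_n) (s : 'rV[R]_n) : atlas M c -> cimg c p ->
  P \in unitmx -> P^T *m ricci_sym (G c) p *m P = diag_mx s ->
  (forall i : 'I_n, (s 0 i != 0) = (i < m)%N) ->
  exists (zeta : 'I_n -> chart R n M -> vect_comp R n)
    (h : 'I_n -> 'I_n -> chart R n M -> vect_comp R n) (rho : R),
  [/\ 0 < rho, forall z, `|z - p| < rho -> cimg c z,
      forall a : 'I_n, (m <= a)%N -> [/\ point_symmetry A G (zeta a), zeta a c p = (col a P)^T
        & nabla_mx (G c) (zeta a c) p = 0],
      forall a j : 'I_n, (m <= a)%N -> [/\ point_symmetry A G (h a j), h a j c p = 0
        & diff_mx (h a j c) p = col a P *m row j (invmx P)]
    & forall z, `|z - p| < rho -> forall a b j : 'I_n, (m <= a)%N -> (m <= b)%N ->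
        forall k l, zeta a c z 0 k * h b j c z 0 l = h a j c z 0 k * zeta b c z 0 l].
Proof.
move=> Mc cp uP dP hs; set S := ricci_sym (G c).
have Sk (a : 'I_n) : (m <= a)%N -> S p *m col a P = 0.
  move=> ma; apply: (diag_kernel uP dP); apply/eqP.
  by rewrite -[_ == 0]negbK hs -leqNgt.
have [zeta hz] : {zeta : 'I_n -> chart R n M -> vect_comp R n & forall a : 'I_n, (m <= a)%N ->
    [/\ point_symmetry A G (zeta a), zeta a c p = (col a P)^T & nabla_mx (G c) (zeta a c) p = 0]}.
  apply: (@choice _ _ (fun (a : 'I_n) z => (m <= a)%N -> [/\ point_symmetry A G z,
    z c p = (col a P)^T & nabla_mx (G c) (z c) p = 0])) => a.
  (* For a < m the column is not in the kernel; zero is a placeholder on which nothing is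
     required. *)
  have [ma|ma] := leqP m a; last by exists (fun _ _ => 0).
  by have [z sz [e f]] := kernel_exists hn hM sG mn hrank hdim Mc cp (Sk a ma); exists z.
have [h hh] : {h : 'I_n * 'I_n -> chart R n M -> vect_comp R n & forall aj : 'I_n * 'I_n, (m <= aj.1)%N ->
    [/\ point_symmetry A G (h aj), h aj c p = 0
      & diff_mx (h aj c) p = col aj.1 P *m row aj.2 (invmx P)]}.
  apply: (@choice _ _ (fun (aj : 'I_n * 'I_n) z => (m <= aj.1)%N -> [/\ point_symmetry A G z, z c p = 0
      & diff_mx (z c) p = col aj.1 P *m row aj.2 (invmx P)])) => -[a j] /=.
  have [ma|ma] := leqP m a; last by exists (fun _ _ => 0).
  have [z sz [e f]] := outer_exists hM sG mn hrank hdim Mc (row j (invmx P)) cp (Sk a ma).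
  by exists z.
have oU : open (cimg c) := @cimg_open _ _ _ c.
have sS := smooth_ricci_sym oU (sG Mc).
have [i0 [j0 S0]] : exists i j, S p i j != 0.
  apply: contrapT => h0; have Z : S p = 0.
    apply/matrixP => i j; rewrite [RHS]mxE; apply/eqP; apply: contra_notT h0 => Sij.
    by exists i, j.
  by move: m0; rewrite -(hrank Mc cp) -/S Z mxrank0.
pose U := cimg c `&` [set z | S z i0 j0 != 0].
have oU' : open U := open_nonzero oU (sS i0 j0).
have UU : U `<=` cimg c by move=> z [].
have [rho rho0 rhoU] := closed_ball_in oU' (conj cp S0 : U p).
exists zeta, (fun a j => h (a, j)), rho; split=> //.
- by move=> z /ltW /rhoU /UU.
- by move=> a j ma; exact: (hh (a, j) ma).
move=> z Bz a b j ma mb k l.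
(* [nabla_recurrent] yields the factor point by point. Dividing by an entry of S that does not
   vanish on [U] gives a continuous factor, as domination requires. *)
pose nu t z := nabla_S (G c) t z i0 j0 / S z i0 j0.
have cnu t y : U y -> {for y, continuous (nu t)}.
  move=> [cy Sy]; apply: continuousM; last first.
    by apply: continuousV => //; exact: smooth_cont (sS i0 j0) cy.
  have sC := smooth_conn_mx oU t (sG Mc).
  have s1 := smooth_mxD oU (smooth_mx_pd oU t sS) (smooth_mxN oU (smooth_mxM oU sS sC)).
  have s2 := smooth_mxN oU (smooth_mxM oU (smooth_mx_tr oU sC) sS).
  exact: smooth_cont (smooth_mxD oU s1 s2 i0 j0) cy.
have recG y : U y -> forall t, nabla_S (G c) t y = nu t y *: S y.
  move=> [cy Sy] t; have [[nu' /(_ t) e] _] := nabla_recurrent hn hM sG mn hrank hdim Mc cy.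
  by rewrite /nu e scalemxE mulfK.
have sv eta : point_symmetry A G eta -> smooth_vect U (eta c).
  by move=> se i; exact: smooth_on_sub UU (smooth_symmetry Mc se i).
have av eta : point_symmetry A G eta -> forall z, U z -> infinitesimal_affine (eta c) (G c) z.
  by move=> se y [cy _]; exact: (affine_symmetry Mc se cy).
have [[sza ez fz] [szb ez' fz']] := (hz a ma, hz b mb).
have [[sha e f] [shb e' f']] := (hh (a, j) ma, hh (b, j) mb).
have nabla0 eta : eta c p = 0 -> nabla_mx (G c) (eta c) p = diff_mx (eta c) p.
  by move=> e0; rewrite /nabla_mx big1 ?addr0 // => i _; rewrite e0 mxE scale0r.
apply: (proportional_jets oU' rhoU rho0 _ _ _ cnu recG (sv _ sza) (sv _ sha) (sv _ szb) (sv _ shb)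
  (av _ sza) (av _ sha) (av _ szb) (av _ shb) (Sk a ma) (Sk b mb) _ _ _ _ Bz).
- by move=> i r t; exact: smooth_on_sub UU (sG Mc i r t).
- by move=> y [cy _]; exact: symG.
- by move=> y [cy _] *; exact: (curvature_form hn hM sG symG mn hrank hdim Mc).
- by rewrite /jet_mx ez fz trmxK.
- by rewrite /jet_mx nabla0 // f e trmx0.
- by rewrite /jet_mx ez' fz' trmxK.
- by rewrite /jet_mx nabla0 // f' e' trmx0.
Qed.

End ProjectiveCoordinates.

(** * Poincare's lemma *)

Section Poincare.
Context {R : realType} {k : nat} (rho : R).
Local Notation B := [set y : 'rV[R]_k | `|y - 0| < rho].
Context (phi : 'I_k -> 'rV[R]_k -> R).
Hypothesis sphi : forall j, smooth_on B (phi j).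
Hypothesis closed_phi : forall y, B y -> forall i j, pd i (phi j) y = pd j (phi i) y.
Let oB : open B. Proof. exact: open_normball. Qed.

Let Bscale (y : 'rV[R]_k) (t : R) : B y -> 0 <= t <= 1 -> B (t *: y).
Proof.
rewrite /= !subr0 normrZ => By /andP[t0 t1]; apply: le_lt_trans By.
by rewrite ger0_norm // ler_piMl.
Qed.

(** Integrand of the radial homotopy operator, psi(y) being its integral over t from 0 to 1. *)
Let f (y : 'rV[R]_k) (t : R) := \sum_j phi j (t *: y) * y 0 j.

Let smooth_f t : 0 <= t <= 1 -> smooth_on B (f^~ t).
Proof.
move=> t01; apply: (smooth_sum oB) => j; apply: (smoothM oB) (smooth_coord oB j).
apply: (smooth_comp oB oB _ (sphi j)) => [y By|i]; first exact: Bscale.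
have h := smoothM oB (smooth_cst oB t) (smooth_coord oB i).
by apply: (smooth_on_eq oB _ h) => z _; rewrite mxE.
Qed.

(** Closedness exchanges the two indices of the derivative, so that the result is d/dt (t phi_j(t
    y)) and integrates to phi_j(y). *)
Let pd_f t j y : 0 <= t <= 1 -> B y ->
  pd j (f^~ t) y = phi j (t *: y) + t * \sum_l pd l (phi j) (t *: y) * y 0 l.
Proof.
move=> t01 By; have Bty := Bscale By t01.
have sZ i : smooth_on B (fun z : 'rV[R]_k => (t *: z) 0 i).
  have h := smoothM oB (smooth_cst oB t) (smooth_coord oB i).
  by apply: (smooth_on_eq oB _ h) => z _; rewrite mxE.
have sp l : smooth_on B (fun z => phi l (t *: z)).
  by apply: (smooth_comp oB oB _ (sphi l) sZ) => z Bz; exact: Bscale.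
rewrite (smooth_pd_sum oB _ j By (fun l => smoothM oB (sp l) (smooth_coord oB l))).
have pl l : pd j (fun z => phi l (t *: z)) y = t * pd j (phi l) (t *: y).
  rewrite (pd_comp j oB By Bty (sphi l) sZ) (bigD1 j) //= big1 => [|i ij].
    rewrite addr0 mulrC; congr (_ * _).
    have -> : pd j (fun z : 'rV[R]_k => (t *: z) 0 j) y = pd j (fun z => t * z 0 j) y.
      by apply: pd_ext => z; rewrite mxE.
    rewrite (smooth_pdM _ By (smooth_cst oB t) (smooth_coord oB j)) pd_cst pd_coord eqxx.
    by rewrite mul0r add0r mulr1.
  have -> : pd j (fun z : 'rV[R]_k => (t *: z) 0 i) y = pd j (fun z => t * z 0 i) y.
    by apply: pd_ext => z; rewrite mxE.
  rewrite (smooth_pdM _ By (smooth_cst oB t) (smooth_coord oB i)) pd_cst pd_coord eq_sym.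
  by rewrite (negbTE ij) !mulr0 mul0r addr0 mulr0.
under eq_bigr do rewrite (smooth_pdM _ By (sp _) (smooth_coord oB _)) pl pd_coord.
rewrite big_split /= addrC; congr (_ + _).
  rewrite (bigD1 j) //= eqxx mulr1 big1 ?addr0 // => l lj.
  by rewrite eq_sym (negbTE lj) mulr0.
by rewrite mulr_sumr; apply: eq_bigr => l _; rewrite (closed_phi Bty j l) mulrA.
Qed.

Let ray_derive g y (t : R) : smooth_on B g -> 0 <= t <= 1 -> B y ->
  is_derive t 1 (fun s : R => g (s *: y)) (\sum_l pd l g (t *: y) * y 0 l).
Proof.
move=> sg t01 By; have df := smooth_differentiable oB sg (Bscale By t01).
have -> : (fun s : R => g (s *: y)) = (fun s : R => g (0 + s *: y)).
  by apply: funext => s; rewrite add0r.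
have -> : \sum_l pd l g (t *: y) * y 0 l = 'D_y g (0 + t *: y).
  rewrite add0r (differentiable_derive y df).
  by apply: eq_bigr => l _; rewrite mulrC.
by apply: is_derive_line; rewrite add0r; exact: diff_derivable.
Qed.

Let ray_continuous g y (t : R) : smooth_on B g -> 0 <= t <= 1 -> B y ->
  {for t, continuous (fun s : R => g (s *: y))}.
Proof.
move=> sg t01 By; have [d _] := ray_derive sg t01 By.
by apply: differentiable_continuous; apply/derivable1_diffP.
Qed.

Let psi (y : 'rV[R]_k) : R := \int[lebesgue_measure]_(t in `[0%R, 1%R]) f y t.

Let continuous_f y (t : R) : 0 <= t <= 1 -> B y -> {for t, continuous (f y)}.
Proof.
move=> t01 By; apply: continuous_bigsum => j; apply: continuousM; last exact: continuous_const.
exact: ray_continuous (sphi j) t01 By.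
Qed.

Let integrable_f y : B y -> lebesgue_measure.-integrable `[0%R, 1%R] (EFin \o f y).
Proof.
move=> By; apply: continuous_compact_integrable; first exact: segment_compact.
apply: continuous_in_subspaceT => t; rewrite inE /= in_itv /= => t01.
exact: continuous_f.
Qed.

Let psi_derive j y : B y -> derivable psi y (delta_mx 0 j) /\ pd j psi y = phi j y.
Proof.
move=> By; pose e : 'rV[R]_k := delta_mx 0 j; pose F x t := f (y + x *: e) t.
have By0 : `|y| < rho by rewrite /= subr0 in By.
(* Half the distance left to the boundary: displacements below [d] stay in a closed ball inside [B],
   where continuous functions are bounded. *)
pose d := (rho - `|y|) / 2.
have d0 : 0 < d by rewrite divr_gt0 // subr_gt0.
have e1 : `|e| <= 1.
  apply/(rV_norm_le _ ler01) => i; rewrite mxE eqxx /=.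
  by case: (i == j); rewrite ?normr1 ?normr0.
have near_y x : x \in `]- d, d[ -> `|y + x *: e - 0| < `|y| + d.
  rewrite in_itv /= -ltr_norml => xd; rewrite subr0; apply: le_lt_trans (ler_normD _ _) _.
  rewrite ltrD2l normrZ; apply: le_lt_trans xd; rewrite -[leRHS]mulr1.
  exact: ler_wpM2l.
have dB z : `|z - 0| <= `|y| + d -> B z.
  move=> h; apply: le_lt_trans h _; rewrite /d; move: By0; lra.
have BI x : x \in `]- d, d[ -> B (y + x *: e) by move=> /near_y /ltW; exact: dB.
(* By [pd_f], with |z_l| < rho, the derivative of the integrand is at most C + rho C once [C] bounds
   [g]; this is the integrable majorant. *)
pose g z := `|phi j z| + \sum_l `|pd l (phi j) z|.
have cg z : B z -> {for z, continuous g}.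
  move=> Bz; apply: continuousD.
    by apply: continuous_comp; [exact: smooth_cont (sphi j) Bz|exact: norm_continuous].
  apply: continuous_bigsum => l; apply: continuous_comp; last exact: norm_continuous.
  exact: smooth_cont (smooth_on_pd l (sphi j)) Bz.
have [C C0 hC] := continuous_bounded dB cg.
have dF x t : x \in `]- d, d[ -> t \in `[0, 1] ->
    is_derive x 1 (F^~ t) (pd j (f^~ t) (y + x *: e)).
  rewrite [t \in _]in_itv /= => Ix t01; rewrite pdE; apply: is_derive_line.
  exact: smooth_derivable (smooth_f t01) (BI x Ix).
have d1F x t : x \in `]- d, d[ -> t \in `[0, 1] -> partial1of2 F x t = pd j (f^~ t) (y + x *: e).
  by move=> Ix It; rewrite partial1of2E; have [_ ->] := dF x t Ix It.
have I0 : (0 : R) \in `]- d, d[ by rewrite in_itv /= oppr_lt0 d0.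
have derF x t : x \in `]- d, d[ -> t \in `[0, 1] -> derivable (F^~ t) x 1.
  by move=> Ix It; have [] := dF x t Ix It.
have g_ub x t : x \in `]- d, d[ -> t \in `[0, 1] -> `|partial1of2 F x t| <= (1 + rho) * C.
  move=> Ix It; have t01 : 0 <= t <= 1 by move: It; rewrite in_itv.
  have /andP[t0 t1] := t01; rewrite d1F // (pd_f j t01 (BI x Ix)); set z := y + x *: e.
  have Bz := BI x Ix; have gz := hC (t *: z).
  have {gz} : `|g (t *: z)| <= C.
    apply: gz; rewrite /= subr0 normrZ ger0_norm //; have := near_y x Ix; rewrite subr0.
    by apply: le_lt_trans; exact: ler_piMl.
  rewrite ger0_norm ?addr_ge0 ?sumr_ge0 // => gC; apply: le_trans (ler_normD _ _) _.
  have rho0 : 0 <= rho by apply: le_trans (ltW By0).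
  rewrite mulrDl mul1r lerD //.
    by apply: le_trans gC; rewrite lerDl sumr_ge0.
  rewrite normrM (ger0_norm t0); apply: (@le_trans _ _ `|\sum_l pd l (phi j) (t *: z) * z 0 l|).
    exact: ler_piMl.
  apply: le_trans (ler_norm_sum _ _ _) _.
  apply: (@le_trans _ _ (rho * \sum_l `|pd l (phi j) (t *: z)|)).
    rewrite mulr_sumr; apply: ler_sum => l _; rewrite normrM mulrC ler_wpM2r //.
    by apply: le_trans (rV_coord_le _ _) _; apply: ltW; move: Bz; rewrite /= subr0.
  by rewrite ler_wpM2l //; apply: le_trans gC; rewrite lerDr.
have G0 : forall t : R, 0 <= (1 + rho) * C.
  by move=> _; rewrite mulr_ge0 // addr_ge0 //; exact: le_trans (ltW By0).
have intG : lebesgue_measure.-integrable `[0%R, 1%R] (EFin \o (fun _ : R => (1 + rho) * C)).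
  apply: continuous_compact_integrable; first exact: segment_compact.
  by apply: continuous_in_subspaceT => u _; exact: continuous_const.
have key := @cvg_differentiation_under_integral R _ _ lebesgue_measure F `[0%R, 1%R]%classic
  (measurable_itv _) 0 (- d) d I0 (fun x Ix => integrable_f (BI x Ix)) derF _ G0 intG g_ub.
have ftc : \int[lebesgue_measure]_(t in `[0%R, 1%R]) partial1of2 F 0 t = phi j y.
  have E (t : R) : t \in `[0, 1] -> partial1of2 F 0 t =
      phi j (t *: y) + t * \sum_l pd l (phi j) (t *: y) * y 0 l.
    move=> It; have t01 : 0 <= t <= 1 by move: It; rewrite in_itv.
    by rewrite d1F // scale0r addr0 (pd_f j t01 By).
  pose H t := t * phi j (t *: y).
  have dH (t : R) : 0 <= t <= 1 ->
      is_derive t 1 H (phi j (t *: y) + t * \sum_l pd l (phi j) (t *: y) * y 0 l).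
    move=> t01; have h := is_deriveM (is_derive_id t (1 : R)) (ray_derive (sphi j) t01 By).
    by apply: is_derive_eq h _; rewrite /GRing.scale /= mulr1 addrC.
  have cH (t : R) : 0 <= t <= 1 -> {for t, continuous H}.
    move=> t01; have [h _] := dH t t01.
    by apply: differentiable_continuous; apply/derivable1_diffP.
  rewrite /Rintegral.
  rewrite (@continuous_FTC2 R (partial1of2 F 0) H 0 1 ltr01) /=.
  - by rewrite /H scale1r mul1r mul0r subr0.
  - have E' : {in `[0, 1]%classic, (fun t : R => phi j (t *: y) + t * \sum_l pd l (phi j) (t *: y) * y 0 l)
        =1 partial1of2 F 0}.
      by move=> t /set_mem It; rewrite E.
    apply: (subspace_eq_continuous E'); apply: continuous_in_subspaceT => t.
    rewrite inE /= in_itv /= => t01.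
    have c1 := ray_continuous (sphi j) t01 By.
    have c2 : {for t, continuous (fun u : R => \sum_l pd l (phi j) (u *: y) * y 0 l)}.
      apply: continuous_bigsum => l; apply: continuousM; last exact: continuous_const.
      exact: ray_continuous (smooth_on_pd l (sphi j)) t01 By.
    exact: cvgD c1 (cvgM cvg_id c2).
  - split=> [t||].
    + rewrite in_itv /= => /andP[/ltW t0 /ltW t1].
      by have [] := dH t (introT andP (conj t0 t1)).
    + by apply: cvg_at_right_filter; apply: cH; rewrite lexx ler01.
    + by apply: cvg_at_left_filter; apply: cH; rewrite lexx ler01.
  - move=> t It; have t01 : 0 <= t <= 1.
      by move: It; rewrite in_itv /= => /andP[/ltW -> /ltW ->].
    by have [_ h] := dH t t01; rewrite derive1E h E.
have key2 : (fun h : R => h^-1 *: ((psi \o shift y) (h *: e) - psi y)) @ 0^' --> phi j y.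
  rewrite -ftc; move: key; apply: cvg_trans; apply: near_eq_cvg.
  apply: nearW => h.
  change (h^-1 *: (psi (y + (h + 0) *: e) - psi (y + 0 *: e)) =
          h^-1 *: (psi (h *: e + y) - psi y)).
  by rewrite addr0 scale0r addr0 [h *: e + y]addrC.
split; first by apply/cvg_ex; exists (phi j y); exact: key2.
by rewrite pdE; apply: cvg_lim key2.
Qed.

Lemma poincare : exists2 psi : 'rV[R]_k -> R, smooth_on B psi &
  forall y, B y -> forall j, pd j psi y = phi j y.
Proof.
exists psi => [s y By|y By j]; last exact: (psi_derive j By).2.
(* The innermost derivative of [psi] is a smooth phi_i, so only the empty sequence needs a separate
   argument. *)
have [s0|[s' [i si]]] : s = [::] \/ exists s' i, s = rcons s' i.
  by case/lastP: s => [|s' i]; [left|right; exists s', i].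
  rewrite s0 /=; split=> [|i]; last exact: (psi_derive i By).1.
  apply: differentiable_continuous.
  apply: (C1_differentiable oB By _ _).1 => [z Bz i|i]; first exact: (psi_derive i Bz).1.
  have h := smooth_cont (sphi i) By.
  apply: (smooth_cont _ By); apply: (smooth_on_eq oB _ (sphi i)) => z Bz.
  by rewrite (psi_derive i Bz).2.
have sp : smooth_on B (pd i psi).
  by apply: (smooth_on_eq oB _ (sphi i)) => z Bz; rewrite (psi_derive i Bz).2.
by rewrite si iter_pd_rcons; exact: sp.
Qed.

End Poincare.

(** * Projective normal form *)

Lemma affine_mul_algebra {R : comRingType} (a b c d e q1 q2 q3 q4 q5 q6 q7 q8 : R) :
  b = q2 + c ->
  a * q8 + q7 * b = q1 * q8 + q4 * q5 + (q3 * q6 + q7 * q2) + (q7 * c + (q3 * d + q4 * e)) ->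
  (q1 - a) * q8 + q4 * (q5 + e) + q3 * (q6 + d) = 0.
Proof.
move=> -> E; rewrite mulrBl; have -> : q1 * q8 = a * q8 + q7 * (q2 + c) - (q4 * q5 + (q3 * q6 + q7 * q2))
    - (q7 * c + (q3 * d + q4 * e)) by rewrite E; ring.
by ring.
Qed.

Section ProjectiveChart.
Context {R : realType} {n : nat} (U : set 'rV[R]_n) (oU : open U).
Context (G : conn_comp R n).
Hypothesis symG : forall z, U z -> forall i r s, G z i r s = G z i s r.

(** Subtracting h times the equation of [eta] from that of h eta leaves the covariant Hessian of h
    times eta, plus dh multiplied symmetrically with nabla eta. *)
Lemma affine_mul (h : 'rV[R]_n -> R) (eta zeta : vect_comp R n) y :
  smooth_on U h -> smooth_vect U eta -> (forall z, U z -> zeta z = h z *: eta z) -> U y ->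
  infinitesimal_affine eta G y -> infinitesimal_affine zeta G y -> forall i r s,
  (pd r (pd s h) y - \sum_k pd k h y * G y k r s) * eta y 0 i
  + pd s h y * nabla_mx G eta y i r + pd r h y * nabla_mx G eta y i s = 0.
Proof.
move=> sh se he Uy ae az i r s.
have sz k z : U z -> zeta z 0 k = h z * eta z 0 k by move=> /he ->; rewrite mxE.
have dz k l z : U z -> pd l (fun z => zeta z 0 k) z = pd l h z * eta z 0 k + h z * pd l (fun z => eta z 0 k) z.
  move=> Uz; rewrite (pd_eq_on oU l Uz (fun z Uz => sz k z Uz)).
  exact: smooth_pdM Uz sh (se k).
have d2 : pd r (pd s (fun z => zeta z 0 i)) y = pd r (pd s h) y * eta y 0 i
    + pd s h y * pd r (fun z => eta z 0 i) y
    + (pd r h y * pd s (fun z => eta z 0 i) y + h y * pd r (pd s (fun z => eta z 0 i)) y).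
  have s1 := smooth_on_pd s sh; have s2 := smooth_on_pd s (se i).
  rewrite (pd_eq_on oU r Uy (fun z Uz => dz i s z Uz)).
  rewrite (smooth_pdD _ Uy (smoothM oU s1 (se i)) (smoothM oU sh s2)).
  by rewrite (smooth_pdM _ Uy s1 (se i)) (smooth_pdM _ Uy sh s2).
have N k : nabla_mx G eta y i k = pd k (fun z => eta z 0 i) y + \sum_l eta y 0 l * G y i l k.
  rewrite /nabla_mx addmxE [diff_mx _ _ _ _]mxE summxE; congr (_ + _).
  by apply: eq_bigr => l _; rewrite !mxE.
have := az i r s; have := ae i r s; rewrite d2 !N => E E'.
have F1 : \sum_k pd k (fun z => zeta z 0 i) y * G y k r s =
    (\sum_k pd k h y * G y k r s) * eta y 0 i + h y * \sum_k pd k (fun z => eta z 0 i) y * G y k r s.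
  rewrite mulr_suml mulr_sumr -big_split /=; apply: eq_bigr => k _.
  rewrite dz //; ring.
have F2 : \sum_k (pd k (fun z => G z i r s) y * zeta y 0 k + G y i k s * pd r (fun z => zeta z 0 k) y
      + G y i r k * pd s (fun z => zeta z 0 k) y) =
    h y * (\sum_k (pd k (fun z => G z i r s) y * eta y 0 k + G y i k s * pd r (fun z => eta z 0 k) y
      + G y i r k * pd s (fun z => eta z 0 k) y)) + (pd r h y * \sum_l eta y 0 l * G y i l s
      + pd s h y * \sum_l eta y 0 l * G y i l r).
  rewrite !mulr_sumr -!big_split /=; apply: eq_bigr => k _.
  rewrite !dz // sz // (symG Uy i r k); ring.
rewrite F1 F2 in E'.
exact: affine_mul_algebra E E'.
Qed.

(** No summation over r: if Gamma^j_rs = delta^j_s phi_r + delta^j_r phi_s, then Gamma^r_rr = 2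
    phi_r. *)
Definition proj_form y r : R := 2^-1 * G y r r r.

Section Coordinates.
Context (eta : vect_comp R n) (h : 'I_n -> vect_comp R n).
Hypothesis se : smooth_vect U eta.
Hypothesis he : forall j z, U z -> h j z = z 0 j *: eta z.
Hypothesis ae : forall z, U z -> infinitesimal_affine eta G z.
Hypothesis ah : forall j z, U z -> infinitesimal_affine (h j) G z.

(** [affine_mul] for h the coordinate y^j, whose second derivatives vanish, so that its covariant
    Hessian is -Gamma^j_rs. *)
Lemma coordinate_affine y i j r s : U y ->
  G y j r s * eta y 0 i = (s == j)%:R * nabla_mx G eta y i r + (r == j)%:R * nabla_mx G eta y i s.
Proof.
move=> Uy; have := affine_mul (smooth_coord oU j) se (he j) Uy (ae Uy) (@ah j y Uy) i r s.
rewrite !pd_coord.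
have -> : pd r (pd s (fun z : 'rV[R]_n => z 0 j)) y = 0.
  by rewrite (pd_eq_on (g := fun=> (s == j)%:R) oU r Uy (fun z _ => pd_coord s j z)) pd_cst.
under eq_bigr do rewrite pd_coord mulrC.
rewrite sum_delta sub0r mulNr -addrA addrC => /eqP; rewrite subr_eq0 => /eqP ->.
by [].
Qed.

Lemma coordinate_nabla y i r : U y -> nabla_mx G eta y i r = proj_form y r * eta y 0 i.
Proof.
move=> Uy; rewrite /proj_form -mulrA (coordinate_affine i r r r Uy) eqxx !mul1r.
by move: (nabla_mx G eta y i r) => x; field.
Qed.

Lemma coordinate_connection y i j r s : U y -> eta y 0 i != 0 ->
  G y j r s = (j == s)%:R * proj_form y r + (j == r)%:R * proj_form y s.
Proof.
move=> Uy nz; apply: (mulIf nz); rewrite coordinate_affine // !coordinate_nabla //.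
rewrite [j == s]eq_sym [j == r]eq_sym; ring.
Qed.

End Coordinates.
End ProjectiveChart.

(** The identity T(X(y)) = y^i differentiated twice; it trades the second derivatives of X in the
    transformation law of a connection for those of T. *)
Lemma inverse_second_derivative {R : realType} {k : nat} (U V : set 'rV[R]_k) (X : 'rV[R]_k -> 'rV[R]_k)
  (T : 'rV[R]_k -> R) i y r s : open U -> open V -> (forall z, U z -> V (X z)) ->
  (forall j, smooth_on U (fun z => X z 0 j)) -> smooth_on V T ->
  (forall z, U z -> T (X z) = z 0 i) -> U y ->
  \sum_a pd a T (X y) * (pd r (pd s (fun z => X z 0 a)) y) +
  \sum_a \sum_b pd b (pd a T) (X y) * (pd r (fun z => X z 0 b) y * pd s (fun z => X z 0 a) y) = 0.
Proof.
move=> oU oV UV sX sT TX Uy.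
have E z : U z -> \sum_a pd a T (X z) * pd s (fun z => X z 0 a) z = (s == i)%:R.
  move=> Uz; rewrite -(pd_comp s oV Uz (UV z Uz) sT sX) -(pd_coord s i z).
  by apply: (pd_eq_on oU s Uz) => w Uw; exact: TX.
have sTX a : smooth_on U (fun z => pd a T (X z)).
  exact: (smooth_comp oU oV UV (smooth_on_pd a sT) sX).
have := pd_eq_on oU r Uy E; rewrite pd_cst.
rewrite (smooth_pd_sum oU _ r Uy (fun a => smoothM oU (sTX a) (smooth_on_pd s (sX a)))) => E2.
rewrite -[RHS]E2 -big_split /=; apply: eq_bigr => a _.
rewrite (smooth_pdM _ Uy (sTX a) (smooth_on_pd s (sX a))) addrC; congr (_ + _).
rewrite (pd_comp r oV Uy (UV y Uy) (smooth_on_pd a sT) sX) mulr_suml.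
by apply: eq_bigr => b _; rewrite mulrA.
Qed.

(** Along the segment each coordinate is either fixed or one on which f does not depend. This serves
    both constancy and independence of the last coordinates. *)
Lemma const_along {R : realType} {k : nat} (x0 : 'rV[R]_k) (r : R) (f : 'rV[R]_k -> R) a b :
  let B := [set z | `|z - x0| < r] in
  smooth_on B f -> B a -> B b ->
  (forall i, b 0 i = a 0 i \/ forall z, B z -> pd i f z = 0) -> f b = f a.
Proof.
move=> B sf Ba Bb h; pose v := b - a; have oB : open B by exact: open_normball.
have Bt (t : R) : 0 <= t <= 1 -> B (a + t *: v).
  by move=> t01; apply: (path_in_ball Ba Bb) => i; exists t => //; rewrite !mxE.
have df (t : R) : 0 <= t <= 1 -> differentiable f (a + (t * 1) *: v).
  by move=> t01; rewrite mulr1; exact: smooth_differentiable oB sf (Bt t t01).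
have dv (t : R) : 0 <= t <= 1 -> derivable f (a + (t * 1) *: v) v.
  by move=> t01; apply: diff_derivable; exact: df.
have [t t01] := mvt_line dv.
rewrite scale1r mul1r (differentiable_derive v (df t t01)) big1 => [|i _].
  have -> : a + v = b by rewrite /v addrC subrK.
  by move/eqP; rewrite subr_eq0 => /eqP.
case: (h i) => [ab|-> //]; first by rewrite !mxE ab subrr mul0r.
  by rewrite mulr0.
by rewrite mulr1; exact: Bt.
Qed.

(** * Ratios of symmetries as local coordinates *)

Section ProjectiveChartExists.
Context {R : realType} {n m : nat} (hn : (2 <= n)%N) (M : smooth_manifold R n).
Context (G : chart R n M -> conn_comp R n) (A : chart R n M -> op_comp R n).
Hypothesis hM : connected [set: M].
Hypothesis hG : affine_connection G.
Hypothesis symG : symmetric_connection G.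
Hypothesis m0 : (0 < m)%N.
Hypothesis mn : (m < n)%N.
Hypothesis hrank : forall c, atlas M c -> forall y, cimg c y -> \rank (ricci_sym (G c) y) = m.
Hypothesis hdim : vect_dim [set eta | point_symmetry A G eta]
            (n * (n + 1 - m) + (m * (m - 1)) %/ 2)%N.

Lemma projective_chart p : exists (d : chart R n M) (r : R)
    (zeta : 'I_n -> chart R n M -> vect_comp R n)
    (h : 'I_n -> 'I_n -> chart R n M -> vect_comp R n),
  [/\ [/\ atlas M d, cdom d p, 0 < r & cimg d = [set y | `|y - 0| < r]],
      forall a : 'I_n, (m <= a)%N -> point_symmetry A G (zeta a) /\
        forall j, point_symmetry A G (h a j) /\
        forall y, cimg d y -> h a j d y = y 0 j *: zeta a d y,
      forall a : 'I_n, (m <= a)%N -> forall i, zeta a d 0 0 i = (i == a)%:R,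
      exists2 o : 'I_n, (m <= o)%N & forall y, cimg d y -> exists i, zeta o d y 0 i != 0
    & forall i r s, G d 0 i r s = 0].
Proof.
have [c Mc cp] := atlas_cover p; pose x0 := cmap c p.
have cx0 : cimg c x0 by exists p.
have two : 2 != 0 :> R by rewrite pnatr_eq0.
have [P [s [uP dP hs]]] := symmetric_diag_rank two (ricci_symT _ _) (hrank Mc cx0).
have [zeta [h [rho [rho0 rhoc hz hh prop]]]] :=
  proportional_symmetries hn hM hG.1 symG m0 mn hrank hdim Mc cx0 uP dP hs.
pose o := Ordinal mn; have mo : (m <= o)%N by [].
have [k0 Pk0] : exists k0, P k0 o != 0.
  apply: contrapT => h0; suff : (1%:M : 'M[R]_n) o o = 0 by rewrite mxE eqxx => /eqP; rewrite oner_eq0.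
  rewrite -(mulVmx uP) mxE big1 // => k _; apply/eqP; rewrite mulf_eq0; apply/orP; right.
  by apply: contra_notT h0 => Pk; exists k.
pose B0 := [set z | `|z - x0| < rho]; have oB0 : open B0 by exact: open_normball.
have B0c : B0 `<=` cimg c by move=> z /rhoc.
have sz (a : 'I_n) : (m <= a)%N -> forall i, smooth_on B0 (fun z => zeta a c z 0 i).
  by move=> ma i; have [sy _ _] := hz a ma; exact: smooth_on_sub B0c (smooth_symmetry Mc sy i).
have sh (a j : 'I_n) : (m <= a)%N -> forall i, smooth_on B0 (fun z => h a j c z 0 i).
  by move=> ma i; have [sy _ _] := hh a j ma; exact: smooth_on_sub B0c (smooth_symmetry Mc sy i).
pose V := B0 `&` [set z | zeta o c z 0 k0 != 0].
have oV : open V := open_nonzero oB0 (sz o mo k0).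
have VB : V `<=` B0 by move=> z [].
have zx0 (a i : 'I_n) : (m <= a)%N -> zeta a c x0 0 i = P i a.
  by move=> ma; have [_ -> _] := hz a ma; rewrite !mxE.
have Vx0 : V x0 by split; rewrite /= ?zx0 // /B0 /= subrr normr0.
(* By proportionality the ratio is the same for every kernel index and component; index [o], the
   first kernel direction, and component [k0] are used because the denominator is nonzero at
   [x0]. *)
pose Y z : 'rV[R]_n := \row_j (h o j c z 0 k0 / zeta o c z 0 k0).
have sY j : smooth_on V (fun z => Y z 0 j).
  have s1 := smoothV oV (fun z (Vz : V z) => Vz.2) (smooth_on_sub VB (sz o mo k0)).
  have s2 := smoothM oV (smooth_on_sub VB (sh o j mo k0)) s1.
  by apply: (smooth_on_eq oV _ s2) => z _; rewrite mxE.
have hY (a j : 'I_n) z : (m <= a)%N -> V z -> h a j c z = Y z 0 j *: zeta a c z.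
  move=> ma [Bz nz]; apply/rowP => l; rewrite scalemxE mxE.
  have := prop z Bz o a j mo ma k0 l => E.
  by apply: (mulfI nz); rewrite E mulrA [_ * (_ / _)]mulrC divfK.
have Yx0 : Y x0 = 0.
  apply/rowP => j; rewrite mxE; have [_ -> _] := hh o j mo.
  by rewrite !mxE mul0r.
have dYx0 l j : pd l (fun z => Y z 0 j) x0 = invmx P j l.
  have -> : pd l (fun z => Y z 0 j) x0 = pd l (fun z => h o j c z 0 k0 * (zeta o c z 0 k0)^-1) x0.
    by apply: pd_ext => z; rewrite mxE.
  have s1 := smoothV oV (fun z (Vz : V z) => Vz.2) (smooth_on_sub VB (sz o mo k0)).
  rewrite (smooth_pdM _ Vx0 (smooth_on_sub VB (sh o j mo k0)) s1).
  have [_ hx0 dh] := hh o j mo; rewrite hx0 [(0 : 'rV_n) 0 k0]mxE mul0r addr0 zx0 //.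
  have -> : pd l (fun z => h o j c z 0 k0) x0 = diff_mx (h o j c) x0 k0 l by rewrite mxE.
  by rewrite dh mxE big_ord1 !mxE mulrAC divff ?mul1r.
have uJ : jacobian_rows Y x0 \in unitmx.
  rewrite (_ : jacobian_rows Y x0 = (invmx P)^T) ?unitmx_tr ?unitmx_inv //.
  by apply/matrixP => l j; rewrite [LHS]mxE dYx0 [RHS]mxE.
have [d [r [Md dp r0 imd dY]]] :=
  chart_of_coordinates Mc cp oV (fun z Vz => B0c z (VB z Vz)) Vx0 sY uJ.
rewrite Yx0 in imd.
have d0 : cmap d p = 0 by have [_ _ ->] := dY p dp.
have TY i z : overlap c d z -> transition c d i z = Y z 0 i.
  by move=> [q [cq dq] <-]; rewrite transition_cmap //; have [_ _ ->] := dY q dq.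
have oT : open (overlap c d) := @overlap_open _ _ _ c d.
have oX : open (overlap d c) := @overlap_open _ _ _ d c.
have ox0 : overlap c d x0 by exists p.
have o0 : overlap d c 0 by exists p.
have dT l i : pd l (transition c d i) x0 = invmx P i l.
  by rewrite -dYx0; apply: (pd_eq_on oT l ox0) => z oz; exact: TY.
have law eta q i : point_symmetry A G eta -> cdom d q ->
    eta d (cmap d q) 0 i = \sum_j pd j (transition c d i) (cmap c q) * eta c (cmap c q) 0 j.
  by move=> [[_ l] _] dq; have [cq _ _] := dY q dq; exact: (l c d Mc Md q cq dq i).
exists d, r, zeta, h; split=> //.
- move=> a ma; have [sya _ _] := hz a ma; split=> // j; have [syh _ _] := hh a j ma; split=> //.
  move=> y [q dq <-]; have [cq Vq Yq] := dY q dq; apply/rowP => i.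
  rewrite scalemxE !law // mulr_sumr; apply: eq_bigr => l _.
  by rewrite (hY a j _ ma Vq) scalemxE -Yq mulrCA.
- move=> a ma i; have [sya _ _] := hz a ma; rewrite -[X in zeta a d X]d0 law //.
  rewrite -/x0; have -> : (i == a)%:R = (invmx P *m P) i a by rewrite mulVmx // mxE.
  by rewrite mxE; apply: eq_bigr => l _; rewrite dT zx0.
- exists o => // y [q dq <-]; have [cq [_ /= nz] _] := dY q dq; have [[[_ l] _] _ _] := hz o mo.
  apply: contrapT => z0; move/eqP: nz; apply; rewrite (l d c Md Mc q dq cq k0) big1 // => i _.
  suff -> : zeta o d (cmap d q) 0 i = 0 by rewrite mulr0.
  by apply/eqP; apply: contra_notT z0 => zi; exists i.
move=> i r' s'.
(* As nabla zeta_o = 0 at [x0], [affine_mul] says that the covariant Hessian of each new coordinate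
   vanishes there, which amounts to Gamma = 0 at the origin of the new chart. *)
have hessY a b : pd a (pd b (transition c d i)) x0 =
    \sum_k pd k (transition c d i) x0 * G c x0 k a b.
  have [syz _ nz] := hz o mo; have [syh _ _] := hh o i mo.
  have sV : smooth_vect V (zeta o c) by move=> l; exact: smooth_on_sub VB (sz o mo l).
  have symV z : V z -> forall i r s, G c z i r s = G c z i s r.
    by move=> Vz; exact: symG Mc _ (B0c _ (VB _ Vz)).
  have := affine_mul oV symV (sY i) sV (fun z => @hY o i z mo) Vx0
    (affine_symmetry Mc syz cx0) (affine_symmetry Mc syh cx0) k0 a b.
  have zE u w : (0 : 'M[R]_n) u w = 0 by rewrite mxE.
  rewrite nz (zE k0 a) (zE k0 b) !mulr0 !addr0 => /eqP.
  rewrite zx0 // mulf_eq0 (negbTE Pk0) orbF subr_eq0 => /eqP E.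
  have dTY l z : overlap c d z -> pd l (transition c d i) z = pd l (fun z => Y z 0 i) z.
    by move=> oz; apply: (pd_eq_on oT l oz) => w ow; exact: TY.
  rewrite (pd_eq_on oT a ox0 (fun z oz => dTY b z oz)) E.
  by apply: eq_bigr => l _; rewrite dTY.
have [_ lawG] := hG; have := lawG c d Mc Md p cp dp i r' s'; rewrite /= d0 -/x0 => ->.
have [sT _] := atlas_compatible Mc Md i.
have sX j : smooth_on (overlap d c) (fun z => cmap c (cinv d z) 0 j).
  by have [] := atlas_compatible Md Mc j.
have XO z : overlap d c z -> overlap c d (cmap c (cinv d z)).
  by move=> [q [dq cq] <-]; rewrite cmapK //; exists q.
have TX z : overlap d c z -> transition c d i (cmap c (cinv d z)) = z 0 i.
  by move=> [q [dq cq] <-]; rewrite cmapK // transition_cmap.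
have X0 : cmap c (cinv d 0) = x0 by rewrite -d0 cmapK.
have := inverse_second_derivative r' s' oX oT XO sX sT TX o0; rewrite X0 => E.
rewrite -[RHS]E; under eq_bigr do rewrite mulrDr.
rewrite big_split /=; congr (_ + _).
transitivity (\sum_a \sum_b pd r' (transition d c a) 0 * pd s' (transition d c b) 0 *
    pd a (pd b (transition c d i)) x0).
  under eq_bigr do rewrite mulr_sumr.
  rewrite exchange_big /=; apply: eq_bigr => a _.
  under eq_bigr do rewrite mulr_sumr.
  rewrite exchange_big /=; apply: eq_bigr => b _.
  by rewrite hessY mulr_sumr; apply: eq_bigr => k _; rewrite mulrCA.
rewrite exchange_big /=; apply: eq_bigr => b _; apply: eq_bigr => a _.
by rewrite mulrC.
Qed.

End ProjectiveChartExists.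

(** * Normalising the symmetries and the projective one-form *)

Section FlatProjectiveForm.
Context {R : realType} {n m : nat} (hn : (2 <= n)%N) (M : smooth_manifold R n).
Context (G : chart R n M -> conn_comp R n) (A : chart R n M -> op_comp R n).
Hypothesis hM : connected [set: M].
Hypothesis hG : affine_connection G.
Hypothesis symG : symmetric_connection G.
Hypothesis m0 : (0 < m)%N.
Hypothesis mn : (m < n)%N.
Hypothesis hrank : forall c, atlas M c -> forall y, cimg c y -> \rank (ricci_sym (G c) y) = m.
Hypothesis hdim : vect_dim [set eta | point_symmetry A G eta]
            (n * (n + 1 - m) + (m * (m - 1)) %/ 2)%N.

Lemma projective_normal_form p : exists (d : chart R n M) (r : R) (phi : 'I_n -> 'rV[R]_n -> R),
  [/\ [/\ atlas M d, cdom d p, 0 < r & cimg d = [set y | `|y - 0| < r]],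
      forall i, smooth_on (cimg d) (phi i),
      forall y, cimg d y -> forall j r s,
        G d y j r s = (j == s)%:R * phi r y + (j == r)%:R * phi s y,
      forall y, cimg d y -> forall a : 'I_n, (m <= a)%N ->
        phi a y = 0 /\ forall s, pd a (phi s) y = 0
    & forall y, cimg d y -> forall r s, pd r (phi s) y = pd s (phi r) y].
Proof.
have [d [r [zeta [h [[Md dp r0 imd] sy z0 [ o mo nz] G0]]]]] :=
  projective_chart hn hM hG symG m0 mn hrank hdim p.
have oU : open (cimg d) := @cimg_open _ _ _ d.
have sG := hG.1 d Md.
pose phi i y := proj_form (G d) y i.
have sphi i : smooth_on (cimg d) (phi i) := smoothM oU (smooth_cst oU 2^-1) (sG i i i).
have sz (a : 'I_n) : (m <= a)%N -> smooth_vect (cimg d) (zeta a d).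
  by move=> ma; exact: (smooth_symmetry Md (sy a ma).1).
have az (a : 'I_n) : (m <= a)%N -> forall z, cimg d z -> infinitesimal_affine (zeta a d) (G d) z.
  by move=> ma; exact: (affine_symmetry Md (sy a ma).1).
have symd z : cimg d z -> forall i r s, G d z i r s = G d z i s r by move=> cz; exact: symG Md z cz.
have hE (a j : 'I_n) z : (m <= a)%N -> cimg d z -> h a j d z = z 0 j *: zeta a d z.
  by move=> ma; exact: ((sy a ma).2 j).2.
have ah (a j : 'I_n) : (m <= a)%N -> forall z, cimg d z -> infinitesimal_affine (h a j d) (G d) z.
  by move=> ma; exact: (affine_symmetry Md ((sy a ma).2 j).1).
have GE y : cimg d y -> forall j r s,
    G d y j r s = (j == s)%:R * phi r y + (j == r)%:R * phi s y.
  move=> dy j r' s'; have [i zi] := nz y dy.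
  exact: (coordinate_connection oU symd (sz o mo) (fun j z => @hE o j z mo) (az o mo)
    (fun j => ah o j mo) j r' s' dy zi).
(* Combine nabla zeta = phi (x) zeta with the form of Gamma: the terms phi_l zeta^i cancel and only
   a multiple of the identity is left. *)
have dz (a i l : 'I_n) y : (m <= a)%N -> cimg d y ->
    pd l (fun z => zeta a d z 0 i) y = - ((i == l)%:R * \sum_k phi k y * zeta a d y 0 k).
  move=> ma dy.
  have := coordinate_nabla oU symd (sz a ma) (fun j z => @hE a j z ma) (az a ma)
    (fun j => ah a j ma) i l dy.
  rewrite /nabla_mx addmxE [diff_mx _ _ _ _]mxE summxE -/(phi l y).
  have -> : \sum_k (zeta a d y 0 k *: conn_mx (G d) k y) i l =
      (i == l)%:R * (\sum_k phi k y * zeta a d y 0 k) + phi l y * zeta a d y 0 i.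
    rewrite -(sum_delta (fun k => phi l y * zeta a d y 0 k) i) mulr_sumr -big_split /=.
    apply: eq_bigr => k _; rewrite scalemxE [conn_mx _ _ _ _ _]mxE GE // [i == k]eq_sym; ring.
  by rewrite addrA -[X in _ = X]add0r => /addIr/eqP; rewrite addr_eq0 => /eqP.
have dU : [set y | `|y - 0| < r] `<=` cimg d by rewrite imd.
have d0 : cimg d 0 by rewrite imd /= subrr normr0.
have constD f : smooth_on (cimg d) f -> (forall i z, cimg d z -> pd i f z = 0) ->
    forall y, cimg d y -> f y = f 0.
  move=> sf f0 y dy; apply: (@const_along R n 0 r).
  - exact: smooth_on_sub dU sf.
  - by rewrite -imd.
  - by rewrite -imd.
  - by move=> i; right => z Bz; apply: f0; rewrite imd.
have phi0 i : phi i 0 = 0 by rewrite /phi /proj_form G0 mulr0.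
pose theta (a : 'I_n) y := \sum_k phi k y * zeta a d y 0 k.
have stheta (a : 'I_n) : (m <= a)%N -> smooth_on (cimg d) (theta a).
  by move=> ma; exact: (smooth_sum oU _ (fun k => smoothM oU (sphi k) (sz a ma k))).
(* For i different from l, theta = -d_i zeta^i while d_l zeta^i = 0; commuting derivatives gives d_l
   theta = 0. So theta is constant, and it vanishes at 0 together with Gamma. *)
have theta0 (a : 'I_n) y : (m <= a)%N -> cimg d y -> theta a y = 0.
  move=> ma dy; rewrite (constD _ (stheta a ma) _ y dy) => [|l z dzz].
    by rewrite /theta big1 // => k _; rewrite phi0 mul0r.
  have [i il] := other_index hn l.
  have E w : cimg d w -> theta a w = - pd i (fun z => zeta a d z 0 i) w.
    by move=> dw; rewrite dz // eqxx mul1r opprK.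
  rewrite (pd_eq_on oU l dzz E) (smooth_pdN oU l dzz (smooth_on_pd i (sz a ma i))).
  rewrite (pd_comm l i oU dzz (sz a ma i)).
  have E0 w : cimg d w -> pd l (fun z => zeta a d z 0 i) w = 0.
    by move=> dw; rewrite dz // (negbTE il) mul0r oppr0.
  by rewrite (pd_eq_on (g := fun=> 0) oU i dzz E0) pd_cst oppr0.
have dz0 (a i l : 'I_n) y : (m <= a)%N -> cimg d y -> pd l (fun z => zeta a d z 0 i) y = 0.
  by move=> ma dy; rewrite dz // -/(theta a y) theta0 // mulr0 oppr0.
have zE (a i : 'I_n) y : (m <= a)%N -> cimg d y -> zeta a d y 0 i = (i == a)%:R.
  move=> ma dy; rewrite -z0 //; apply: (constD (fun z => zeta a d z 0 i) (sz a ma i)) => //.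
  by move=> l z dzz; exact: dz0.
have phiE (a : 'I_n) y : (m <= a)%N -> cimg d y -> phi a y = 0.
  move=> ma dy; rewrite -(theta0 a y ma dy) /theta.
  by under eq_bigr do rewrite zE //; rewrite sum_delta.
exists d, r, phi; split=> //.
- move=> y dy a ma; split=> [|s']; first exact: phiE.
  (* zeta_a is now the coordinate field d/dy^a, and its being affine means that Gamma does not
     depend on y^a. *)
  have := az a ma y dy s' s' s'.
  rewrite big1 => [|k _]; last by rewrite dz0 // mul0r.
  rewrite (pd_eq_on (g := fun=> 0) oU s' dy (fun z dzz => dz0 a s' s' z ma dzz)) pd_cst add0r.
  under eq_bigr do rewrite !dz0 // !mulr0 !addr0 zE //.
  rewrite sum_delta => E.
  by rewrite (smooth_pdM a dy (smooth_cst oU 2^-1) (sG s' s' s')) pd_cst -E mul0r mulr0 addr0.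
move=> y dy u w.
(* The commutator in the curvature is traceless, so the trace of R(u, w) is (n + 1) times d_u phi_w
   - d_w phi_u, and its vanishing is closedness. *)
have trC l z : cimg d z -> \tr (conn_mx (G d) l z) = (n%:R + 1) * phi l z.
  move=> dzz; rewrite /mxtrace; transitivity (\sum_i (phi l z + phi i z * (i == l)%:R)).
    by apply: eq_bigr => i _; rewrite mxE GE // eqxx mul1r [_%:R * _]mulrC.
  by rewrite big_split /= sumr_const card_ord sum_delta mulrDl mul1r mulr_natl.
have dC k l : \tr (pd_mx k (conn_mx (G d) l) y) = (n%:R + 1) * pd k (phi l) y.
  have sC i := smooth_conn_mx oU l sG i i.
  transitivity (pd k (fun z => \tr (conn_mx (G d) l z)) y).
    by rewrite /mxtrace (smooth_pd_sum oU _ k dy sC); apply: eq_bigr => i _; exact: pd_mxE.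
  rewrite (pd_eq_on oU k dy (trC l)) (smooth_pdM k dy (smooth_cst oU _) (sphi l)) pd_cst.
  by rewrite mul0r add0r.
have := curvature_trace hn hM hG.1 symG mn hrank hdim Md u w dy.
rewrite /curv_mx mxtraceD !raddfB /= [\tr (_ *m conn_mx (G d) w y)]mxtrace_mulC subrr addr0.
rewrite !dC -mulrBr => /eqP; rewrite mulf_eq0 gt_eqF ?ltr_wpDl //= subr_eq0.
by move/eqP.
Qed.

End FlatProjectiveForm.

Lemma sum_quadratic {R : comRingType} {n : nat} (phi : 'I_n -> R) (u : 'rV[R]_n) (j : 'I_n) :
  \sum_r \sum_s ((j == s)%:R * phi r + (j == r)%:R * phi s) * u 0 r * u 0 s =
  2 * (\sum_r phi r * u 0 r) * u 0 j.
Proof.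
have D (f : 'I_n -> R) : \sum_k (j == k)%:R * f k = f j.
  rewrite (bigD1 j) //= eqxx mul1r big1 ?addr0 // => k kj.
  by rewrite eq_sym (negbTE kj) mul0r.
transitivity (\sum_r (phi r * u 0 r * u 0 j + (j == r)%:R * (u 0 r * \sum_s phi s * u 0 s))).
  apply: eq_bigr => r _.
  rewrite -(D (fun s => phi r * u 0 r * u 0 s)) !mulr_sumr -big_split /=.
  by apply: eq_bigr => s _; ring.
by rewrite big_split /= D -mulr_suml; ring.
Qed.

Theorem theorem17p3 (R : realType) (n : nat) (hn : (2 <= n)%N)
  (M : smooth_manifold R n) (hM : connected [set: M])
  (G : chart R n M -> conn_comp R n)
  (hG : affine_connection G) (hGsym : symmetric_connection G)
  (A : chart R n M -> op_comp R n)
  (hA : operator_field A) (hAnd : nondegenerate_field A)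
  (m : nat) (hmn : (m <= n)%N)
  (hdeg : degeneration_case G m)
  (hdim : vect_dim [set eta | point_symmetry A G eta]
            (n * (n + 1 - m) + (m * (m - 1)) %/ 2)%N) :
  forall p : M,
  exists (c : chart R n M) (a : R) (W : set 'rV[R]_m) (psi : 'rV[R]_m -> R),
    [/\ atlas M c, cdom c p, open W, smooth_on W psi
      & forall y : 'rV[R]_n, cimg c y ->
          W (first_coords hmn y) /\
          forall (u w : 'rV[R]_n) (i : 'I_n),
            system_rhs (A c) (G c) y u w i =
            a * w 0 i
            - 2 * a * (\sum_(r < m) pd r psi (first_coords hmn y)
                         * u 0 (widen_ord hmn r)) * u 0 i].
Proof.
move=> p; have [m0 mn1 hrank] := hdeg.
have mn : (m < n)%N by rewrite (leq_ltn_trans mn1) // ltn_predL (leq_trans _ hn).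
have [d [r [phi [[Md dp r0 imd] sphi GE phi0 closed]]]] :=
  projective_normal_form hn hM hG hGsym m0 mn hrank hdim p.
have oU : open (cimg d) := @cimg_open _ _ _ d.
pose W := [set x : 'rV[R]_m | `|x - 0| < r]; have oW : open W by exact: open_normball.
have d0 : cimg d 0 by rewrite imd /= subrr normr0.
(* Padding by zeros keeps the sup norm, hence stays in the ball; phi is read off on this slice since
   it does not depend on the remaining coordinates. *)
pose emb (x : 'rV[R]_m) : 'rV[R]_n := \row_i \sum_(l < m) (i == widen_ord hmn l)%:R * x 0 l.
have embE x l : emb x 0 (widen_ord hmn l) = x 0 l.
  rewrite mxE (bigD1 l) //= eqxx mul1r big1 ?addr0 // => k kl.
  by rewrite eq_sym -val_eqE /= val_eqE (negbTE kl) mul0r.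
have emb0 x (i : 'I_n) : (m <= i)%N -> emb x 0 i = 0.
  move=> mi; rewrite mxE big1 // => l _; rewrite -val_eqE /= gtn_eqF ?mul0r //.
  exact: leq_trans (ltn_ord l) mi.
have ordP (i : 'I_n) : (m <= i)%N \/ exists l : 'I_m, i = widen_ord hmn l.
  have [|im] := leqP m i; first by left.
  by right; exists (Ordinal im); apply: val_inj.
have embW x : W x -> cimg d (emb x).
  rewrite /W imd /= !subr0 => /(rV_norm_lt _ r0) xr; apply/(rV_norm_lt _ r0) => i.
  by have [mi|[l ->]] := ordP i; [rewrite emb0 // normr0|rewrite embE].
have firstW y : cimg d y -> W (first_coords hmn y).
  rewrite /W imd /= !subr0 => /(rV_norm_lt _ r0) yr; apply/(rV_norm_lt _ r0) => l.
  by rewrite mxE.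
have semb i : smooth_on W (fun x => emb x 0 i).
  have s1 := smooth_sum oW (index_enum 'I_m) (fun l => smoothM oW (smooth_cst oW (i == widen_ord hmn l)%:R)
    (smooth_coord oW l)).
  by apply: (smooth_on_eq oW _ s1) => x _; rewrite mxE.
have dU : [set y | `|y - 0| < r] `<=` cimg d by rewrite imd.
have phi_emb y l : cimg d y -> phi l (emb (first_coords hmn y)) = phi l y.
  move=> dy; apply: (@const_along R n 0 r); first exact: smooth_on_sub dU (sphi l).
  - by rewrite -imd.
  - by have := embW _ (firstW y dy); rewrite imd.
  move=> i; have [mi|[k ->]] := ordP i; last by left; rewrite embE mxE.
  by right => z; rewrite -imd => dz; have [_ ->] := phi0 z dz i mi.
(* The sign turns the quadratic term 2 phi(u) u^i of the connection into the required -2 dpsi(u)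
   u^i. *)
pose f (l : 'I_m) x := - phi (widen_ord hmn l) (emb x).
have sf l : smooth_on W (f l).
  exact: (smoothN oW (smooth_comp oW oU embW (sphi (widen_ord hmn l)) semb)).
have pd_emb k i x : W x -> pd k (fun x => emb x 0 i) x = (i == widen_ord hmn k)%:R.
  move=> Wx; have [mi|[l ->]] := ordP i.
    rewrite (pd_ext (g := fun=> 0)) ?pd_cst => [|z]; last exact: emb0.
    rewrite -val_eqE /= gtn_eqF //; exact: leq_trans (ltn_ord k) mi.
  rewrite (pd_ext (g := fun z => z 0 l)) => [|z]; last exact: embE.
  by rewrite pd_coord eq_sym -val_eqE.
have pdf x k l : W x -> pd k (f l) x = - pd (widen_ord hmn k) (phi (widen_ord hmn l)) (emb x).
  move=> Wx; rewrite (smooth_pdN oW k Wx (smooth_comp oW oU embW (sphi (widen_ord hmn l)) semb)).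
  rewrite (pd_comp k oU Wx (embW x Wx) (sphi _) semb); congr (- _).
  by under eq_bigr do rewrite pd_emb //; rewrite sum_delta.
have [psi spsi dpsi] : exists2 psi : 'rV[R]_m -> R, smooth_on W psi &
    forall x, W x -> forall l, pd l psi x = f l x.
  by apply: poincare => // x Wx k l; rewrite !pdf // closed //; exact: embW.
have sG c' : atlas M c' -> smooth_conn (cimg c') (G c') by move=> Mc'; exact: hG.1.
have [a Aa] := op_scalar hM sG mn hrank hdim Md d0.
have AE y : cimg d y -> A d y = a%:M.
  move=> dy; rewrite -Aa; apply/matrixP => i j.
  apply: (@const_along R n 0 r (fun z => A d z i j) 0 y).
  - exact: smooth_on_sub dU (hA.1 d Md i j).
  - by rewrite -imd.
  - by rewrite -imd.
  move=> l; right => z; rewrite -imd => dz.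
  by rewrite -pd_mxE (op_constant hM sG mn hrank hdim Md l dz) mxE.
exists d, a, W, psi; split=> // y dy; split=> [|u w i]; first exact: firstW.
have SE : \sum_k phi k y * u 0 k = \sum_(l < m) phi (widen_ord hmn l) y * u 0 (widen_ord hmn l).
  rewrite (bigID (fun k : 'I_n => (k < m)%N)) /= [X in _ + X]big1 ?addr0; last first.
    by move=> k; rewrite -leqNgt => mk; have [-> _] := phi0 y dy k mk; rewrite mul0r.
  exact: (big_ord_narrow hmn).
have -> : \sum_(l < m) pd l psi (first_coords hmn y) * u 0 (widen_ord hmn l) =
    - \sum_k phi k y * u 0 k.
  rewrite SE -sumrN; apply: eq_bigr => l _; rewrite dpsi; last exact: firstW.
  by rewrite /f phi_emb // mulNr.
rewrite /system_rhs AE //.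
transitivity (a * (w 0 i + \sum_r \sum_s G d y i r s * u 0 r * u 0 s)).
  rewrite (bigD1 i) //= mxE eqxx mulr1n [X in _ + X = _]big1 ?addr0 // => j ji.
  by rewrite mxE eq_sym (negbTE ji) mulr0n mul0r.
under eq_bigr do under eq_bigr do rewrite GE //.
by rewrite sum_quadratic; ring.
Qed.
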